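(* Assume that $0<\alpha<1/2$. Then there exists smooth periodic initial data $u_0(x)$ such that the solution $u(x,t)$ of $$u_t=u\,u_x-(-\Delta)^\alpha u,\qquad u(x,0)=u_0(x),$$ blows up in finite time in $H^s$ for each $s>\frac32-2\alpha$.
   Context: All functions are real-valued and have mean zero on the circle $\mathbb S^1$ (equivalently, they are periodic on $\mathbb R$ with period $1$). $H^s$ denotes the $L^2$-based Sobolev space on $\mathbb S^1$ restricted to mean-zero functions, with norm $\|f\|_s=\|(-\Delta)^{s/2}f\|_{L^2}$. $(-\Delta)^\alpha$ is the Fourier multiplier with symbol $|2\pi k|^{2\alpha}$, $k\in\mathbb Z$. For $u_0\in H^s$ with $s>\frac32-2\alpha$ there is a local in time solution in $C([0,T],H^s)$, unique in this class and $C^\infty$ in $x$ for $0<t<T$; ''the solution'' refers to it. Solutions are understood in the weak sense: for every smooth periodic $\varphi(x)$, $(u,\varphi)_t=-\tfrac12(u^2,\varphi_x)-(u,(-\Delta)^\alpha\varphi)$ for a.e. $t$, with $(u,\varphi)(0)=(u_0,\varphi)$, where $(\cdot,\cdot)$ is the $L^2$ pairing. ''Blows up in finite time in $H^s$'' means that the maximal time of existence of the solution in the class $C([0,T),H^s)$ is finite, i.e. there is a finite $T$ such that no solution in $C([0,T],H^s)$ with initial data $u_0$ exists. *)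

(* Defs.v *)
From mathcomp Require Import all_boot all_order all_algebra.
From mathcomp Require Import all_classical all_reals all_analysis.
From mathcomp.real_closed Require Import complex.

Set Implicit Arguments.
Unset Strict Implicit.
Unset Printing Implicit Defensive.
Import Order.TTheory GRing.Theory Num.Theory.
Import numFieldNormedType.Exports.

Local Open Scope classical_set_scope.
Local Open Scope ring_scope.
Local Open Scope complex_scope.

(* A function on the circle R/Z is a 1-periodic function R -> R; integrals over
   the circle are Lebesgue integrals over [0, 1].  Elements of L^2 and of H^s
   are given by representatives: every notion below depends on f only up to
   a.e. equality, apart from [periodic], [smooth] and [mean_zero] of given
   functions. *)

Definition smooth (R : realType) (f : R -> R) : Prop :=
  forall (n : nat) (x : R), derivable (derive1n n f) x 1.

Definition pairing (R : realType) (f g : R -> R) : R :=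
  \int[lebesgue_measure]_(x in `[0, 1]) (f x * g x).

Definition mean_zero (R : realType) (f : R -> R) : Prop :=
  \int[lebesgue_measure]_(x in `[0, 1]) f x = 0.

Definition L2 (R : realType) (f : R -> R) : Prop :=
  f \_ `[0, 1] \in Lfun (@lebesgue_measure R) 2%:E.

Definition L2norm (R : realType) (f : R -> R) : \bar R :=
  'N[lebesgue_measure]_2%:E [EFin \o f \_ `[0, 1]].

(* int_0^1 f(x) e^{-2 pi i k x} dx, for real-valued f *)
Definition fourier (R : realType) (f : R -> R) (k : int) : R[i] :=
  pairing f (fun x => cos (2 * pi * k%:~R * x))
  -i* pairing f (fun x => sin (2 * pi * k%:~R * x)).

(* g = (-Delta)^a f, as the Fourier multiplier with symbol |2 pi k|^{2a}.  For
   f and g in L^2 this determines g up to a.e. equality. *)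
Definition is_fraclap (R : realType) (a : R) (f g : R -> R) : Prop :=
  forall k : int,
    fourier g k = (`|2 * pi * k%:~R| `^ (2 * a))%:C * fourier f k.

(* || (-Delta)^{s/2} f ||_{L^2}: the set has at most one element, and the
   infimum is +oo when (-Delta)^{s/2} f is not an L^2 function. *)
Definition Hnorm (R : realType) (s : R) (f : R -> R) : \bar R :=
  ereal_inf [set L2norm g | g in [set g | L2 g /\ is_fraclap (s / 2) f g]].

(* H^s for s >= 0, where it is a subspace of L^2 *)
Definition Hs (R : realType) (s : R) (f : R -> R) : Prop :=
  [/\ periodic f 1, L2 f, mean_zero f & (Hnorm s f < +oo)%E].

(* u is in C([0, T], H^s), with u t the function x |-> u(x, t) *)
Definition continuous_Hs (R : realType) (T s : R) (u : R -> R -> R) : Prop :=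
  forall t : R, t \in `[0, T] ->
    Hs s (u t) /\
    Hnorm s (u r \- u t) @[r --> within `[0, T] (nbhs t)] --> 0%E.

Definition absolutely_continuous (R : realType) (a b : R) (f : R -> R) : Prop :=
  forall e : R, 0 < e -> exists2 d : R, 0 < d &
    forall (n : nat) (l r : 'I_n -> R),
      (forall i, [/\ a <= l i, l i <= r i & r i <= b]) ->
      (forall i j, i != j -> r i <= l j \/ r j <= l i) ->
      \sum_(i < n) (r i - l i) < d ->
      \sum_(i < n) `|f (r i) - f (l i)| < e.

(* Weak solutions on [0, T].  The identity for a.e. t is an equality of
   derivatives of absolutely continuous functions of t: without this
   requirement an a.e. derivative would not determine (u, phi), because of
   singular functions such as Cantor's.  The function psi is (-Delta)^alpha
   phi, which exists since phi is smooth. *)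
Definition weak_solution (R : realType) (alpha T : R) (u0 : R -> R)
    (u : R -> R -> R) : Prop :=
  forall phi psi : R -> R,
    smooth phi -> periodic phi 1 -> L2 psi -> is_fraclap alpha phi psi ->
    [/\ absolutely_continuous 0 T (fun t => pairing (u t) phi),
        {ae lebesgue_measure, forall t : R, t \in `]0, T[ ->
           is_derive t 1 (fun t => pairing (u t) phi)
             (- (1 / 2) * pairing (fun x => u t x ^+ 2) (derive1 phi)
              - pairing (u t) psi)}
      & pairing (u 0) phi = pairing u0 phi].

Definition solution (R : realType) (alpha s T : R) (u0 : R -> R)
    (u : R -> R -> R) : Prop :=
  continuous_Hs T s u /\ weak_solution alpha T u0 u.

Definition blows_up (R : realType) (alpha s : R) (u0 : R -> R) : Prop :=
  exists2 T : R, 0 < T & ~ exists u : R -> R -> R, solution alpha s T u0 u.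

(* Main.v *)
(** Put [g = 1/2 - alpha] and [Z = sin^2 (pi x) + 1/N^2].  The test function is
    an odd trigonometric polynomial [phi] with [- phi' = W - E], where [W] is a
    positive combination of Fejer kernels with [W >= c Z^(-(1+g)/2)] and [E] is a
    small multiple of a single Fejer kernel of order [N], concentrated at 0.  Both
    [phi] and [(-Delta)^alpha phi] are [O(Z^(-(1-g)/2))], uniformly in [N].

    For a solution [u], consider [M(t) = max_y (u(t), phi(. - y))].  At a
    maximizing [y] one has [(u, phi'(. - y)) = 0], so that a constant, here
    [u(y)], may be subtracted from [u] in
    [- 1/2 (u^2, phi') - (u, (-Delta)^alpha phi)].  By Young's inequality the term
    in [W] absorbs the dissipation and dominates [M^2], because
    [Z^(-(1-2g)/2)] is integrable.  A solution in [H^s], [s > 1/2 + 2g], is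
    Hoelder of exponent [2g] uniformly in time, so the term in [E] is harmless
    for [N] large.  Hence [M' >= k M^2 - b] with [k] and [b] independent of [N]
    and of [u], and [M] becomes infinite if [M(0)] is large, as is the case for
    [u_0 = A sin (2 pi x)] with [A] large. *)

Require Import Defs.
From mathcomp Require Import all_boot all_order all_algebra.
From mathcomp Require Import all_classical all_reals all_analysis.
From mathcomp Require Import measurable_realfun.
From mathcomp.real_closed Require Import complex.
From mathcomp Require Import ring lra zify.
Set Implicit Arguments.
Unset Strict Implicit.
Unset Printing Implicit Defensive.
Import Order.TTheory GRing.Theory Num.Theory.
Import numFieldNormedType.Exports.

Local Open Scope classical_set_scope.
Local Open Scope ring_scope.

(** * Integration over the unit interval *)

Section unit_integral.
Context {R : realType}.
Implicit Types f g h : R -> R.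

(** The maximum over translates takes the place of symmetry. For odd data, uniqueness would keep the
    solution odd and give [u(0, t) = 0]; the stationarity of the pairing at a maximizer allows
    [u(y)] to be subtracted for any weak solution. The maximizer may jump in time, so [M] is never
    differentiated: one translate is followed over a short time, and real induction compares [M]
    with an explicit barrier.

    A derivative of a periodic function has mean zero, whereas the mean of [W] is positive and grows
    with [N]; the compensating mass [E] is put where [u - u(y)] vanishes. A finite [N] keeps the
    test function smooth, and for a trigonometric polynomial the derivative and [(-Delta)^alpha] are
    explicit. [N] depends on the Hoelder constant of the solution, while the data and the blow-up
    time are chosen before the solution; hence the need for constants free of [N].

    The exponents fit because, with [rho = Z^(-1/2)], the square of [rho^(1-g)] divided by
    [rho^(1+g)] is [rho^(1-3g)], at most a constant times [rho^(1-2g)]. *)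

Definition I01 f : R := \int[lebesgue_measure]_(x in `[0, 1]) f x.

Definition intg f : Prop :=
  (@lebesgue_measure R).-integrable `[0, 1] (EFin \o f).

Lemma intg_continuous f : continuous f -> intg f.
Proof.
move=> cf; apply: continuous_compact_integrable; first exact: segment_compact.
exact: continuous_subspaceT.
Qed.

Lemma intg_measurable f : intg f -> measurable_fun (`[0, 1]%classic : set R) f.
Proof. by move=> /integrableP[/measurable_EFinP]. Qed.

Lemma eq_intg f g : {in `[0, 1], f =1 g} -> intg f -> intg g.
Proof.
move=> fg; apply: eq_integrable => // x; rewrite inE => x01 /=.
by congr EFin; apply: fg.
Qed.

Lemma intgD f g : intg f -> intg g -> intg (fun x => f x + g x).
Proof.
move=> intf integ.
have h : (@lebesgue_measure R).-integrable `[0, 1] ((EFin \o f) \+ (EFin \o g))%E.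
  by apply: integrableD => //; exact: measurable_itv.
exact: h.
Qed.

Lemma intgZ a f : intg f -> intg (fun x => a * f x).
Proof.
move=> intf.
have h : (@lebesgue_measure R).-integrable `[0, 1] (fun x => a%:E * (EFin \o f) x)%E.
  by apply: integrableZl => //; exact: measurable_itv.
exact: h.
Qed.

Lemma intgB f g : intg f -> intg g -> intg (fun x => f x - g x).
Proof.
move=> intf integ; apply: (@eq_intg (fun x => f x + -1 * g x)).
  by move=> x _; rewrite mulN1r.
by apply: intgD => //; apply: intgZ.
Qed.

Lemma intg_cst a : intg (fun=> a).
Proof. by apply: intg_continuous => x; apply: cvg_cst. Qed.

Lemma intg_sum (I : eqType) (s : seq I) (F : I -> R -> R) :
  (forall i, i \in s -> intg (F i)) -> intg (fun x => \sum_(i <- s) F i x).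
Proof.
elim: s => [_|i s IH Fs].
  by apply: (@eq_intg (fun=> 0)); [move=> x _; rewrite big_nil|exact: intg_cst].
apply: (@eq_intg (fun x => F i x + \sum_(i <- s) F i x)).
  by move=> x _; rewrite big_cons.
apply: intgD; first by apply: Fs; rewrite mem_head.
by apply: IH => j js; apply: Fs; rewrite in_cons js orbT.
Qed.

Lemma le_intg f g : measurable_fun (`[0, 1]%classic : set R) f -> intg g ->
  {in `[0, 1], forall x, `|f x| <= g x} -> intg f.
Proof.
move=> mf ig fg; apply: (@le_integrable _ _ _ (@lebesgue_measure R) `[0,1]%classic
   _ (EFin \o f) (EFin \o g)) => //.
- exact/measurable_EFinP.
- move=> x x01 /=; rewrite lee_fin; apply: (le_trans (fg _ x01)); exact: ler_norm.
Qed.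

Lemma intgM_bounded f g (M : R) : intg f -> measurable_fun (`[0, 1]%classic : set R) g ->
  {in `[0, 1], forall x, `|g x| <= M} -> intg (fun x => f x * g x).
Proof.
move=> intf mg gM; apply: (@le_intg _ (fun x => M * `|f x|)).
- by apply: measurable_funM => //; exact: intg_measurable.
- by apply: intgZ; exact: (integrable_norm intf).
- by move=> x x01; rewrite normrM mulrC ler_wpM2r// gM.
Qed.

Lemma continuous_bounded01 f : continuous f ->
  exists2 M, 0 < M & {in `[0, 1], forall x, `|f x| <= M}.
Proof.
move=> cf; have [|c c01 cM] := @EVT_max R (fun x => `|f x|) 0 1 ler01.
  apply: continuous_subspaceT => x.
  by apply: cvg_norm; exact: cf.
exists (`|f c| + 1); first by rewrite ltr_wpDl.
by move=> x x01; rewrite (le_trans (cM _ x01))// lerDl.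
Qed.

Lemma continuous_measurable01 f : continuous f -> measurable_fun (`[0, 1]%classic : set R) f.
Proof. by move=> /intg_continuous/intg_measurable. Qed.

Lemma intgM_continuous f g : intg f -> continuous g ->
  intg (fun x => f x * g x).
Proof.
move=> intf cg; have [M _ gM] := continuous_bounded01 cg.
by apply: intgM_bounded gM => //; exact: continuous_measurable01.
Qed.

Lemma eq_I01 f g : {in `[0, 1], f =1 g} -> I01 f = I01 g.
Proof.
by move=> fg; apply: eq_Rintegral => x; rewrite inE => x01; rewrite fg.
Qed.

Lemma I01D f g : intg f -> intg g -> I01 (fun x => f x + g x) = I01 f + I01 g.
Proof. by move=> intf integ; rewrite /I01 RintegralD. Qed.

Lemma I01Z a f : intg f -> I01 (fun x => a * f x) = a * I01 f.
Proof. by move=> intf; rewrite /I01 RintegralZl. Qed.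

Lemma I01B f g : intg f -> intg g -> I01 (fun x => f x - g x) = I01 f - I01 g.
Proof. by move=> intf integ; rewrite /I01 RintegralB. Qed.

Lemma I01_cst a : I01 (fun=> a) = a.
Proof.
rewrite /I01 Rintegral_cst//= lebesgue_measure_itv/= lte_fin ltr01.
by rewrite -EFinD/= subr0 mulr1.
Qed.

Lemma I01_sum (I : eqType) (s : seq I) (F : I -> R -> R) :
  (forall i, i \in s -> intg (F i)) ->
  I01 (fun x => \sum_(i <- s) F i x) = \sum_(i <- s) I01 (F i).
Proof.
elim: s => [_|i s IH Fs].
  rewrite big_nil -[RHS](I01_cst 0); apply: eq_I01 => x _.
  by rewrite big_nil.
rewrite big_cons -IH; last by move=> j js; apply: Fs; rewrite in_cons js orbT.
rewrite -I01D; first by apply: eq_I01 => x _; rewrite big_cons.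
  by apply: Fs; rewrite mem_head.
by apply: intg_sum => j js; apply: Fs; rewrite in_cons js orbT.
Qed.

Lemma le_I01 f g : intg f -> intg g -> {in `[0, 1], forall x, f x <= g x} ->
  I01 f <= I01 g.
Proof. by move=> intf integ fg; apply: le_Rintegral. Qed.

Lemma I01_ge0 f : {in `[0, 1], forall x, 0 <= f x} -> 0 <= I01 f.
Proof. by move=> f0; apply: Rintegral_ge0. Qed.

Lemma le_norm_I01 f M : intg f -> {in `[0, 1], forall x, `|f x| <= M} ->
  `|I01 f| <= M.
Proof.
move=> intf fM; rewrite (le_trans (le_normr_Rintegral _ _))//.
rewrite -[leRHS]I01_cst; apply: le_I01 => //; last exact: intg_cst.
exact: (integrable_norm intf).
Qed.

Lemma I01_derive (F f : R -> R) : continuous f ->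
  (forall x : R, is_derive x 1 F (f x)) -> I01 f = F 1 - F 0.
Proof.
move=> cf dF; rewrite /I01 /Rintegral (@continuous_FTC2 R f F)//.
- exact: continuous_subspaceT.
- split=> //.
  + apply: cvg_at_right_filter; apply: differentiable_continuous.
    by apply/derivable1_diffP; exact: ex_derive.
  + apply: cvg_at_left_filter; apply: differentiable_continuous.
    by apply/derivable1_diffP; exact: ex_derive.
- by move=> x _; rewrite derive1E; exact: derive_val.
Qed.

Lemma ae_eq_I01 f g : measurable_fun (`[0, 1]%classic : set R) f ->
  measurable_fun (`[0, 1]%classic : set R) g ->
  ae_eq (@lebesgue_measure R) (`[0, 1]%classic : set R) f g -> I01 f = I01 g.
Proof.
move=> mf mg fg; rewrite /I01 /Rintegral; congr fine.
apply: ae_eq_integral => //; try exact/measurable_EFinP.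
by apply: filterS fg => x fgx x01; rewrite /= fgx.
Qed.

End unit_integral.

(** * Trigonometric polynomials and Fourier coefficients *)

Section trigonometric_modes.
Context {R : realType}.
Implicit Types (j k : int) (x : R).

Definition freq (k : int) : R := 2 * pi * k%:~R.
Definition cs (k : int) (x : R) : R := cos (freq k * x).
Definition sn (k : int) (x : R) : R := sin (freq k * x).

Lemma derive_continuous (f df : R -> R) :
  (forall x : R, is_derive x 1 f (df x)) -> continuous f.
Proof.
move=> fdf x; apply: differentiable_continuous; apply/derivable1_diffP.
exact: (@ex_derive _ _ _ _ _ _ _ (fdf x)).
Qed.

Lemma is_deriveMl (c : R) (f : R -> R) (x df : R) : is_derive x 1 f df ->
  is_derive x 1 (fun y => c * f y) (c * df).
Proof. exact: is_deriveZ. Qed.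

Lemma is_derive_add (f g : R -> R) (x df dg : R) : is_derive x 1 f df ->
  is_derive x 1 g dg -> is_derive x 1 (fun y => f y + g y) (df + dg).
Proof. exact: is_deriveD. Qed.

Lemma is_derive_mul (f g : R -> R) (x df dg : R) : is_derive x 1 f df ->
  is_derive x 1 g dg -> is_derive x 1 (fun y => f y * g y) (df * g x + f x * dg).
Proof.
move=> hf hg; have h := is_deriveM hf hg.
by move: h; rewrite /GRing.scale/= addrC (mulrC (g x)).
Qed.

Lemma is_derive_congr (f : R -> R) (x a b : R) : is_derive x 1 f a -> a = b ->
  is_derive x 1 f b.
Proof. by move=> h <-. Qed.

Lemma is_derive_freq k x : is_derive x 1 (fun y => freq k * y) (freq k).
Proof.
by rewrite -[X in is_derive _ _ _ X]mulr1; apply: is_deriveMl; exact: is_derive_id.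
Qed.

Lemma is_derive_cs k x : is_derive x 1 (cs k) (- freq k * sn k x).
Proof.
have := is_derive1_comp (is_derive_cos (freq k * x)) (is_derive_freq k x).
by move=> h; apply: (is_derive_congr h); rewrite mulrC mulrN mulNr.
Qed.

Lemma is_derive_sn k x : is_derive x 1 (sn k) (freq k * cs k x).
Proof.
have := is_derive1_comp (is_derive_sin (freq k * x)) (is_derive_freq k x).
by move=> h; apply: (is_derive_congr h); rewrite mulrC.
Qed.

Lemma continuous_cs k : continuous (cs k).
Proof. exact: (derive_continuous (is_derive_cs k)). Qed.

Lemma continuous_sn k : continuous (sn k).
Proof. exact: (derive_continuous (is_derive_sn k)). Qed.

Lemma periodic_intmul (f : R -> R) (T : R) (k : int) (x : R) :
  periodic f T -> f (x + T *~ k) = f x.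
Proof.
move=> pf; case: k => n; first by rewrite -pmulrn periodicn.
rewrite NegzE mulrNz -pmulrn.
by rewrite -{2}(subrK (T *+ n.+1) x) periodicn.
Qed.

Lemma freqD1 k x : freq k * (x + 1) = freq k * x + (pi *+ 2) *~ k.
Proof. by rewrite mulrDr mulr1 /freq !mulr_natl mulrzr. Qed.

Lemma periodic_cs k : periodic (cs k) 1.
Proof.
by move=> x; rewrite /cs freqD1 periodic_intmul//; exact: cosD2pi.
Qed.

Lemma periodic_sn k : periodic (sn k) 1.
Proof.
by move=> x; rewrite /sn freqD1 periodic_intmul//; exact: sinD2pi.
Qed.

Lemma freqN k : freq (- k) = - freq k.
Proof. by rewrite /freq mulrNz mulrN. Qed.

Lemma freqD j k : freq (j + k) = freq j + freq k.
Proof. by rewrite /freq mulrzDr mulrDr. Qed.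

Lemma freq_eq0 k : (freq k == 0) = (k == 0).
Proof.
rewrite /freq !mulf_eq0 (gt_eqF (@pi_gt0 R)) orbF intr_eq0.
by rewrite pnatr_eq0.
Qed.

Lemma cs0 x : cs 0 x = 1.
Proof. by rewrite /cs /freq mulr0 mul0r cos0. Qed.

Lemma sn0 x : sn 0 x = 0.
Proof. by rewrite /sn /freq mulr0 mul0r sin0. Qed.

Lemma csN k x : cs (- k) x = cs k x.
Proof. by rewrite /cs freqN mulNr cosN. Qed.

Lemma snN k x : sn (- k) x = - sn k x.
Proof. by rewrite /sn freqN mulNr sinN. Qed.

Lemma cs_le1 k x : `|cs k x| <= 1. Proof. exact: cos_max. Qed.
Lemma sn_le1 k x : `|sn k x| <= 1. Proof. exact: sin_max. Qed.

Lemma I01_cs k : I01 (cs k) = (k == 0)%:R.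
Proof.
have [->|k0] := eqVneq k 0.
  by rewrite -(I01_cst 1); apply: eq_I01 => x _; rewrite cs0.
have dF (x : R) : is_derive x 1 (fun x => (freq k)^-1 * sn k x) (cs k x).
  apply: (is_derive_congr (is_deriveMl _ (is_derive_sn k x))).
  by rewrite mulKf// freq_eq0.
rewrite (I01_derive (@continuous_cs k) dF).
by rewrite -[in sn k 1](add0r 1) periodic_sn subrr.
Qed.

Lemma I01_sn k : I01 (sn k) = 0.
Proof.
have [->|k0] := eqVneq k 0.
  by rewrite -(I01_cst 0); apply: eq_I01 => x _; rewrite sn0.
have dF (x : R) : is_derive x 1 (fun x => - (freq k)^-1 * cs k x) (sn k x).
  apply: (is_derive_congr (is_deriveMl _ (is_derive_cs k x))).
  by rewrite mulrA mulrNN mulVf ?mul1r// freq_eq0.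
rewrite (I01_derive (@continuous_sn k) dF).
by rewrite -[in cs k 1](add0r 1) periodic_cs subrr.
Qed.

Lemma cs_cs j k x : cs j x * cs k x = 2^-1 * (cs (j - k) x + cs (j + k) x).
Proof.
by rewrite /cs !freqD freqN !mulrDl mulNr !cosD cosN sinN; field.
Qed.

Lemma sn_sn j k x : sn j x * sn k x = 2^-1 * (cs (j - k) x - cs (j + k) x).
Proof.
by rewrite /cs /sn !freqD freqN !mulrDl mulNr !cosD cosN sinN; field.
Qed.

Lemma sn_cs j k x : sn j x * cs k x = 2^-1 * (sn (j - k) x + sn (j + k) x).
Proof.
by rewrite /cs /sn !freqD freqN !mulrDl mulNr !sinD cosN sinN; field.
Qed.

Lemma intg_cs k : intg (cs k). Proof. exact/intg_continuous/continuous_cs. Qed.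
Lemma intg_sn k : intg (sn k). Proof. exact/intg_continuous/continuous_sn. Qed.

Lemma I01_cs_cs j k : I01 (fun x => cs j x * cs k x) =
  2^-1 * ((j == k)%:R + (j == - k)%:R).
Proof.
rewrite (@eq_I01 _ _ (fun x => 2^-1 * (cs (j - k) x + cs (j + k) x))); last first.
  by move=> x _; exact: cs_cs.
rewrite I01Z; last by apply: intgD; exact: intg_cs.
rewrite I01D; [|exact: intg_cs..].
by rewrite !I01_cs subr_eq0 addr_eq0.
Qed.

Lemma I01_sn_sn j k : I01 (fun x => sn j x * sn k x) =
  2^-1 * ((j == k)%:R - (j == - k)%:R).
Proof.
rewrite (@eq_I01 _ _ (fun x => 2^-1 * (cs (j - k) x - cs (j + k) x))); last first.
  by move=> x _; exact: sn_sn.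
rewrite I01Z; last by apply: intgB; exact: intg_cs.
rewrite I01B; [|exact: intg_cs..].
by rewrite !I01_cs subr_eq0 addr_eq0.
Qed.

Lemma I01_sn_cs j k : I01 (fun x => sn j x * cs k x) = 0.
Proof.
rewrite (@eq_I01 _ _ (fun x => 2^-1 * (sn (j - k) x + sn (j + k) x))); last first.
  by move=> x _; exact: sn_cs.
rewrite I01Z; last by apply: intgD; exact: intg_sn.
rewrite I01D; [|exact: intg_sn..].
by rewrite !I01_sn addr0 mulr0.
Qed.

Lemma I01_cs_sn j k : I01 (fun x => cs j x * sn k x) = 0.
Proof. by rewrite -(I01_sn_cs k j); apply: eq_I01 => x _; rewrite mulrC. Qed.

End trigonometric_modes.

Section trigonometric_polynomials.
Context {R : realType}.
Implicit Types (a b : nat -> R) (n : nat).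

Definition trig n a b (x : R) : R :=
  \sum_(0 <= k < n) (a k * cs k%:Z x + b k * sn k%:Z x).

Lemma is_derive_trig n a b (x : R) : is_derive x 1 (trig n a b)
  (trig n (fun k => freq k%:Z * b k) (fun k => - freq k%:Z * a k) x).
Proof.
elim: n => [|n IH].
  rewrite /trig big_nil; rewrite (_ : (fun x => _) = (fun=> 0)).
    exact: is_derive_cst.
  by apply/funext => y; rewrite big_nil.
rewrite /trig big_nat_recr//= -/(trig n _ _ x).
rewrite (_ : (fun x => _) =
    (fun x => trig n a b x + (a n * cs n%:Z x + b n * sn n%:Z x))).
  apply: is_derive_add => //.
  have h1 := is_derive_cs n%:Z x; have h2 := is_derive_sn n%:Z x.
  apply: (is_derive_congr (is_derive_add (is_deriveMl _ h1) (is_deriveMl _ h2))).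
  ring.
by apply/funext => y; rewrite big_nat_recr.
Qed.

Lemma derive1_trig n a b : derive1 (trig n a b) =
  trig n (fun k => freq k%:Z * b k) (fun k => - freq k%:Z * a k).
Proof.
apply/funext => x; rewrite derive1E.
exact: (@derive_val _ _ _ _ _ _ _ (is_derive_trig n a b x)).
Qed.

Lemma smooth_trig n a b : smooth (trig n a b).
Proof.
move=> m; elim: m a b => [|m IH] a b x.
  exact: (@ex_derive _ _ _ _ _ _ _ (is_derive_trig n a b x)).
by rewrite derive1Sn derive1_trig; exact: IH.
Qed.

Lemma continuous_trig n a b : continuous (trig n a b).
Proof. exact: (derive_continuous (is_derive_trig n a b)). Qed.

Lemma periodic_trig n a b : periodic (trig n a b) 1.
Proof.
by move=> x; apply: eq_bigr => k _; rewrite periodic_cs periodic_sn.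
Qed.

Lemma I01_trig f n a b : intg f -> I01 (fun x => f x * trig n a b x) =
  \sum_(0 <= k < n) (a k * pairing f (cs k%:Z) + b k * pairing f (sn k%:Z)).
Proof.
move=> intf.
rewrite (@eq_I01 _ _ (fun x => \sum_(0 <= k < n)
   (a k * (f x * cs k%:Z x) + b k * (f x * sn k%:Z x)))); last first.
  move=> x _; rewrite big_distrr/=; apply: eq_bigr => k _; ring.
have ic k : intg (fun x => f x * cs k x).
  by apply: intgM_continuous => //; exact: continuous_cs.
have isn k : intg (fun x => f x * sn k x).
  by apply: intgM_continuous => //; exact: continuous_sn.
rewrite I01_sum; last by move=> k _; apply: intgD; apply: intgZ.
by apply: eq_bigr => k _; rewrite I01D ?I01Z//; exact: intgZ.
Qed.

End trigonometric_polynomials.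

Section trigonometric_fraclap.
Context {R : realType}.

Lemma is_fraclapP (a : R) (f g : R -> R) : is_fraclap a f g <->
  forall k : int,
    pairing g (cs k) = `|freq k| `^ (2 * a) * pairing f (cs k) /\
    pairing g (sn k) = `|freq k| `^ (2 * a) * pairing f (sn k).
Proof.
have fE (h : R -> R) k :
  fourier h k = complex.Complex (pairing h (cs k)) (- pairing h (sn k)) by [].
split=> H k; have := H k; rewrite !fE => {H}.
  move=> /eqP; rewrite eq_complex/= mul0r subr0 mul0r addr0 mulrN eqr_opp.
  by move=> /andP[/eqP -> /eqP ->].
move=> [-> ->]; apply/eqP.
by rewrite eq_complex/= mul0r subr0 mul0r addr0 mulrN !eqxx.
Qed.

Lemma pairingC (f g : R -> R) : pairing f g = pairing g f.
Proof. by apply: eq_Rintegral => x _; rewrite mulrC. Qed.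

(** Mode [k] pairs non-trivially only with the modes [k] and [- k], on which the even symbol takes a
    single value. *)
Lemma is_fraclap_trig (a : R) n (A B : nat -> R) :
  is_fraclap a (trig n A B)
    (trig n (fun k => `|freq k%:Z| `^ (2 * a) * A k)
            (fun k => `|freq k%:Z| `^ (2 * a) * B k)).
Proof.
have freqE (k : nat) (j : int) : (k%:Z == j) || (k%:Z == - j) ->
    `|freq k%:Z| = `|freq j| :> R.
  by move=> /orP[/eqP <-//|/eqP ->]; rewrite freqN normrN.
apply/is_fraclapP => j; rewrite !(pairingC (trig _ _ _)).
have Ic := @intg_cs R j; have Is := @intg_sn R j.
rewrite /pairing -!/(I01 _) !I01_trig// !big_distrr/=; split; apply: eq_bigr => k _.
  rewrite /pairing -!/(I01 _) I01_cs_cs I01_cs_sn !mulr0 !addr0 -mulrA.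
  have [h|/norP[h1 h2]] := boolP ((k%:Z == j) || (k%:Z == - j)).
    by rewrite (freqE _ _ h).
  rewrite [j == _]eq_sym (negbTE h1) -eqr_oppLR [_ == k%:Z]eq_sym (negbTE h2).
  by rewrite addr0 !mulr0.
rewrite /pairing -!/(I01 _) I01_sn_sn I01_sn_cs !mulr0 !add0r -mulrA.
have [h|/norP[h1 h2]] := boolP ((k%:Z == j) || (k%:Z == - j)).
  by rewrite (freqE _ _ h).
rewrite [j == _]eq_sym (negbTE h1) -eqr_oppLR [_ == k%:Z]eq_sym (negbTE h2).
by rewrite subr0 !mulr0.
Qed.

End trigonometric_fraclap.

(** * Uniqueness of the Fourier coefficients of integrable functions *)

Section fourier_uniqueness.
Context {R : realType}.

Lemma aeS (P Q : R -> Prop) : (forall x, P x -> Q x) ->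
  {ae (@lebesgue_measure R), forall x, P x} ->
  {ae (@lebesgue_measure R), forall x, Q x}.
Proof. by move=> PQ; apply: negligibleS => x /= nQ /PQ. Qed.

Lemma aeS2 (P Q S : R -> Prop) : (forall x, P x -> Q x -> S x) ->
  {ae (@lebesgue_measure R), forall x, P x} ->
  {ae (@lebesgue_measure R), forall x, Q x} ->
  {ae (@lebesgue_measure R), forall x, S x}.
Proof.
move=> PQS aP aQ; apply: negligibleS (negligibleU aP aQ) => x /= nS.
have [Px|] := pselect (P x); last by left.
by right=> Qx; exact/nS/PQS.
Qed.

Lemma bernoulli_sub (x : R) n : 0 <= x <= 1 -> 1 - n%:R * x <= (1 - x) ^+ n.
Proof.
move=> /andP[x0 x1]; elim: n => [|n IH]; first by rewrite mul0r subr0 expr0.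
rewrite exprS; have : (1 - x) * (1 - n%:R * x) <= (1 - x) * (1 - x) ^+ n.
  by rewrite ler_wpM2l// subr_ge0.
apply: le_trans; rewrite -natr1.
have : 0 <= n%:R * x * x by rewrite !mulr_ge0.
lra.
Qed.

Lemma bernoulli_add (x : R) n : 0 <= x -> 1 + n%:R * x <= (1 + x) ^+ n.
Proof.
move=> x0; elim: n => [|n IH]; first by rewrite mul0r addr0 expr0.
rewrite exprS; have : (1 + x) * (1 + n%:R * x) <= (1 + x) * (1 + x) ^+ n.
  by rewrite ler_wpM2l// addr_ge0.
apply: le_trans; rewrite -natr1.
have : 0 <= n%:R * x * x by rewrite !mulr_ge0.
lra.
Qed.

(** The polynomials of the elementary proof of the Stone-Weierstrass theorem by Brosowski and
    Deutsch. By the Bernoulli inequalities they converge to the step function that jumps at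
    [q = 1/2], as [(2 q)^n] tends to 0 or to infinity. *)
Definition step_approx (n : nat) (q : R) : R := (1 - q ^+ n) ^+ (2 ^ n).

Lemma step_approx_itv n (q : R) : 0 <= q <= 1 -> 0 <= step_approx n q <= 1.
Proof.
move=> /andP[q0 q1]; have h : 0 <= 1 - q ^+ n by rewrite subr_ge0 exprn_ile1.
rewrite exprn_ge0//= exprn_ile1// gerBl; exact: exprn_ge0.
Qed.

Lemma step_approx_lt (q : R) : 0 <= q -> q < 2^-1 ->
  step_approx n q @[n --> \oo] --> (1 : R).
Proof.
move=> q0 q1; have q01 : 0 <= q <= 1 by lra.
apply: (@squeeze_cvgr _ _ _ _ (fun n => 1 - (2 * q) ^+ n) (fun=> 1)).
- apply: nearW => n; have /andP[_ ->] := step_approx_itv n q01; rewrite andbT.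
  rewrite exprMn -natrX; apply: bernoulli_sub.
  by rewrite exprn_ge0//= exprn_ile1//; lra.
- rewrite -[X in _ --> X]subr0; apply: cvgB; first exact: cvg_cst.
  by apply: cvg_expr; rewrite ger0_norm; lra.
- exact: cvg_cst.
Qed.

Lemma step_approx_gt (q : R) : 2^-1 < q -> q <= 1 ->
  step_approx n q @[n --> \oo] --> (0 : R).
Proof.
move=> q0 q1; have q01 : 0 <= q <= 1 by lra.
have qp : 0 < 2 * q by lra.
apply: (@squeeze_cvgr _ _ _ _ (fun=> 0) (fun n => ((2 * q)^-1) ^+ n)).
- apply: nearW => n; have /andP[s0 _] := step_approx_itv n q01; rewrite s0/=.
  rewrite exprVn -[leRHS]mul1r ler_pdivlMr ?exprn_gt0//.
  have qn0 : 0 <= q ^+ n by apply: exprn_ge0; lra.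
  have qn1 : q ^+ n <= 1 by apply: exprn_ile1; lra.
  have h : (2 * q) ^+ n <= (1 + q ^+ n) ^+ (2 ^ n).
    rewrite exprMn -natrX; apply: le_trans (bernoulli_add _ qn0).
    by rewrite lerDr.
  apply: (le_trans (ler_wpM2l s0 h)).
  rewrite /step_approx -exprMn; apply: exprn_ile1; nra.
- exact: cvg_cst.
- apply: cvg_expr; rewrite ger0_norm ?invr_ge0 ?ltW// invf_lt1//; lra.
Qed.

Variable f : R -> R.
Hypothesis intf : intg f.
Hypothesis fcs : forall k : int, I01 (fun x => f x * cs k x) = 0.
Hypothesis fsn : forall k : int, I01 (fun x => f x * sn k x) = 0.

(** All Fourier coefficients of [f p] are required to vanish, not only its mean: by the product
    formulas this is stable under multiplication of [p] by a mode, hence reaches every polynomial in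
    [arc_fun]. *)
Definition orth (p : R -> R) : Prop := continuous p /\ forall k : int,
  I01 (fun x => f x * (p x * cs k x)) = 0 /\
  I01 (fun x => f x * (p x * sn k x)) = 0.

Lemma orth1 : orth (fun=> 1).
Proof.
split=> [x|k]; first exact: cvg_cst.
by split; [rewrite -[RHS](fcs k)|rewrite -[RHS](fsn k)];
  apply: eq_I01 => x _; rewrite mul1r.
Qed.

Lemma orth_continuousM p q : orth p -> continuous q ->
  continuous (fun x => p x * q x).
Proof. by move=> [cp _] cq x; apply: cvgM; [exact: cp|exact: cq]. Qed.

Lemma intg_orth p q : orth p -> continuous q -> intg (fun x => f x * (p x * q x)).
Proof.
by move=> op cq; apply: intgM_continuous => //; exact: orth_continuousM.
Qed.

Lemma orthD p q : orth p -> orth q -> orth (fun x => p x + q x).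
Proof.
move=> op oq; split=> [x|k]; first by apply: cvgD; [exact: op.1|exact: oq.1].
have ic h : orth h -> intg (fun x => f x * (h x * cs k x)).
  by move=> oh; apply: intg_orth => //; exact: continuous_cs.
have is_ h : orth h -> intg (fun x => f x * (h x * sn k x)).
  by move=> oh; apply: intg_orth => //; exact: continuous_sn.
have [p1 p2] := op.2 k; have [q1 q2] := oq.2 k; split.
  rewrite (@eq_I01 _ _ (fun x => f x * (p x * cs k x) + f x * (q x * cs k x))).
    by rewrite I01D ?p1 ?q1 ?addr0//; exact: ic.
  by move=> x _; rewrite mulrDl mulrDr.
rewrite (@eq_I01 _ _ (fun x => f x * (p x * sn k x) + f x * (q x * sn k x))).
  by rewrite I01D ?p2 ?q2 ?addr0//; exact: is_.
by move=> x _; rewrite mulrDl mulrDr.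
Qed.

Lemma orthZ a p : orth p -> orth (fun x => a * p x).
Proof.
move=> op; split=> [x|k]; first by apply: cvgM; [exact: cvg_cst|exact: op.1].
have [p1 p2] := op.2 k; split.
  rewrite (@eq_I01 _ _ (fun x => a * (f x * (p x * cs k x)))).
    rewrite I01Z ?p1 ?mulr0//; apply: intg_orth => //; exact: continuous_cs.
  by move=> x _; ring.
rewrite (@eq_I01 _ _ (fun x => a * (f x * (p x * sn k x)))).
  rewrite I01Z ?p2 ?mulr0//; apply: intg_orth => //; exact: continuous_sn.
by move=> x _; ring.
Qed.

Lemma orthMcs j p : orth p -> orth (fun x => p x * cs j x).
Proof.
move=> op; split=> [|k].
  by apply: orth_continuousM => //; exact: continuous_cs.
have ic i : intg (fun x => f x * (p x * cs i x)).
  by apply: intg_orth => //; exact: continuous_cs.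
have is_ i : intg (fun x => f x * (p x * sn i x)).
  by apply: intg_orth => //; exact: continuous_sn.
split.
  rewrite (@eq_I01 _ _ (fun x => 2^-1 * (f x * (p x * cs (j - k) x) +
                                  f x * (p x * cs (j + k) x)))).
    rewrite I01Z ?I01D//; last exact: intgD.
    by rewrite (op.2 _).1 (op.2 _).1 addr0 mulr0.
  by move=> x _; rewrite -mulrA cs_cs; ring.
rewrite (@eq_I01 _ _ (fun x => 2^-1 * (f x * (p x * sn (k - j) x) +
                                f x * (p x * sn (k + j) x)))).
  rewrite I01Z ?I01D//; last exact: intgD.
  by rewrite (op.2 _).2 (op.2 _).2 addr0 mulr0.
by move=> x _; rewrite -mulrA (mulrC (cs j x)) sn_cs; ring.
Qed.

Lemma orthMsn j p : orth p -> orth (fun x => p x * sn j x).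
Proof.
move=> op; split=> [|k].
  by apply: orth_continuousM => //; exact: continuous_sn.
have ic i : intg (fun x => f x * (p x * cs i x)).
  by apply: intg_orth => //; exact: continuous_cs.
have is_ i : intg (fun x => f x * (p x * sn i x)).
  by apply: intg_orth => //; exact: continuous_sn.
split.
  rewrite (@eq_I01 _ _ (fun x => 2^-1 * (f x * (p x * sn (j - k) x) +
                                  f x * (p x * sn (j + k) x)))).
    rewrite I01Z ?I01D//; last exact: intgD.
    by rewrite (op.2 _).2 (op.2 _).2 addr0 mulr0.
  by move=> x _; rewrite -mulrA sn_cs; ring.
rewrite (@eq_I01 _ _ (fun x => 2^-1 * (f x * (p x * cs (j - k) x) -
                                f x * (p x * cs (j + k) x)))).
  rewrite I01Z ?I01B//; last exact: intgB.
  by rewrite (op.2 _).1 (op.2 _).1 subr0 mulr0.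
by move=> x _; rewrite -mulrA sn_sn; ring.
Qed.

Section arc.
Variable x : R.
Hypothesis x01 : 0 < x < 1.

(* The arc ]0, x[ is the sublevel set [arc_fun < 1/2], so that the trigonometric
   polynomials [(1 - arc_fun ^ n) ^ (2 ^ n)] converge to its indicator. *)
Definition arc_fun (y : R) : R :=
  2^-1 + (cos (pi * x) - (cos (pi * x) * cs 1 y + sin (pi * x) * sn 1 y)) / 4.

Lemma arc_funE y : arc_fun y = 2^-1 - sin (pi * y) * sin (pi * (x - y)) / 2.
Proof.
rewrite /arc_fun /cs /sn /freq mulr1.
rewrite (_ : 2 * pi * y = pi * y + pi * y); last by ring.
rewrite cosD sinD (mulrBr pi x y) (sinB (pi * x)); have := cos2Dsin2 (pi * y).
set c := cos (pi * y); set s := sin (pi * y); set a := cos _; set b := sin _.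
move=> /(congr1 (fun z => z - c ^+ 2)); rewrite addrAC subrr add0r => h.
have -> : c * c - s * s = 1 - 2 * s ^+ 2 by rewrite -!expr2 h; ring.
by field.
Qed.

Lemma arc_fun_itv y : 0 <= arc_fun y <= 1.
Proof.
rewrite arc_funE; have := sin_max (pi * y); have := sin_max (pi * (x - y)).
rewrite !ler_norml => /andP[a1 a2] /andP[b1 b2]; nra.
Qed.

Lemma sin_pi_gt0 (y : R) : 0 < y < 1 -> 0 < sin (pi * y).
Proof.
move=> /andP[y0 y1]; apply: sin_gt0_pi; have := @pi_gt0 R => p.
by apply/andP; split; nra.
Qed.

Lemma arc_fun_lt (y : R) : 0 < y < x -> arc_fun y < 2^-1.
Proof.
move=> yx; rewrite arc_funE; have xlt1 := x01.
have s1 : 0 < sin (pi * y) by apply: sin_pi_gt0; lra.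
have s2 : 0 < sin (pi * (x - y)) by apply: sin_pi_gt0; lra.
have := mulr_gt0 s1 s2; lra.
Qed.

Lemma arc_fun_gt (y : R) : x < y < 1 -> 2^-1 < arc_fun y.
Proof.
move=> yx; rewrite arc_funE -(opprB y x) mulrN sinN; have xlt1 := x01.
have s1 : 0 < sin (pi * y) by apply: sin_pi_gt0; lra.
have s2 : 0 < sin (pi * (y - x)) by apply: sin_pi_gt0; lra.
have := mulr_gt0 s1 s2; lra.
Qed.

Lemma orthM_arc_fun p : orth p -> orth (fun y => p y * arc_fun y).
Proof.
move=> op; have o1 := orthMcs 1 op; have o2 := orthMsn 1 op.
rewrite (_ : (fun y => _) = (fun y => (2^-1 + cos (pi * x) / 4) * p y +
   ((- cos (pi * x) / 4) * (p y * cs 1 y) + (- sin (pi * x) / 4) * (p y * sn 1 y)))).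
  by apply: orthD; [exact: orthZ|apply: orthD; exact: orthZ].
by apply/funext => y; rewrite /arc_fun; ring.
Qed.

Lemma orth_step_approx n : orth (step_approx n \o arc_fun).
Proof.
have orthX m p : orth p -> orth (fun y => p y * arc_fun y ^+ m).
  elim: m p => [|m IH] p op.
    by rewrite (_ : (fun y => _) = p)//; apply/funext => y; rewrite mulr1.
  rewrite (_ : (fun y => _) = (fun y => (p y * arc_fun y) * arc_fun y ^+ m)).
    by apply: IH; exact: orthM_arc_fun.
  by apply/funext => y; rewrite exprS mulrA.
have orthY m p : orth p -> orth (fun y => p y * (1 - arc_fun y ^+ n) ^+ m).
  elim: m p => [|m IH] p op.
    by rewrite (_ : (fun y => _) = p)//; apply/funext => y; rewrite mulr1.
  rewrite (_ : (fun y => _) = (fun y =>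
      (p y + -1 * (p y * arc_fun y ^+ n)) * (1 - arc_fun y ^+ n) ^+ m)).
    by apply: IH; apply: orthD => //; apply: orthZ; exact: orthX.
  by apply/funext => y; rewrite exprS; ring.
rewrite (_ : _ \o _ = (fun y => 1 * (1 - arc_fun y ^+ n) ^+ (2 ^ n))).
  by apply: orthY; exact: orth1.
by apply/funext => y /=; rewrite mul1r.
Qed.

Lemma I01_step_approx n : I01 (fun y => f y * step_approx n (arc_fun y)) = 0.
Proof.
have [_ /(_ 0)[<- _]] := orth_step_approx n.
by apply: eq_I01 => y _; rewrite cs0 mulr1.
Qed.

End arc.

Lemma I01_cvg (F : nat -> R -> R) (h g : R -> R) : (forall n, intg (F n)) ->
  measurable_fun (`[0, 1]%classic : set R) h -> intg g ->
  {ae (@lebesgue_measure R), forall y, y \in `[0, 1] ->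
    F n y @[n --> \oo] --> h y} ->
  (forall n y, y \in `[0, 1] -> `|F n y| <= g y) ->
  I01 (F n) @[n --> \oo] --> I01 h.
Proof.
move=> iF mh ig cF Fg.
have [|||||ih _ h3] := @dominated_convergence _ _ _ (@lebesgue_measure R)
  `[0, 1]%classic (measurable_itv _) (fun n => EFin \o F n) (EFin \o h) (EFin \o g).
- by move=> n; apply/measurable_EFinP; exact: intg_measurable.
- exact/measurable_EFinP.
- apply: aeS cF => y cFy y01; apply: cvg_EFin; first exact: nearW.
  exact: cFy.
- exact: ig.
- by apply: aeW => y n y01; rewrite /= lee_fin; exact: Fg.
apply: fine_cvg; rewrite /I01 /Rintegral fineK//.
exact: integrable_fin_num.
Qed.

Lemma ae_notin3 (a b c : R) :
  {ae (@lebesgue_measure R), forall y, ~ [set a; b; c] y}.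
Proof.
exists [set a; b; c]; split.
- by apply: measurableU => //; apply: measurableU.
- apply: countable_lebesgue_measure0; apply: finite_set_countable.
  by rewrite !finite_setU.
- by move=> y /= /contrapT.
Qed.

Lemma I01_initial (x : R) : 0 < x < 1 ->
  \int[lebesgue_measure]_(y in `[0, x]) f y = 0.
Proof.
move=> x01.
pose h y := f y * (\1_(`[0, x] : set R) y).
have mh : measurable_fun (`[0, 1]%classic : set R) h.
  apply: measurable_funM; first exact: intg_measurable.
  exact: measurable_indic.
have -> : \int[lebesgue_measure]_(y in `[0, x]) f y = I01 h.
  rewrite (_ : `[0, x]%classic = `[0, 1] `&` `[0, x]); last first.
    apply/seteqP; split=> y /=; rewrite !in_itv/=; last by case.
    by move: x01 => /andP[_ x1] /andP[-> yx]; rewrite yx (le_trans yx (ltW x1)).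
  by rewrite Rintegral_mkcondr patch_indic.
have : I01 (fun y => f y * step_approx n (arc_fun x y)) @[n --> \oo] --> I01 h.
  apply: (@I01_cvg _ _ (fun y => `|f y|)) => //.
  - move=> n; have := orth_step_approx x n.
    move=> osa; apply: intgM_continuous => //.
    by case: osa.
  - exact: (integrable_norm intf).
  (* At 0, [x] and 1 the function [arc_fun] equals 1/2, where the approximations tend neither to 0
     nor to 1. *)
  - apply: aeS (ae_notin3 0 x 1) => y yA y01.
    apply: cvgM; first exact: cvg_cst.
    rewrite indicE.
    have [y0 yx y1] : [/\ y <> 0, y <> x & y <> 1].
      by split => yE; apply: yA; rewrite yE; [left; left|left; right|right].
    move: y01; rewrite in_itv/= => y01; have xlt1 := x01.
    have [yltx|xlty|//] := ltgtP y x.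
      rewrite mem_set/=; last by rewrite in_itv/=; lra.
      apply: step_approx_lt; first by case/andP: (arc_fun_itv x y).
      apply: arc_fun_lt => //; rewrite yltx andbT lt_neqAle eq_sym.
      by apply/andP; split; [exact/eqP|lra].
    rewrite memNset/=; last by rewrite in_itv/=; lra.
    apply: step_approx_gt; last by case/andP: (arc_fun_itv x y).
    apply: arc_fun_gt => //; rewrite xlty/= lt_neqAle.
    by apply/andP; split; [exact/eqP|lra].
  - move=> n y y01; rewrite normrM ler_piMr//.
    have /andP[s0 s1] := step_approx_itv n (arc_fun_itv x y).
    by rewrite ger0_norm.
rewrite (_ : (fun n => _) = (fun=> 0)); last first.
  by apply/funext => n; exact: I01_step_approx.
move=> /cvg_lim <-//; exact: lim_cst.
Qed.

(** By Lebesgue differentiation [f] is almost everywhere the derivative of its primitive from 0,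
    which vanishes on []0, 1[] by [I01_initial]. *)
Lemma fourier_uniqueness :
  {ae (@lebesgue_measure R), forall x, x \in `[0, 1] -> f x = 0}.
Proof.
pose f0 := f \_ (`[0, 1]%classic : set R).
have if0 : (@lebesgue_measure R).-integrable setT (EFin \o f0).
  rewrite /f0 -restrict_EFin.
  have m01 : measurable (`[0, 1]%classic : set R) by exact: measurable_itv.
  have := (integrable_mkcond (mu := @lebesgue_measure R) (EFin \o f) m01).1 intf.
  by apply: eq_integrable => // y _; rewrite /= /patch; case: ifP.
have lf0 : locally_integrable setT f0.
  by apply: integrable_locally.
have f0i y : (@lebesgue_measure R).-integrable `[0, y] (EFin \o f0).
  by apply: integrableS if0.
have FTC := @FTC1 R f0 (BLeft 0) f0i lf0.
apply: aeS2 (ae_notin3 0 0 1) FTC => x xA Fx.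
rewrite in_itv/= => /andP[x0 x1].
have {}x0 : 0 < x.
  rewrite lt_neqAle x0 andbT eq_sym; apply/eqP => xE; apply: xA.
  by left; left.
have {}x1 : x < 1.
  by rewrite lt_neqAle x1 andbT; apply/eqP => xE; apply: xA; right.
have -> : f x = f0 x.
  by rewrite /f0 patchE mem_set//= in_itv/= (ltW x0) (ltW x1).
move: Fx; rewrite lte_fin x0 => /(_ isT)[_ <-].
rewrite derive1E (@near_eq_derive _ _ _ _ (cst 0)); first exact: derive_cst.
near=> y; rewrite -[RHS](@I01_initial y); last first.
  by apply/andP; split; near: y; [exact: lt_nbhsr|exact: lt_nbhsl].
apply: eq_Rintegral => z; rewrite inE/= in_itv/= => /andP[z0 zy].
rewrite /f0 patchE mem_set//= in_itv/= z0/= (le_trans zy)// ltW//.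
by near: y; exact: lt_nbhsl.
Unshelve. all: end_near.
Qed.

End fourier_uniqueness.

(** * Sobolev embedding *)

Section square_integrable.
Context {R : realType}.
Implicit Types f g : R -> R.

Lemma L2norm_sqr f :
  (L2norm f `^ 2)%E = (\int[lebesgue_measure]_(x in `[0%R, 1%R]) (f x ^+ 2)%:E)%E.
Proof.
rewrite /L2norm poweR_Lnorm// [RHS]integral_mkcond; apply: eq_integral => x _.
rewrite /= /patch; case: ifP => _ /=.
  by rewrite -[2]/(2%:R) powR_mulrn// real_normK// num_real.
by rewrite normr0 powR0.
Qed.

Lemma L2_measurable f : L2 f -> measurable_fun (`[0, 1]%classic : set R) f.
Proof.
move=> /andP[/set_mem mf _].
have m01 : measurable (`[0, 1]%classic : set R) by exact: measurable_itv.
exact: (iffRL (measurable_restrictT _ m01) mf).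
Qed.

Lemma L2_sqr f : L2 f -> intg (fun x => f x ^+ 2).
Proof.
move=> f2; have := Lfun2_integrable_sqr f2 => h.
have {}h : (@lebesgue_measure R).-integrable `[0, 1] (EFin \o (fun x => (f \_ `[0, 1]) x ^+ 2)).
  exact: integrableS h.
by apply: eq_integrable h => // x x01 /=; rewrite /patch x01.
Qed.

Lemma intg_L2 f : measurable_fun (`[0, 1]%classic : set R) f ->
  intg (fun x => f x ^+ 2) -> L2 f.
Proof.
move=> mf if2; apply/andP; split.
  apply/mem_set; have m01 : measurable (`[0, 1]%classic : set R) by exact: measurable_itv.
  exact/(measurable_restrictT _ m01).
apply/mem_set; rewrite /= /finite_norm.
have := L2norm_sqr f; rewrite /L2norm; set N := 'N[_]_ _ [_]%E.
have N0 : (0 <= N)%E by exact: Lnorm_ge0.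
case: N N0 => [r| |]//= _; first by rewrite ltry.
rewrite /poweR/= pnatr_eq0/= => h.
have : (\int[lebesgue_measure]_(x in `[0%R, 1%R]) (f x ^+ 2)%:E)%E \is a fin_num.
  by apply: integrable_fin_num => //; exact: if2.
by rewrite -h.
Qed.

Lemma L2_intg f : L2 f -> intg f.
Proof.
move=> f2; apply: (@le_intg _ _ (fun x => 1 + f x ^+ 2)).
- exact: L2_measurable.
- by apply: intgD; [exact: intg_cst|exact: L2_sqr].
- by move=> x _; rewrite -[f x ^+ 2]real_normK ?num_real//; nra.
Qed.

Lemma L2_continuous f : continuous f -> L2 f.
Proof.
move=> cf; apply: intg_L2; first exact: continuous_measurable01.
apply: intg_continuous => x; have -> : (fun x => f x ^+ 2) = (fun x => f x * f x) by [].
by apply: cvgM; exact: cf.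
Qed.

Lemma L2norm_lt g (e : R) : L2 g -> (L2norm g < e%:E)%E ->
  I01 (fun x => g x ^+ 2) <= e ^+ 2.
Proof.
move=> g2; have := L2norm_sqr g.
have N0 : (0 <= L2norm g)%E by exact: Lnorm_ge0.
have -> : (\int[lebesgue_measure]_(x in `[0%R, 1%R]) (g x ^+ 2)%:E)%E =
   (I01 (fun x => g x ^+ 2))%:E.
  by rewrite /I01 /Rintegral fineK//; apply: integrable_fin_num => //; exact: L2_sqr.
case: (L2norm g) N0 => [r| |]//; rewrite lee_fin lte_fin poweR_EFin => r0 [<-] re.
rewrite -[2]/(2%:R) powR_mulrn// lerXn2r// ?nnegrE//; last exact: ltW.
by rewrite ltW// (le_lt_trans r0).
Qed.

End square_integrable.

(** * Power functions and comparison of power sums with integrals *)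

Section powers.
Context {R : realType}.
Implicit Types (x y p q : R).

Lemma powRD_gt0 x p q : 0 < x -> x `^ (p + q) = x `^ p * x `^ q.
Proof. by move=> x0; rewrite powRD// (gt_eqF x0) implybT. Qed.

Lemma powR_le_gt0 x y p : 0 <= p -> 0 <= x -> x <= y -> x `^ p <= y `^ p.
Proof.
by move=> p0 x0 xy; rewrite ge0_ler_powR// nnegrE// (le_trans x0 xy).
Qed.

Lemma powR_le_lt0 x y p : p <= 0 -> 0 < x -> x <= y -> y `^ p <= x `^ p.
Proof.
move=> p0 x0 xy; rewrite -(opprK p) [y `^ _]powRN [x `^ _]powRN.
rewrite lef_pV2 ?posrE ?powR_gt0// ?(lt_le_trans x0 xy)//.
by apply: powR_le_gt0 => //; [rewrite oppr_ge0|exact: ltW].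
Qed.

Lemma powR_MVT p x y : 0 < x -> x < y ->
  exists2 c, x < c < y & y `^ p - x `^ p = p * c `^ (p - 1) * (y - x).
Proof.
move=> x0 xy.
have dp (z : R) : 0 < z -> is_derive z 1 (fun t => t `^ p) (p * z `^ (p - 1)).
  by move=> z0; exact: is_derive1_powR.
have [z|z|c cxy ->] := @MVT R (fun t => t `^ p) (fun z => p * z `^ (p - 1)) x y xy.
- by rewrite in_itv/= => /andP[xz _]; apply: dp; exact: lt_trans xz.
- apply: continuous_in_subspaceT => t; rewrite inE/= in_itv/= => /andP[xt _].
  apply: differentiable_continuous; apply/derivable1_diffP.
  exact: (@ex_derive _ _ _ _ _ _ _ (dp t (lt_le_trans x0 xt))).
- by exists c => //; move: cxy; rewrite in_itv.
Qed.

(** Mean value theorem for [x^g], whose derivative is nonincreasing; the step from 0 to 1 is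
    separate, since [powR_MVT] requires a positive left end. *)
Lemma powR_step_concave (g : R) (k : nat) : 0 < g <= 1 ->
  k.+1%:R `^ (g - 1) <= (k.+1%:R `^ g - k%:R `^ g) / g :> R.
Proof.
move=> /andP[g0 g1]; rewrite ler_pdivlMr//; case: k => [|k].
  by rewrite !powR1 mul1r powR0 ?gt_eqF// subr0.
have k0 : 0 < k.+1%:R :> R by rewrite ltr0n.
have kk : k.+1%:R < k.+2%:R :> R by rewrite ltr_nat.
have [c /andP[c1 c2] ->] := powR_MVT g k0 kk.
rewrite -natrB// subSnn mulr1 mulrC ler_pM2l//.
apply: powR_le_lt0; [lra|exact: lt_trans c1|exact: ltW].
Qed.

Lemma sum_powR_concave (g : R) n : 0 < g <= 1 ->
  \sum_(0 <= k < n) k.+1%:R `^ (g - 1) <= n%:R `^ g / g :> R.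
Proof.
move=> g01; apply: (@le_trans _ _
    (\sum_(0 <= k < n) (k.+1%:R `^ g / g - k%:R `^ g / g))).
  apply: ler_sum => k _; rewrite -mulrBl; exact: powR_step_concave.
rewrite telescope_sumr// powR0 ?mul0r ?subr0// gt_eqF//.
by case/andP: g01.
Qed.

Lemma powR_step_convex (d : R) (k : nat) : 0 < d -> (0 < k)%N ->
  k.+1%:R `^ (- d - 1) <= (k%:R `^ (- d) - k.+1%:R `^ (- d)) / d :> R.
Proof.
move=> d0 k0; rewrite ler_pdivlMr//.
have {}k0 : 0 < k%:R :> R by rewrite ltr0n.
have kk : k%:R < k.+1%:R :> R by rewrite ltr_nat.
have [c /andP[c1 c2]] := powR_MVT (- d) k0 kk.
rewrite -natrB// subSnn mulr1 => h.
have -> : k%:R `^ (- d) - k.+1%:R `^ (- d) = d * c `^ (- d - 1).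
  by rewrite -opprB h; ring.
rewrite mulrC ler_pM2l//.
apply: powR_le_lt0; [lra|exact: lt_trans c1|exact: ltW].
Qed.

Lemma sum_powR_convex (d : R) m n : 0 < d -> (0 < m)%N ->
  \sum_(m <= k < n) k.+1%:R `^ (- d - 1) <= m%:R `^ (- d) / d :> R.
Proof.
move=> d0 m0; have [nm|mn] := leqP n m.
  by rewrite big_geq// divr_ge0// ?powR_ge0// ltW.
apply: (@le_trans _ _
    (\sum_(m <= k < n) (- (k.+1%:R `^ (- d) / d) - - (k%:R `^ (- d) / d)))).
  rewrite big_nat_cond [leRHS]big_nat_cond; apply: ler_sum => k.
  rewrite andbT => /andP[mk _].
  have -> : - (k.+1%:R `^ (- d) / d) - - (k%:R `^ (- d) / d) =
    (k%:R `^ (- d) - k.+1%:R `^ (- d)) / d by ring.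
  by apply: powR_step_convex => //; exact: leq_trans mk.
rewrite telescope_sumr ?(ltnW mn)// opprK addrC gerBl.
by rewrite divr_ge0// ?powR_ge0// ltW.
Qed.

Lemma sum_powR_le (d : R) n : 0 < d ->
  \sum_(0 <= k < n) k.+1%:R `^ (- d - 1) <= 1 + d^-1 :> R.
Proof.
move=> d0; case: n => [|n]; first by rewrite big_geq// addr_ge0// invr_ge0 ltW.
rewrite big_ltn// powR1 lerD2l.
by apply: le_trans (sum_powR_convex n.+1 d0 (ltn0Sn 0)) _; rewrite powR1 mul1r.
Qed.

Lemma powR_step_diff p (k : nat) : 0 <= p -> (0 < k)%N ->
  `|k%:R `^ (- p) - k.+1%:R `^ (- p)| <= p * k%:R `^ (- p - 1) :> R.
Proof.
move=> p0 k0; rewrite distrC.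
have kp : 0 < k%:R :> R by rewrite ltr0n.
have kk : k%:R < k.+1%:R :> R by rewrite ltr_nat.
have [c /andP[c1 c2] ->] := powR_MVT (- p) kp kk.
rewrite -natrB// subSnn mulr1 normrM normrN (ger0_norm p0).
rewrite (ger0_norm (powR_ge0 _ _)) ler_wpM2l// powR_le_lt0//; [lra|exact: ltW].
Qed.

End powers.

Section sobolev.
Context {R : realType}.
Implicit Types (f g : R -> R).

Lemma abs_sin_mul (k : nat) (t : R) : `|sin (k%:R * t)| <= k%:R * `|sin t|.
Proof.
elim: k => [|k IH]; first by rewrite !mul0r sin0 normr0.
rewrite -natr1 mulrDl mul1r sinD mulrDl mul1r.
apply: (le_trans (ler_normD _ _)); rewrite !normrM.
have h1 := cos_max t; have h2 := cos_max (k%:R * t).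
apply: lerD; last by rewrite ler_piMl.
by apply: le_trans IH; rewrite ler_piMr.
Qed.

(** Interpolation between [abs_sin_mul] and the bound by 1: the minimum of 1 and [S] is at most
    [S^b] when [0 < b <= 1]. *)
Lemma abs_sin_powR (k : nat) (t b : R) : 0 < b <= 1 -> (0 < k)%N ->
  `|sin (k%:R * t)| <= k%:R `^ b * `|sin t| `^ b.
Proof.
move=> /andP[b0 b1] k0; rewrite -powRM//; set S := k%:R * `|sin t|.
have [S1|S1] := leP S 1.
  have [S0|S0] := eqVneq S 0.
    by rewrite S0 powR0 ?gt_eqF// -S0 abs_sin_mul.
  apply: (le_trans (abs_sin_mul _ _)); rewrite -/S ger1_powR// S1 andbT.
  by rewrite lt_neqAle eq_sym S0 mulr_ge0.
apply: (le_trans (sin_max _)).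
by rewrite -[leLHS](@powRr0 _ S) ler_powR// ltW.
Qed.

Lemma dist_cs (k : nat) (x y : R) :
  `|cs k%:Z x - cs k%:Z y| <= 2 * `|sin (k%:R * (pi * (x - y)))|.
Proof.
rewrite /cs /freq -pmulrn.
set a := k%:R * (pi * (x + y)); set b := k%:R * (pi * (x - y)).
have -> : 2 * pi * k%:R * x = a + b by rewrite /a /b; ring.
have -> : 2 * pi * k%:R * y = a - b by rewrite /a /b; ring.
rewrite !cosD cosN sinN (_ : _ - _ = - (2 * (sin a * sin b))); last by ring.
rewrite normrN normrM ger0_norm// ler_pM2l// normrM ler_piMl//.
exact: sin_max.
Qed.

Lemma dist_sn (k : nat) (x y : R) :
  `|sn k%:Z x - sn k%:Z y| <= 2 * `|sin (k%:R * (pi * (x - y)))|.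
Proof.
rewrite /sn /freq -pmulrn.
set a := k%:R * (pi * (x + y)); set b := k%:R * (pi * (x - y)).
have -> : 2 * pi * k%:R * x = a + b by rewrite /a /b; ring.
have -> : 2 * pi * k%:R * y = a - b by rewrite /a /b; ring.
rewrite !sinD cosN sinN (_ : _ - _ = 2 * (cos a * sin b)); last by ring.
rewrite normrM ger0_norm// ler_pM2l// normrM ler_piMl//.
exact: cos_max.
Qed.

Lemma sum_delta n (F : nat -> R) k :
  \sum_(0 <= j < n) F j * (k == j)%:R = if (k < n)%N then F k else 0.
Proof.
elim: n => [|n IH]; first by rewrite big_geq.
rewrite big_nat_recr//= IH; have [->|kn] := eqVneq k n.
  by rewrite ltnn ltnSn mulr1 add0r.
by rewrite mulr0 addr0 [(k < n.+1)%N]ltnS (leq_eqVlt k n) (negbTE kn).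
Qed.

Lemma pairing_trig_cs n (A B : nat -> R) k : (0 < k)%N ->
  pairing (trig n A B) (cs k%:Z) = if (k < n)%N then 2^-1 * A k else 0.
Proof.
move=> k0; rewrite pairingC /pairing -/(I01 _) I01_trig; last exact: intg_cs.
rewrite -(sum_delta n (fun k => 2^-1 * A k)); apply: eq_bigr => j _.
rewrite /pairing -!/(I01 _) I01_cs_cs I01_cs_sn mulr0 addr0.
have -> : (k%:Z == - j%:Z) = false by case: k k0; case: j.
by rewrite addr0; change (k%:Z == j%:Z) with (k == j); ring.
Qed.

Lemma pairing_trig_sn n (A B : nat -> R) k : (0 < k)%N ->
  pairing (trig n A B) (sn k%:Z) = if (k < n)%N then 2^-1 * B k else 0.
Proof.
move=> k0; rewrite pairingC /pairing -/(I01 _) I01_trig; last exact: intg_sn.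
rewrite -(sum_delta n (fun k => 2^-1 * B k)); apply: eq_bigr => j _.
rewrite /pairing -!/(I01 _) I01_sn_cs I01_sn_sn mulr0 add0r.
have -> : (k%:Z == - j%:Z) = false by case: k k0; case: j.
by rewrite subr0; change (k%:Z == j%:Z) with (k == j); ring.
Qed.

Lemma bessel g n : L2 g ->
  \sum_(1 <= k < n) (pairing g (cs k%:Z) ^+ 2 + pairing g (sn k%:Z) ^+ 2) <=
  2^-1 * I01 (fun x => g x ^+ 2).
Proof.
move=> g2; have intg_g := L2_intg g2.
case: n => [|n]; first by rewrite big_geq// mulr_ge0// I01_ge0// => x _; exact: sqr_ge0.
(* [T] is the projection of [g] on the modes of positive frequency, whose squared norm is 1/2,
   whence the factor 2. The constant mode, of squared norm 1, is left out. *)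
pose A k := if k == 0%N then 0 else 2 * pairing g (cs k%:Z).
pose B k := if k == 0%N then 0 else 2 * pairing g (sn k%:Z).
pose T := trig n.+1 A B.
have ct : continuous T by exact: continuous_trig.
set S := (X in X <= _).
have gT : I01 (fun x => g x * T x) = 2 * S.
  rewrite I01_trig// big_ltn// /A /B/= !mul0r addr0 add0r big_distrr/=.
  by rewrite big_nat_cond [RHS]big_nat_cond; apply: eq_bigr => -[|k]//= _; ring.
have TT : I01 (fun x => T x * T x) = 2 * S.
  rewrite I01_trig; last exact: intg_continuous.
  rewrite big_ltn// {1}/A {1}/B/= !mul0r addr0 add0r big_distrr/=.
  rewrite big_nat_cond [RHS]big_nat_cond; apply: eq_bigr => -[|k]//=; rewrite andbT => kn.
  by rewrite pairing_trig_cs// pairing_trig_sn// kn /A /B/=; field.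
have : 0 <= I01 (fun x => (g x - T x) ^+ 2) by apply: I01_ge0 => x _; exact: sqr_ge0.
rewrite (@eq_I01 _ _ (fun x => g x ^+ 2 + (-2) * (g x * T x) + T x * T x)); last first.
  by move=> x _; ring.
have i1 : intg (fun x => g x * T x) by exact: intgM_continuous.
have i2 : intg (fun x => T x * T x) by apply: intgM_continuous => //; exact: intg_continuous.
have i3 : intg (fun x => g x ^+ 2) by exact: L2_sqr.
have i4 : intg (fun x => -2 * (g x * T x)) by exact: intgZ.
rewrite (I01D (intgD i3 i4) i2) (I01D i3 i4) (I01Z _ i1) gT TT.
set I := I01 _; lra.
Qed.

(** Young's inequality with weight [e] plays the role of Cauchy-Schwarz: if [e] bounds the L^2 norm
    of the function with coefficients [p], both terms sum to order [e]. *)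
Lemma fourier_coef_decay (s b e p a : R) (k : nat) : (0 < k)%N -> 0 <= s ->
  0 < e -> p = `|@freq R k%:Z| `^ s * a ->
  k%:R `^ b * `|a| <= 2^-1 * (e * k%:R `^ (2 * (b - s)) + p ^+ 2 / e).
Proof.
move=> k0 s0 e0 pa; have kR : 0 < k%:R :> R by rewrite ltr0n.
have kF : k%:R <= `|@freq R k%:Z|.
  rewrite /freq -pmulrn ger0_norm; last by rewrite !mulr_ge0// pi_ge0.
  by rewrite ler_peMl//; have := @pi_ge2 R; lra.
have ap : `|a| <= k%:R `^ (- s) * `|p|.
  rewrite pa normrM (ger0_norm (powR_ge0 _ _)) mulrA -[leLHS]mul1r ler_wpM2r//.
  rewrite powRN mulrC ler_pdivlMr ?powR_gt0// mul1r.
  by apply: powR_le_gt0 => //; exact: ltW.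
apply: (@le_trans _ _ (k%:R `^ (b - s) * `|p|)).
  by rewrite powRD_gt0// -mulrA ler_wpM2l// powR_ge0.
rewrite mulrC (mulrC 2 (b - s)) powRrM -[2]/(2%:R) powR_mulrn ?powR_ge0//.
set x := _ `^ _; rewrite -(ler_pM2r e0).
rewrite (_ : 2^-1 * _ * e = 2^-1 * (e ^+ 2 * x ^+ 2 + p ^+ 2)); last first.
  by field; rewrite gt_eqF.
rewrite -[p ^+ 2]real_normK ?num_real//; have := sqr_ge0 (e * x - `|p|).
nra.
Qed.

(** The condition [b < s - 1/2] says that [k^(2 (b - s))] is summable; the exponent is written
    [- d - 1] with [d > 0]. The squares of the coefficients of [g] are summed by [bessel]. *)
Lemma fourier_coef_sum (s b : R) : 0 <= s -> b < s - 1 / 2 ->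
  exists2 C : R, 0 < C & forall f g e n, 0 < e -> L2 g ->
  is_fraclap (s / 2) f g -> I01 (fun x => g x ^+ 2) <= e ^+ 2 ->
  \sum_(1 <= k < n) k%:R `^ b *
     (`|pairing f (cs k%:Z)| + `|pairing f (sn k%:Z)|) <= C * e.
Proof.
move=> s0 bs; pose d := 2 * s - 2 * b - 1; have d0 : 0 < d by rewrite /d; lra.
exists (2 + d^-1); first by rewrite addr_gt0 ?invr_gt0.
move=> f g e n e0 g2 /is_fraclapP fg ge.
apply: (@le_trans _ _ (\sum_(1 <= k < n) (e * k%:R `^ (- d - 1) + (2 * e)^-1 *
   (pairing g (cs k%:Z) ^+ 2 + pairing g (sn k%:Z) ^+ 2)))).
  rewrite big_nat_cond [leRHS]big_nat_cond; apply: ler_sum => k.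
  rewrite andbT => /andP[k0 _]; have [] := fg k%:Z.
  have -> : 2 * (s / 2) = s by field.
  move=> pa qa; have h1 := fourier_coef_decay b k0 s0 e0 pa.
  have h2 := fourier_coef_decay b k0 s0 e0 qa.
  have -> : - d - 1 = 2 * (b - s) by rewrite /d; ring.
  rewrite invfM; lra.
rewrite big_split/= -!big_distrr/=.
have S1 : \sum_(1 <= k < n) k%:R `^ (- d - 1) <= 1 + d^-1.
  case: n => [|n]; first by rewrite big_geq// addr_ge0// invr_ge0 ltW.
  by rewrite big_add1; exact: sum_powR_le.
have S2 := bessel n g2; set S := \sum_(1 <= k < n) k%:R `^ _ in S1 *.
set S' := (X in X <= _) in S2.
have -> : (2 * e)^-1 * S' = (2^-1 / e) * S' by rewrite invfM.
have h1 : e * S <= e * (1 + d^-1) by rewrite ler_wpM2l// ltW.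
have h2 : (2^-1 / e) * S' <= (2^-1 / e) * (2^-1 * e ^+ 2).
  rewrite ler_wpM2l//; first by rewrite mulr_ge0// invr_ge0 ltW.
  by apply: (le_trans S2); rewrite ler_pM2l// invr_gt0.
have h3 : (2^-1 / e) * (2^-1 * e ^+ 2) = 4^-1 * e by field; rewrite gt_eqF.
have h4 : 0 < e * d^-1 by rewrite mulr_gt0// invr_gt0.
lra.
Qed.

End sobolev.

(** * Absolutely convergent Fourier series *)

Section fourier_series.
Context {R : realType}.
Variable f : R -> R.
Hypothesis intf : intg f.
Hypothesis f0 : mean_zero f.
Variables (b K : R).
Hypothesis b01 : 0 < b <= 1.
Hypothesis fK : forall n, \sum_(1 <= k < n) k%:R `^ b *
     (`|pairing f (cs k%:Z)| + `|pairing f (sn k%:Z)|) <= K.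

Let a (k : nat) : R := 2 * pairing f (cs k%:Z).
Let c (k : nat) : R := 2 * pairing f (sn k%:Z).
Let V (n : nat) : R := \sum_(0 <= k < n) (`|a k| + `|c k|).
Let S (n : nat) : R -> R := trig n a c.

Let pcs0 : pairing f (cs 0) = 0.
Proof.
by rewrite -[RHS]f0; apply: eq_I01 => x _; rewrite cs0 mulr1.
Qed.

Let psn0 : pairing f (sn 0) = 0.
Proof.
by rewrite -[RHS](I01_cst 0); apply: eq_I01 => x _; rewrite sn0 mulr0.
Qed.

Let sum_from1 (F : nat -> R) n : F 0%N = 0 ->
  \sum_(0 <= k < n) F k = \sum_(1 <= k < n) F k.
Proof.
move=> F0; case: n => [|n]; first by rewrite !big_geq.
by rewrite big_ltn// F0 add0r.
Qed.

Lemma fourier_weighted_sum n : \sum_(0 <= k < n) k%:R `^ b * (`|a k| + `|c k|) <= 2 * K.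
Proof.
rewrite sum_from1; last by rewrite /a /c pcs0 psn0 mulr0 normr0 addr0 mulr0.
have := fK n; set X := \sum_(1 <= _ < _) _ => h.
rewrite (_ : \sum_(1 <= _ < _) _ = 2 * X); first by rewrite ler_pM2l.
rewrite /X big_distrr/=; apply: eq_bigr => k _.
by rewrite /a /c !normrM (ger0_norm (ler0n _ 2)); ring.
Qed.

Lemma fourier_sum_bound n : V n <= 2 * K.
Proof.
apply: le_trans (fourier_weighted_sum n); apply: ler_sum => -[|k] _.
  by rewrite /a /c pcs0 psn0 mulr0 normr0 addr0 mulr0.
rewrite ler_peMl ?addr_ge0// -[leLHS](powRr0 k.+1%:R).
by apply: ler_powR; [rewrite ler1n|move: b01 => /andP[/ltW]].
Qed.

Let V_cvg : cvgn V.
Proof.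
apply: nondecreasing_is_cvgn.
  by apply/nondecreasing_seqP => n; rewrite /V big_nat_recr//= lerDl addr_ge0.
by exists (2 * K) => _ [n _ <-]; exact: fourier_sum_bound.
Qed.

Lemma dist_partial_sum m n x : (m <= n)%N -> `|S n x - S m x| <= V n - V m.
Proof.
move=> mn; rewrite /S /trig /V !(big_cat_nat (leq0n m) mn)/= [X in `|X|]addrAC subrr add0r.
rewrite [leRHS]addrAC subrr add0r; apply: (le_trans (ler_norm_sum _ _ _)).
apply: ler_sum => k _; apply: (le_trans (ler_normD _ _)); rewrite !normrM.
by apply: lerD; rewrite ler_piMr//; [exact: cs_le1|exact: sn_le1].
Qed.

Definition fourier_series (x : R) : R := limn (fun n => S n x).

Let S_cvg x : cvgn (fun n => S n x).
Proof.
apply: (@normed_cvg _ _ (fun k => a k * cs k%:Z x + c k * sn k%:Z x)).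
apply: (@series_le_cvg _ _ (fun k => `|a k| + `|c k|)) => [k|k|k|].
- exact: normr_ge0.
- by rewrite addr_ge0.
- apply: (le_trans (ler_normD _ _)); rewrite !normrM.
  by apply: lerD; rewrite ler_piMr//; [exact: cs_le1|exact: sn_le1].
- exact: V_cvg.
Qed.

(** The tail of the majorant [V] does not depend on [x]. This uniformity gives the continuity of the
    sum and lets pairings pass to the limit. *)
Lemma dist_fourier_series n x : `|fourier_series x - S n x| <= limn V - V n.
Proof.
have h : `|S m x - S n x| @[m --> \oo] --> `|fourier_series x - S n x|.
  by apply: cvg_norm; apply: cvgB; [exact: S_cvg|exact: cvg_cst].
have h' : V m - V n @[m --> \oo] --> limn V - V n.
  by apply: cvgB; [exact: V_cvg|exact: cvg_cst].
apply: (ler_cvg_to h h'); exists n => // m /= nm; exact: dist_partial_sum.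
Qed.

Let tail_cvg0 : limn V - V n @[n --> \oo] --> (0 : R).
Proof.
rewrite -(subrr (limn V)); apply: cvgB; [exact: cvg_cst|exact: V_cvg].
Qed.

Lemma fourier_series_bound x : `|fourier_series x| <= 2 * K.
Proof.
have h := dist_fourier_series 0 x.
rewrite /S /trig /V !big_geq// !subr0 in h; apply: (le_trans h).
apply: limr_le; first exact: V_cvg.
by apply: nearW => n; exact: fourier_sum_bound.
Qed.

Lemma fourier_series_hoelder x y :
  `|fourier_series x - fourier_series y| <= 4 * K * `|sin (pi * (x - y))| `^ b.
Proof.
have h : `|S n x - S n y| @[n --> \oo] --> `|fourier_series x - fourier_series y|.
  by apply: cvg_norm; apply: cvgB; exact: S_cvg.
apply: (ler_cvg_to h (cvg_cst _)); apply: nearW => n.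
rewrite /S /trig -sumrB; apply: (le_trans (ler_norm_sum _ _ _)).
set Z := `|sin _| `^ b.
apply: (@le_trans _ _ (2 * Z * \sum_(0 <= k < n) k%:R `^ b * (`|a k| + `|c k|))).
  rewrite big_distrr/=; apply: ler_sum => -[|k] _.
    by rewrite !cs0 !sn0 subrr normr0 /a /c pcs0 psn0 !mulr0 normr0 addr0 !mulr0.
  have -> : a k.+1 * cs k.+1 x + c k.+1 * sn k.+1 x -
     (a k.+1 * cs k.+1 y + c k.+1 * sn k.+1 y) =
     a k.+1 * (cs k.+1 x - cs k.+1 y) + c k.+1 * (sn k.+1 x - sn k.+1 y) by ring.
  apply: (le_trans (ler_normD _ _)); rewrite (normrM (a k.+1)) (normrM (c k.+1)).
  have h1 := dist_cs k.+1 x y; have h2 := dist_sn k.+1 x y.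
  have h3 := abs_sin_powR (pi * (x - y)) b01 (ltn0Sn k).
  rewrite -/Z in h3; set w := _ `^ b in h3 *; set t := `|sin _| in h1 h2 h3.
  have h4 : 2 * t <= 2 * (w * Z) by rewrite ler_pM2l.
  have h5 := ler_wpM2l (normr_ge0 (a k.+1)) (le_trans h1 h4).
  have h6 := ler_wpM2l (normr_ge0 (c k.+1)) (le_trans h2 h4).
  apply: (le_trans (lerD h5 h6)); rewrite le_eqVlt; apply/orP; left; apply/eqP; ring.
have := ler_wpM2l (_ : 0 <= 2 * Z) (fourier_weighted_sum n).
move=> /(_ (mulr_ge0 _ (powR_ge0 _ _))) h'.
by apply: (le_trans (h' _)) => //; rewrite le_eqVlt; apply/orP; left; apply/eqP; ring.
Qed.

Lemma continuous_fourier_series : continuous fourier_series.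
Proof.
move=> x; apply/cvgrPdist_le => e e0.
have e3 : 0 < e / 3 by rewrite divr_gt0.
move/cvgrPdist_le: (tail_cvg0) => /(_ _ e3)[n _ /(_ n (leqnn n)) hn].
rewrite sub0r normrN in hn.
move/cvgrPdist_le: (@continuous_trig R n a c x) => /(_ _ e3).
apply: filterS => y hy.
have h1 := dist_fourier_series n x; have h2 := dist_fourier_series n y.
have h3 := le_trans (ler_norm _) hn.
rewrite (_ : _ - _ = (fourier_series x - S n x) + (S n x - S n y) -
   (fourier_series y - S n y)); last by ring.
apply: (le_trans (ler_normB _ _)); apply: (le_trans (lerD (ler_normD _ _) (lexx _))).
move: hy; rewrite -/(S n) => hy; lra.
Qed.

Let intS n : intg (S n).
Proof. exact/intg_continuous/continuous_trig. Qed.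

Lemma pairing_fourier_series (h : R -> R) (v : R) : continuous h ->
  (forall x, `|h x| <= 1) -> (\forall n \near \oo, pairing (S n) h = v) ->
  pairing fourier_series h = v.
Proof.
move=> ch h1 hv.
have ifs : intg fourier_series by exact/intg_continuous/continuous_fourier_series.
have : pairing (S n) h @[n --> \oo] --> pairing fourier_series h.
  apply/cvgrPdist_le => e e0.
  move/cvgrPdist_le: (tail_cvg0) => /(_ _ e0); apply: filterS => n hn.
  rewrite sub0r normrN in hn; apply: le_trans hn.
  apply: le_trans (ler_norm _).
  rewrite /pairing -!/(I01 _) -I01B; [|exact: intgM_continuous..].
  apply: le_norm_I01; first by apply: intgB; exact: intgM_continuous.
  move=> x _; rewrite -mulrBl normrM; apply: le_trans (dist_fourier_series n x).
  by rewrite ler_piMr.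
have : pairing (S n) h @[n --> \oo] --> v.
  by apply: cvg_near_cst.
by move=> l1 l2; have := cvg_unique _ l2 l1; apply.
Qed.

Lemma fourier_series_ae :
  {ae (@lebesgue_measure R), forall x, x \in `[0, 1] -> f x = fourier_series x}.
Proof.
have ifs : intg fourier_series by exact/intg_continuous/continuous_fourier_series.
pose h x := f x - fourier_series x.
have ih : intg h by exact: intgB.
have hcs (k : nat) : I01 (fun x => h x * cs k%:Z x) = 0.
  rewrite (@eq_I01 _ _ (fun x => f x * cs k%:Z x - fourier_series x * cs k%:Z x)); last first.
    by move=> x _; rewrite mulrBl.
  rewrite I01B; [|apply: intgM_continuous => //; exact: continuous_cs..].
  apply/eqP; rewrite subr_eq0 eq_sym; apply/eqP.
  apply: pairing_fourier_series; [exact: continuous_cs|exact: cs_le1|].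
  exists k.+1 => // n /= kn; case: k kn => [|k] kn.
    rewrite [RHS]pcs0 pairingC /pairing -/(I01 _) I01_trig; last exact: intg_cs.
    rewrite big1// => j _; rewrite /pairing -!/(I01 _) I01_cs_cs I01_cs_sn mulr0 addr0.
    case: j => [|j]; first by rewrite /a pcs0 mulr0 mul0r.
    rewrite (_ : (0%Z == j.+1%:Z) = false)// (_ : (0%Z == - j.+1%:Z) = false)//.
    by rewrite addr0 !mulr0.
  by rewrite pairing_trig_cs// kn /a mulKf// pnatr_eq0.
have hsn (k : nat) : I01 (fun x => h x * sn k%:Z x) = 0.
  rewrite (@eq_I01 _ _ (fun x => f x * sn k%:Z x - fourier_series x * sn k%:Z x)); last first.
    by move=> x _; rewrite mulrBl.
  rewrite I01B; [|apply: intgM_continuous => //; exact: continuous_sn..].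
  apply/eqP; rewrite subr_eq0 eq_sym; apply/eqP.
  apply: pairing_fourier_series; [exact: continuous_sn|exact: sn_le1|].
  exists k.+1 => // n /= kn; case: k kn => [|k] kn.
    rewrite [RHS]psn0 -[RHS](I01_cst 0); apply: eq_I01 => x _.
    by rewrite sn0 mulr0.
  by rewrite pairing_trig_sn// kn /c mulKf// pnatr_eq0.
have hcsZ (k : int) : I01 (fun x => h x * cs k x) = 0.
  case: k => k; first exact: hcs.
  by rewrite -[RHS](hcs k.+1); apply: eq_I01 => x _; rewrite NegzE csN.
have hsnZ (k : int) : I01 (fun x => h x * sn k x) = 0.
  case: k => k; first exact: hsn.
  rewrite -[RHS](mulr0 (-1)) -(hsn k.+1) -I01Z; last first.
    by apply: intgM_continuous => //; exact: continuous_sn.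
  by apply: eq_I01 => x _; rewrite NegzE snN mulN1r mulrN.
have := fourier_uniqueness ih hcsZ hsnZ.
by apply: aeS => x H x01; apply/eqP; rewrite -subr_eq0; apply/eqP; exact: H.
Qed.

End fourier_series.

Section sobolev_embedding.
Context {R : realType}.
Implicit Types (f g : R -> R).

Lemma sobolev_embedding (s b : R) : 0 <= s -> 0 < b <= 1 -> b < s - 1 / 2 ->
  exists2 C : R, 0 < C & forall f g e, 0 < e -> L2 f -> mean_zero f ->
  L2 g -> is_fraclap (s / 2) f g -> (L2norm g < e%:E)%E ->
  exists ft : R -> R, [/\ continuous ft,
    {ae (@lebesgue_measure R), forall x, x \in `[0, 1] -> f x = ft x},
    forall x, `|ft x| <= C * e &
    forall x y, `|ft x - ft y| <= C * e * `|sin (pi * (x - y))| `^ b].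
Proof.
move=> s0 b01 bs; have [C C0 HC] := fourier_coef_sum s0 bs.
exists (4 * C); first by rewrite mulr_gt0.
move=> f g e e0 f2 fm g2 fg ge.
have fK n := HC f g e n e0 g2 fg (L2norm_lt g2 ge).
have intf := L2_intg f2.
exists (fourier_series f); split.
- exact: (continuous_fourier_series fm b01 fK).
- exact: (fourier_series_ae intf fm b01 fK).
- move=> x; apply: (le_trans (fourier_series_bound fm b01 fK x)).
  have : 0 < C * e by rewrite mulr_gt0.
  lra.
- move=> x y; rewrite -(mulrA 4).
  exact: (fourier_series_hoelder fm b01 fK).
Qed.

End sobolev_embedding.

(** * Monotonicity of absolutely continuous functions *)

Section real_induction.
Context {R : realType}.

(** Let [S] be the supremum of the [t] such that [P] holds on [[a, t]]. The limit hypothesis gives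
    [P S], and the step hypothesis would go beyond [S] unless [S = b]. *)
Lemma real_induction (a b : R) (P : R -> Prop) : P a ->
  (forall t, a <= t -> t < b -> P t ->
     exists2 d, 0 < d & forall r, t < r -> r < t + d -> r <= b -> P r) ->
  (forall t, a < t -> t <= b -> (forall r, a <= r -> r < t -> P r) -> P t) ->
  forall t, a <= t -> t <= b -> P t.
Proof.
move=> Pa step lim t0 at0 t0b; have ab := le_trans at0 t0b.
pose A := [set t | a <= t <= b /\ forall r, a <= r -> r <= t -> P r].
have Aa : A a.
  split; first by rewrite lexx.
  by move=> r ar ra; have -> : r = a by apply/eqP; rewrite eq_le ra ar.
have ubA : has_sup A by split; [exists a|exists b => x [/andP[]]].
have aS : a <= sup A by apply: ub_le_sup => //; case: ubA.
have Sb : sup A <= b by apply: ge_sup; [exists a|move=> x [/andP[]]].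
have PS r : a <= r -> r < sup A -> P r.
  move=> ar /(sup_gt (ex_intro _ a Aa))[t [_ At] rt]; exact: At _ ar (ltW rt).
have PSS : P (sup A).
  move: aS; rewrite le_eqVlt => /orP[/eqP <-//|aS].
  exact: lim.
have [Sb'|bS] := ltP (sup A) b; last first.
  have [t0S|St0] := ltP t0 (sup A); first exact: PS.
  have -> // : t0 = sup A.
  by apply/eqP; rewrite eq_le St0 (le_trans t0b).
have [d d0 Hd] := step _ aS Sb' PSS.
pose T := Num.min (sup A + d / 2) b.
have ST : sup A < T by rewrite /T lt_min Sb' andbT ltrDl divr_gt0.
have AT : A T.
  split; first by rewrite (le_trans aS (ltW ST))/= /T ge_min lexx orbT.
  move=> r ar rT; have [rS|] := ltP r (sup A); first exact: PS.
  rewrite le_eqVlt => /orP[/eqP <-//|Sr]; apply: Hd => //.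
    apply: (le_lt_trans rT); rewrite /T gt_min; apply/orP; left; lra.
  by apply: (le_trans rT); rewrite /T ge_min lexx orbT.
have : T <= sup A by apply: ub_le_sup => //; case: ubA.
by rewrite leNgt ST.
Qed.

(** Only intervals [[l, r]] containing [t] are compared, because differentiability at [t] controls
    no others. *)
Lemma locally_monotone (a b : R) (h : R -> R) : a <= b ->
  (forall t, a <= t -> t <= b -> exists2 d, 0 < d &
     forall l r, a <= l -> r <= b -> t - d < l -> l <= t -> t <= r -> r < t + d ->
       h l <= h r) -> h a <= h b.
Proof.
move=> ab loc; apply: (@real_induction a b (fun t => h a <= h t)) => //.
- move=> t at_ tb hat; have [d d0 Hd] := loc t at_ (ltW tb).
  exists d => // r tr rd rb; apply: (le_trans hat); apply: Hd => //; last exact: ltW.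
  by rewrite ltrBlDr ltrDl.
- move=> t at_ tb H; have [d d0 Hd] := loc t (ltW at_) tb.
  pose l := Num.max a (t - d / 2).
  have lt_ : l < t by rewrite /l gt_max at_/=; lra.
  have al : a <= l by rewrite /l le_max lexx.
  apply: (le_trans (H l al lt_)); apply: Hd => //; last 2 first.
  + exact: ltW.
  + by rewrite ltrDl.
  + by rewrite /l lt_max; apply/orP; right; lra.
Qed.

Lemma is_derive_dist (f : R -> R) (t df e : R) : is_derive t 1 f df -> 0 < e ->
  exists2 d, 0 < d & forall x, `|x - t| < d ->
    `|f x - f t - df * (x - t)| <= e * `|x - t|.
Proof.
move=> fdf e0.
have := @ex_derive _ _ _ _ _ _ _ fdf; rewrite /derivable => /cvgP.
have := @derive_val _ _ _ _ _ _ _ fdf; rewrite /derive => ->.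
move=> /cvgrPdist_le /(_ _ e0)[d /= d0 Hd]; exists d => // x xd.
have [->|xt] := eqVneq x t; first by rewrite !subrr mulr0 subr0 normr0 mulr0.
have xt0 : x - t != 0 by rewrite subr_eq0.
have := Hd (x - t); rewrite /= sub0r normrN => /(_ xd xt0).
rewrite /GRing.scale/= mulr1 subrK => h.
have -> : f x - f t - df * (x - t) =
  - ((df - (x - t)^-1 * (f x - f t)) * (x - t)) by field.
by rewrite normrN normrM ler_wpM2r.
Qed.

End real_induction.

(** * Absolutely continuous functions with derivative bounded below *)

Section absolute_continuity.
Context {R : realType}.

Lemma absolutely_continuous_sub_linear (a b c : R) (f : R -> R) :
  absolutely_continuous a b f -> absolutely_continuous a b (fun t => f t - c * t).
Proof.
move=> acf e e0; have e2 : 0 < e / 2 by rewrite divr_gt0.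
have [d d0 Hd] := acf _ e2.
have c1 : 0 < `|c| + 1 by rewrite ltr_wpDl.
exists (Num.min d (e / 2 / (`|c| + 1))); first by rewrite lt_min d0 divr_gt0.
move=> n l r lr dis; rewrite lt_min => /andP[s1 s2].
have h1 := Hd n l r lr dis s1.
rewrite ltr_pdivlMr// in s2.
apply: (@le_lt_trans _ _ (\sum_(i < n) `|f (r i) - f (l i)| +
   (`|c| + 1) * \sum_(i < n) (r i - l i))).
  rewrite big_distrr/= -big_split/=; apply: ler_sum => i _.
  have -> : f (r i) - c * r i - (f (l i) - c * l i) =
     (f (r i) - f (l i)) - c * (r i - l i) by ring.
  apply: (le_trans (ler_normB _ _)); rewrite lerD2l normrM.
  have [_ lri _] := lr i; rewrite (ger0_norm (_ : 0 <= r i - l i)) ?subr_ge0//.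
  by rewrite ler_wpM2r ?subr_ge0// lerDl.
rewrite mulrC; lra.
Qed.

Lemma sum_length_le_measure (U : set R) n (l r : 'I_n -> R) (d : R) :
  measurable U -> (lebesgue_measure U < d%:E)%E ->
  (forall i, l i <= r i) -> (forall i, `[l i, r i]%classic `<=` U) ->
  (forall i j, i != j -> r i <= l j \/ r j <= l i) ->
  \sum_(i < n) (r i - l i) < d.
Proof.
move=> mU Ud lr lrU dis; rewrite -lte_fin; apply: le_lt_trans Ud.
rewrite -sumEFin.
(* Open intervals, since the closed ones may share endpoints. *)
pose F (i : 'I_n) : set R := `]l i, r i[%classic.
have mF i : measurable (F i) by exact: measurable_itv.
have tF : trivIset setT F.
  apply/trivIsetP => i j _ _ ij; apply/seteqP; split => // x /=.
  rewrite /F/= !in_itv/= => -[/andP[lx xr] /andP[lx' xr']].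
  by case: (dis _ _ ij) => h; lra.
have -> : \sum_(i < n) (r i - l i)%:E = (\sum_(i < n) (@lebesgue_measure R) (F i))%E.
  apply: eq_bigr => i _; rewrite /F lebesgue_measure_itv/= lte_fin.
  case: ltP => // h; have -> : r i = l i by apply/eqP; rewrite eq_le h lr.
  by rewrite subrr.
rewrite -(@measure_bigsetU_ord _ _ _ (@lebesgue_measure R) n predT F mF tF).
apply: le_measure; rewrite ?inE//.
  by apply: bigsetU_measurable => i _; exact: mF.
apply: (big_ind (fun A : set R => A `<=` U)) => [//|A B AU BU|i _].
  by rewrite subUset.
move=> x; rewrite /F/= in_itv/= => /andP[lx xr]; apply: (lrU i).
by rewrite /= in_itv/= !ltW.
Qed.

Section small_variation.
Variables (a b e : R) (g : R -> R) (U : set R).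
Hypothesis e0 : 0 < e.
Hypothesis Ug : forall (n : nat) (l r : 'I_n -> R),
  (forall i, [/\ a <= l i, l i <= r i & r i <= b]) ->
  (forall i, `[l i, r i]%classic `<=` U) ->
  (forall i j, i != j -> r i <= l j \/ r j <= l i) ->
  \sum_(i < n) `|g (r i) - g (l i)| < e.

Definition variations (t : R) : set R := [set v | exists n (l r : 'I_n -> R),
  [/\ forall i, [/\ a <= l i, l i <= r i & r i <= t],
     forall i, `[l i, r i]%classic `<=` U,
     forall i j, i != j -> r i <= l j \/ r j <= l i &
     v = \sum_(i < n) `|g (r i) - g (l i)|] ].

(** Total variation of [g] on [[a, t]] counted only inside [U]: a nondecreasing function, at most
    [e], that makes up for any decrease of [g] within [U]. *)
Definition variation (t : R) : R := sup (variations t).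

Lemma variations0 t : variations t 0.
Proof.
exists 0%N, (fun=> 0), (fun=> 0); split => [[]|[]|[]|]//.
by rewrite big_ord0.
Qed.

Lemma ubound_variations t : t <= b -> ubound (variations t) e.
Proof.
move=> tb _ [n [l [r [lr lrU dis ->]]]]; apply: ltW; apply: Ug => // i.
by have [? ? ?] := lr i; split => //; exact: le_trans tb.
Qed.

Lemma has_sup_variations t : t <= b -> has_sup (variations t).
Proof.
move=> tb; split; [exists 0; exact: variations0|exists e; exact: ubound_variations].
Qed.

Lemma variation_ge0 t : t <= b -> 0 <= variation t.
Proof. by move=> tb; apply: sup_upper_bound; [exact: has_sup_variations|exact: variations0]. Qed.

Lemma variation_le t : t <= b -> variation t <= e.
Proof.
move=> tb; apply: ge_sup; first by exists 0; exact: variations0.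
exact: ubound_variations.
Qed.

Lemma variation_mono s t : s <= t -> t <= b -> variation s <= variation t.
Proof.
move=> st tb; apply: ge_sup; first by exists 0; exact: variations0.
move=> _ [n [l [r [lr lrU dis ->]]]]; apply: sup_upper_bound.
  exact: has_sup_variations.
exists n, l, r; split => // i; have [? ? ?] := lr i.
by split => //; exact: le_trans st.
Qed.

Lemma variation_add s t : a <= s -> s <= t -> t <= b -> `[s, t]%classic `<=` U ->
  variation s + `|g t - g s| <= variation t.
Proof.
move=> as_ st tb stU; rewrite -lerBrDr; apply: ge_sup.
  by exists 0; exact: variations0.
move=> _ [n [l [r [lr lrU dis ->]]]]; rewrite lerBrDr; apply: sup_upper_bound.
  exact: has_sup_variations.
(* [ext] appends [x] at the last index: the interval [[s, t]] lies to the right of the whole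
   family. *)
pose ext (x : R) (p : 'I_n -> R) (i : 'I_n.+1) :=
  if unlift ord_max i is Some j then p j else x.
have extl x p j : ext x p (lift ord_max j) = p j by rewrite /ext liftK.
have extm x p : ext x p ord_max = x by rewrite /ext unlift_none.
exists n.+1, (ext s l), (ext t r); split.
- move=> i; case: (unliftP ord_max i) => [j|] ->; rewrite ?extl ?extm//.
  by have [? ? ?] := lr j; split => //; exact: le_trans st.
- by move=> i; case: (unliftP ord_max i) => [j|] ->; rewrite ?extl ?extm//; exact: lrU.
- move=> i j; case: (unliftP ord_max i) => [i'|] ->;
    case: (unliftP ord_max j) => [j'|] ->; rewrite ?extl ?extm ?eqxx//.
  + by move=> ij; apply: dis; apply: contra ij => /eqP ->.
  + by move=> _; left; have [] := lr i'.
  + by move=> _; right; have [] := lr j'.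
- rewrite big_ord_recr/= !extm; congr (_ + _); apply: eq_bigr => i _.
  have -> : widen_ord (leqnSn n) i = lift ord_max i.
    by apply/val_inj; rewrite /= /bump leqNgt ltn_ord.
  by rewrite !extl.
Qed.

End small_variation.

(** The exceptional times lie in an open set [U] of measure so small that [g] varies by less than
    [e] on it. With [G] the variation inside [U], the function [g t + e t + G t] is locally
    monotone: on [U] because [G] grows at least as fast as [g] can fall, elsewhere because the slope
    [e] absorbs the error of a nonnegative derivative. As [G] lies between 0 and [e], letting [e]
    tend to 0 concludes. *)
Lemma absolutely_continuous_nondecreasing (a b : R) (g : R -> R) :
  a <= b -> absolutely_continuous a b g ->
  {ae (@lebesgue_measure R), forall t, t \in `]a, b[ ->
     exists2 dg, 0 <= dg & is_derive t 1 g dg} ->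
  g a <= g b.
Proof.
move=> ab acg [N [mN N0 Nsub]].
suff H e : 0 < e -> g a <= g b + e * (b - a) + e.
  rewrite leNgt; apply/negP => gab.
  pose e := (g a - g b) / 2 / (b - a + 1).
  have b1 : 0 < b - a + 1 by lra.
  have e0 : 0 < e by rewrite /e !divr_gt0// subr_gt0.
  have := H e e0.
  have : e * (b - a + 1) = (g a - g b) / 2 by rewrite /e divfK// gt_eqF.
  nra.
move=> e0; have [d d0 Hd] := acg _ e0.
(* The endpoints join the exceptional set, the derivative being known only inside the interval. *)
pose N' := N `|` [set a; b].
have mN' : measurable N' by apply: measurableU => //; apply: measurableU.
have N'0 : (@lebesgue_measure R) N' = 0%E.
  apply: measure_negligible => //; apply: negligibleU; apply/negligibleP => //.
    by apply: measurableU.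
  apply: countable_lebesgue_measure0.
  by apply: finite_set_countable; rewrite finite_setU.
have N'y : ((@lebesgue_measure R) N' < +oo)%E by rewrite N'0 ltry.
have [U [oU NU Ud]] := @lebesgue_regularity_outer R N' d mN' N'y d0.
have mU : measurable U by exact: open_measurable.
have {}Ud : (@lebesgue_measure R U < d%:E)%E.
  apply: le_lt_trans Ud.
  have h : (@lebesgue_measure R U <= lebesgue_measure N' + lebesgue_measure (U `\` N'))%E.
    by rewrite -{1}(setDUK NU); apply: measureU2 => //; exact: measurableD.
  by rewrite N'0 add0e in h.
have Ug (n : nat) (l r : 'I_n -> R) : (forall i, [/\ a <= l i, l i <= r i & r i <= b]) ->
    (forall i, `[l i, r i]%classic `<=` U) ->
    (forall i j, i != j -> r i <= l j \/ r j <= l i) ->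
    \sum_(i < n) `|g (r i) - g (l i)| < e.
  move=> lr lrU dis; apply: Hd => //.
  by apply: (sum_length_le_measure mU Ud) => // i; have [] := lr i.
pose G := variation a g U.
suff : g a + e * a + G a <= g b + e * b + G b.
  have h1 := variation_ge0 Ug ab; have h2 := variation_le Ug (lexx b).
  rewrite -/G in h1 h2; lra.
apply: (@locally_monotone _ a b (fun t => g t + e * t + G t)) => // t at_ tb.
have [tU|tU] := pselect (U t).
  have := open_nbhs_nbhs (conj oU tU); move=> [d' /= d'0 Hd'].
  exists d' => // l r al rb dl lt_ tr rd.
  have lr := le_trans lt_ tr.
  have : `[l, r]%classic `<=` U.
    move=> x /=; rewrite in_itv/= => /andP[lx xr]; apply: Hd' => /=.
    by rewrite ltr_norml; apply/andP; split; lra.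
  move=> /(variation_add Ug al lr rb); rewrite -/G => h.
  have h1 : `|g r - g l| >= g l - g r by rewrite distrC; exact: ler_norm.
  have h2 : e * l <= e * r by rewrite ler_pM2l.
  lra.
have at0 : a < t.
  rewrite lt_neqAle at_ andbT; apply/eqP => at0; apply: tU; apply: NU.
  by right; left.
have tb0 : t < b.
  rewrite lt_neqAle tb andbT; apply/eqP => tb0; apply: tU; apply: NU.
  by right; right.
have [dg dg0 gdg] : exists2 dg, 0 <= dg & is_derive t 1 g dg.
  apply: contrapT => H; apply: tU; apply: NU; left; apply: Nsub => /= H'.
  by apply: H; apply: H'; rewrite in_itv/= at0.
have [d' d'0 Hd'] := is_derive_dist gdg e0.
exists d' => // l r al rb dl lt_ tr rd.
have lr := le_trans lt_ tr.
have hG := variation_mono Ug lr rb; rewrite -/G in hG.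
have h1 := Hd' l _; have h2 := Hd' r _.
have {}h1 : `|g l - g t - dg * (l - t)| <= e * `|l - t|.
  by apply: Hd'; rewrite ltr_norml; apply/andP; split; lra.
have {}h2 : `|g r - g t - dg * (r - t)| <= e * `|r - t|.
  by apply: Hd'; rewrite ltr_norml; apply/andP; split; lra.
rewrite (ler0_norm (_ : l - t <= 0)) ?subr_le0// in h1.
rewrite (ger0_norm (_ : 0 <= r - t)) ?subr_ge0// in h2.
move: h1 h2; rewrite !ler_norml => /andP[h11 h12] /andP[h21 h22].
have k1 : 0 <= dg * (t - l) by rewrite mulr_ge0// subr_ge0.
have k2 : 0 <= dg * (r - t) by rewrite mulr_ge0// subr_ge0.
lra.
Qed.

Lemma absolutely_continuous_ge (a b c : R) (f : R -> R) :
  a <= b -> absolutely_continuous a b f ->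
  {ae (@lebesgue_measure R), forall t, t \in `]a, b[ ->
     exists2 df, c <= df & is_derive t 1 f df} ->
  c * (b - a) <= f b - f a.
Proof.
move=> ab acf fdf.
suff : f a - c * a <= f b - c * b by lra.
apply: (absolutely_continuous_nondecreasing (g := fun t => f t - c * t) ab).
  exact: absolutely_continuous_sub_linear.
apply: aeS fdf => t Ht /Ht[df cdf fdf]; exists (df - c); first by rewrite subr_ge0.
have h : is_derive t 1 (fun x => f x + - c * x) (df + - c * 1).
  apply: is_derive_add => //; apply: is_deriveMl; exact: is_derive_id.
rewrite (_ : (fun x => f x - c * x) = (fun x => f x + - c * x)).
  by apply: (is_derive_congr h); ring.
by apply/funext => x; rewrite mulNr.
Qed.

Lemma absolutely_continuous_itvS (a b c d : R) (f : R -> R) :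
  a <= c -> d <= b -> absolutely_continuous a b f -> absolutely_continuous c d f.
Proof.
move=> ac db acf e e0; have [del d0 Hd] := acf e e0; exists del => // n l r lr.
by apply: Hd => i; have [? ? ?] := lr i; split=> //; [exact: le_trans ac _|exact: le_trans db].
Qed.

End absolute_continuity.

(** * Kernel estimates *)

Section fejer_kernel.
Context {R : realType}.
Implicit Types (k n : nat) (x : R).

(** The unnormalized Fejer kernel [(sin (k pi x) / sin (pi x))^2], of mean [k] and with value [k^2]
    at 0. *)
Definition fejer k x : R :=
  k%:R + 2 * \sum_(1 <= j < k) (k - j)%:R * cs j%:Z x.

(** Truncated subtraction makes the additional terms vanish, so that kernels of different orders can
    be added over one common range. *)
Lemma fejer_widen k n x : (k <= n)%N ->
  fejer k x = k%:R + 2 * \sum_(1 <= j < n) (k - j)%:R * cs j%:Z x.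
Proof.
case: k => [|k] kn; rewrite /fejer.
  rewrite big_geq// big1// => j _.
  by rewrite sub0n mul0r.
rewrite (big_cat_nat (n := k.+1) (p := n))//=.
rewrite [X in _ + 2 * (_ + X)]big_nat_cond.
rewrite [X in _ + 2 * (_ + X)]big1 ?addr0// => j; rewrite andbT => /andP[kj _].
have /eqP -> : (k.+1 - j == 0)%N by rewrite subn_eq0.
by rewrite mul0r.
Qed.

Lemma dirichletM k x : (1 + 2 * \sum_(1 <= j < k.+1) cs j%:Z x) * sin (pi * x) =
  sin ((2 * k%:R + 1) * (pi * x)).
Proof.
elim: k => [|k IH]; first by rewrite big_geq// !mulr0 addr0 add0r !mul1r.
rewrite big_nat_recr//= mulrDr addrA mulrDl IH {IH}.
rewrite /cs /freq -pmulrn; set t := pi * x.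
have -> : 2 * pi * k.+1%:R * x = 2 * k.+1%:R * t by rewrite /t; ring.
have -> : (2 * k%:R + 1) * t = 2 * k.+1%:R * t - t by rewrite -natr1; ring.
have -> : (2 * k.+1%:R + 1) * t = 2 * k.+1%:R * t + t by ring.
rewrite !sinD cosN sinN; ring.
Qed.

Lemma fejerS k x : fejer k.+1 x = fejer k x + (1 + 2 * \sum_(1 <= j < k.+1) cs j%:Z x).
Proof.
rewrite (fejer_widen x (leqnSn k)) /fejer.
have -> : \sum_(1 <= j < k.+1) (k.+1 - j)%:R * cs j x =
    \sum_(1 <= j < k.+1) (k - j)%:R * cs j x + \sum_(1 <= j < k.+1) cs j x.
  rewrite -big_split/= !big_nat; apply: eq_bigr => j /andP[_ jk].
  by rewrite subSn// -natr1; ring.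
by rewrite -natr1; ring.
Qed.

Lemma fejerM k x : fejer k x * sin (pi * x) ^+ 2 = sin (k%:R * (pi * x)) ^+ 2.
Proof.
elim: k => [|k IH].
  by rewrite /fejer big_geq// mulr0 addr0 !mul0r sin0 expr0n.
rewrite fejerS mulrDl IH (expr2 (sin (pi * x))) [(1 + _) * (_ * _)]mulrA.
rewrite dirichletM; set t := pi * x.
have -> : (2 * k%:R + 1) * t = k%:R * t + (k%:R * t + t) by ring.
have -> : k.+1%:R * t = k%:R * t + t by rewrite -natr1; ring.
rewrite !sinD !cosD; set u := k%:R * t.
have hu := cos2Dsin2 u; have ht := cos2Dsin2 t.
set a := cos u in hu *; set b := sin u in hu *.
set c := cos t in ht *; set d := sin t in ht *.
have ha : a ^+ 2 = 1 - b ^+ 2 by rewrite -hu; ring.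
have hc : c ^+ 2 = 1 - d ^+ 2 by rewrite -ht; ring.
have -> : b ^+ 2 + (b * (a * c - b * d) + a * (b * c + a * d)) * d =
   b ^+ 2 + 2 * a * b * c * d - b ^+ 2 * d ^+ 2 + a ^+ 2 * d ^+ 2 by ring.
have -> : (b * c + a * d) ^+ 2 =
   b ^+ 2 * c ^+ 2 + 2 * a * b * c * d + a ^+ 2 * d ^+ 2 by ring.
rewrite hc; ring.
Qed.

Lemma fejer_le k x : fejer k x <= k%:R ^+ 2.
Proof.
elim: k => [|k IH]; first by rewrite /fejer big_geq// mulr0 addr0 expr0n.
rewrite fejerS; have h : \sum_(1 <= j < k.+1) cs j%:Z x <= k%:R.
  apply: (@le_trans _ _ (\sum_(1 <= j < k.+1) 1)).
    by apply: ler_sum => j _; exact: cos_le1.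
  by rewrite sumr_const_nat subn1.
rewrite -natr1; nra.
Qed.

(** Quantifies how long the kernel stays near its peak [k^2]. For [j <= k] one has
    [cs j >= 1 - 2 k^2 sin^2], and the kernel is a sum of Dirichlet kernels. In the induction the
    order [m] varies while [k] in this bound stays fixed. *)
Lemma fejer_ge k x : k%:R ^+ 2 - 4 * k%:R ^+ 4 * sin (pi * x) ^+ 2 <= fejer k x.
Proof.
have cs_ge j : (j <= k)%N -> 1 - 2 * k%:R ^+ 2 * sin (pi * x) ^+ 2 <= cs j%:Z x.
  move=> jk; rewrite /cs /freq -pmulrn.
  have -> : 2 * pi * j%:R * x = (j%:R * (pi * x)) *+ 2 by rewrite -mulr_natl; ring.
  rewrite cos_mulr2n cos2sin2 -mulr_natl.
  have h := abs_sin_mul j (pi * x).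
  have h2 : j%:R * `|sin (pi * x)| <= k%:R * `|sin (pi * x)|.
    by rewrite ler_wpM2r// ler_nat.
  have h3 : `|sin (j%:R * (pi * x))| ^+ 2 <= (k%:R * `|sin (pi * x)|) ^+ 2.
    by rewrite lerXn2r ?nnegrE ?mulr_ge0// (le_trans h).
  rewrite exprMn !real_normK ?num_real// in h3; lra.
set M := k%:R ^+ 2 * sin (pi * x) ^+ 2.
have M0 : 0 <= M by rewrite mulr_ge0// ?sqr_ge0.
suff H m : (m <= k)%N -> m%:R ^+ 2 - 4 * M * m%:R ^+ 2 <= fejer m x.
  have := H k (leqnn k); rewrite /M; apply: le_trans.
  by rewrite le_eqVlt; apply/orP; left; apply/eqP; ring.
elim: m => [|m IH] mk.
  by rewrite /fejer big_geq// !mulr0 addr0 expr0n/= mulr0 subr0.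
rewrite fejerS; have h : m%:R * (1 - 2 * M) <= \sum_(1 <= j < m.+1) cs j%:Z x.
  apply: (@le_trans _ _ (\sum_(1 <= j < m.+1) (1 - 2 * M))).
    by rewrite sumr_const_nat subn1 mulr_natl.
  rewrite !big_nat; apply: ler_sum => j /andP[_ jm].
  by rewrite /M mulrA; apply: cs_ge; exact: ltnW (leq_trans jm mk).
have {}IH := IH (ltnW mk); rewrite -natr1.
have m0 : 0 <= m%:R :> R by [].
have mM : 0 <= m%:R * M by rewrite mulr_ge0.
nra.
Qed.

Lemma fejer_ge0 k x : 0 <= fejer k x.
Proof.
have [s0|s0] := eqVneq (sin (pi * x)) 0.
  by apply: le_trans (fejer_ge k x); rewrite s0 expr0n mulr0 subr0 sqr_ge0.
have s2 : 0 < sin (pi * x) ^+ 2 by rewrite exprn_even_gt0.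
by rewrite -(pmulr_lge0 _ s2) fejerM sqr_ge0.
Qed.

Variable N : nat.
Hypothesis N0 : (0 < N)%N.

(* [rho x] is comparable to [min (1 / |sin (pi x)|) N]. *)
Definition rho x : R := (Num.sqrt (sin (pi * x) ^+ 2 + N%:R ^- 2))^-1.

Let N0R : 0 < N%:R :> R. Proof. by rewrite ltr0n. Qed.

Let Z_gt0 x : 0 < sin (pi * x) ^+ 2 + N%:R ^- 2.
Proof. by rewrite ltr_wpDl ?sqr_ge0// invr_gt0 exprn_gt0. Qed.

Lemma rho_gt0 x : 0 < rho x.
Proof. by rewrite invr_gt0 sqrtr_gt0. Qed.

Lemma rho_sqr x : rho x ^- 2 = sin (pi * x) ^+ 2 + N%:R ^- 2.
Proof. by rewrite /rho exprVn invrK sqr_sqrtr// ltW. Qed.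


Lemma rho_sqrM x : rho x ^+ 2 * (sin (pi * x) ^+ 2 + N%:R ^- 2) = 1.
Proof. by rewrite -rho_sqr mulfV// expf_neq0// gt_eqF// rho_gt0. Qed.

Lemma rho_le x : rho x <= N%:R.
Proof.
have h := rho_sqrM x; have r0 := rho_gt0 x.
have : rho x ^+ 2 * N%:R ^- 2 <= 1.
  rewrite -[leRHS]h ler_wpM2l ?sqr_ge0// lerDr; exact: sqr_ge0.
rewrite ler_pdivrMr ?exprn_gt0// mul1r.
by rewrite ler_pXn2r ?nnegrE// ltW.
Qed.

Lemma rho_sin x : rho x * `|sin (pi * x)| <= 1.
Proof.
have h := rho_sqrM x; have r0 := rho_gt0 x.
have r0' := ltW r0.
rewrite -(@ler_pXn2r _ 2) ?nnegrE ?mulr_ge0// expr1n exprMn.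
rewrite real_normK ?num_real// -[leRHS]h ler_wpM2l ?sqr_ge0// lerDl.
by rewrite invr_ge0 exprn_ge0.
Qed.

Lemma rho_ge x : 2^-1 <= rho x.
Proof.
have h := rho_sqrM x; have r0 := rho_gt0 x.
rewrite leNgt; apply/negP => r2.
have s1 : sin (pi * x) ^+ 2 <= 1.
  by rewrite -[leRHS](cos2Dsin2 (pi * x)) lerDr sqr_ge0.
have n1 : N%:R ^- 2 <= 1 :> R.
  by rewrite invf_le1 ?exprn_gt0// exprn_ege1// ler1n.
have n0 : 0 <= N%:R ^- 2 :> R by rewrite invr_ge0 exprn_ge0.
have s0 : 0 <= sin (pi * x) ^+ 2 by rewrite sqr_ge0.
have : rho x ^+ 2 <= 4^-1 by nra.
nra.
Qed.

Lemma fejer_rho x : fejer N x <= 2 * rho x ^+ 2.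
Proof.
have -> : fejer N x = rho x ^+ 2 * (fejer N x * (sin (pi * x) ^+ 2 + N%:R ^- 2)).
  by rewrite mulrCA rho_sqrM mulr1.
rewrite [leRHS]mulrC ler_wpM2l ?sqr_ge0// mulrDr fejerM.
have h : fejer N x / N%:R ^+ 2 <= 1.
  by rewrite ler_pdivrMr ?exprn_gt0// mul1r fejer_le.
have : sin (N%:R * (pi * x)) ^+ 2 <= 1.
  by rewrite -[leRHS](cos2Dsin2 (N%:R * (pi * x))) lerDr sqr_ge0.
lra.
Qed.

Lemma truncnP (y : R) : 0 <= y -> (Num.truncn y)%:R <= y < (Num.truncn y).+1%:R.
Proof. by move=> y0; exact: Num.Theory.truncn_itv. Qed.

(** This is [W]. Kernels of order [k] up to about [rho] are of size [k^2], so the exponent [g - 2]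
    produces a sum of [k^g], of order [rho^(1+g)]. *)
Definition fejer_sum (g : R) x : R :=
  \sum_(0 <= k < N) k.+1%:R `^ (g - 2) * fejer k.+1 x.

Lemma fejer_sum_ge (g : R) x : 0 < g <= 1 ->
  256^-1 * rho x `^ (1 + g) <= fejer_sum g x.
Proof.
move=> /andP[g0 g1].
have term_ge0 k : 0 <= k.+1%:R `^ (g - 2) * fejer k.+1 x.
  by rewrite mulr_ge0 ?powR_ge0 ?fejer_ge0.
have sum_ge n : (n <= N)%N ->
    \sum_(0 <= k < n) k.+1%:R `^ (g - 2) * fejer k.+1 x <= fejer_sum g x.
  move=> nN; rewrite /fejer_sum (big_cat_nat (leq0n n) nN)/= lerDl.
  by apply: sumr_ge0 => k _; exact: term_ge0.
have r0 := rho_gt0 x.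
(* For bounded [rho] the kernel of order 1, identically 1, suffices. *)
have [r4|r4] := leP (rho x) 4.
  apply: le_trans (sum_ge 1%N N0); rewrite big_nat1 powR1 mul1r.
  rewrite /fejer big_geq// mulr0 addr0.
  apply: (@le_trans _ _ (256^-1 * 4 `^ 2)).
    rewrite ler_pM2l//; apply: (@le_trans _ _ (4 `^ (1 + g))).
      by apply: powR_le_gt0; [lra|exact: ltW|].
    by apply: ler_powR; lra.
  by rewrite -[X in _ `^ X]/(2%:R) powR_mulrn//; lra.
(* Orders up to [rho / 4] satisfy [k |sin| <= 1/4], so that [fejer_ge] loses at most half of the
   peak. *)
have r40 : 0 <= rho x / 4 by lra.
have /andP[n1 n2] := truncnP r40; set n := Num.truncn _ in n1 n2.
have n0 : (0 < n)%N.
  by rewrite -ltnS -(ltr_nat R); apply: le_lt_trans n2; lra.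
have n0R : 1 <= n%:R :> R by rewrite ler1n.
have nN : (n <= N)%N.
  by rewrite -(ler_nat R); have := rho_le x; lra.
apply: le_trans (sum_ge n nN).
(* Replacing [k^g] by [k n^(g-1)] reduces the sum of powers to the sum of the first [n] integers. *)
apply: (@le_trans _ _ (\sum_(0 <= k < n) 2^-1 * (k.+1%:R * n%:R `^ (g - 1)))); last first.
  rewrite !big_nat; apply: ler_sum => k /andP[_ kn].
  have k0R : 0 < k.+1%:R :> R by rewrite ltr0n.
  have knR : k.+1%:R <= n%:R :> R by rewrite ler_nat.
  have hs := rho_sin x; set s := `|_| in hs.
  have ks : k.+1%:R * s <= 4^-1.
    have s0 : 0 <= s by exact: normr_ge0.
    have : k.+1%:R * s <= rho x / 4 * s by rewrite ler_wpM2r// (le_trans knR).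
    by lra.
  have hf : 2^-1 * k.+1%:R ^+ 2 <= fejer k.+1 x.
    apply: le_trans (fejer_ge _ _).
    rewrite -[sin _ ^+ 2]real_normK ?num_real// -/s.
    have -> : 4 * k.+1%:R ^+ 4 * s ^+ 2 = k.+1%:R ^+ 2 * (4 * (k.+1%:R * s) ^+ 2) by ring.
    have ks2 : (k.+1%:R * s) ^+ 2 <= 4^-1 ^+ 2.
      by rewrite lerXn2r ?nnegrE ?mulr_ge0 ?invr_ge0// /s.
    have kk : 0 < k.+1%:R ^+ 2 :> R by rewrite exprn_gt0.
    have : k.+1%:R ^+ 2 * (4 * (k.+1%:R * s) ^+ 2) <= k.+1%:R ^+ 2 * 2^-1.
      by rewrite ler_pM2l//; lra.
    lra.
  apply: le_trans (ler_wpM2l (powR_ge0 _ _) hf).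
  have -> : k.+1%:R `^ (g - 2) * (2^-1 * k.+1%:R ^+ 2) =
      2^-1 * (k.+1%:R * k.+1%:R `^ (g - 1)) :> R.
    rewrite (_ : g - 2 = (g - 1) - 1); last by ring.
    rewrite powRD_gt0// powR_inv1 ?ltW//; field; exact: lt0r_neq0.
  rewrite ler_pM2l ?invr_gt0// ler_pM2l//.
  by apply: powR_le_lt0 => //; lra.
rewrite -big_distrr/= -big_distrl/=.
have -> : \sum_(0 <= k < n) k.+1%:R = n%:R * (n%:R + 1) / 2 :> R.
  elim: (n) => [|m IH]; first by rewrite big_geq// !mul0r.
  by rewrite big_nat_recr//= IH -natr1; field.
have n3 : n.+1%:R = n%:R + 1 :> R by rewrite natr1.
have nr : rho x / 8 <= n%:R by rewrite n3 in n2; lra.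
apply: (@le_trans _ _ (2^-1 * (n%:R * n%:R / 2 * n%:R `^ (g - 1)))); last first.
  rewrite ler_pM2l ?invr_gt0// ler_wpM2r ?powR_ge0//; nra.
have -> : 2^-1 * (n%:R * n%:R / 2 * n%:R `^ (g - 1)) = 4^-1 * n%:R `^ (1 + g) :> R.
  have n00 : 0 < n%:R :> R by lra.
  rewrite (_ : 1 + g = 1 + (1 + (g - 1))); last by ring.
  by rewrite !powRD_gt0// !powRr1; [field|lra].
have : (rho x / 8) `^ (1 + g) <= n%:R `^ (1 + g).
  by apply: powR_le_gt0 => //; lra.
rewrite powRM//; last by rewrite ltW.
have h8 : 64^-1 <= 8^-1 `^ (1 + g) :> R.
  have -> : 64^-1 = 8^-1 `^ 2 :> R by rewrite -[X in _ `^ X]/(2%:R) powR_mulrn//; field.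
  by apply: ger_powR; lra.
have := powR_ge0 (rho x) (1 + g); nra.
Qed.

End fejer_kernel.

(** * Summation by parts for sine sums *)

Section abel_summation.
Context {R : realType}.
Implicit Types (d : nat -> R) (m n : nat).

(** Summation by parts: [2 sin (pi x) sn j x] is the difference of the cosines of [(2 j - 1) pi x]
    and [(2 j + 1) pi x]. *)
Lemma abel_sin d m n x : (m <= n)%N ->
  2 * sin (pi * x) * \sum_(m <= j < n) d j * sn j%:Z x =
  d m * cos ((2 * m%:R - 1) * (pi * x)) - d n * cos ((2 * n%:R - 1) * (pi * x)) +
  \sum_(m <= j < n) (d j.+1 - d j) * cos ((2 * j.+1%:R - 1) * (pi * x)).
Proof.
elim: n => [|n IH]; first by case: m => // _; rewrite !big_geq// mulr0; ring.
rewrite leq_eqVlt => /orP[/eqP <-|]; first by rewrite !big_geq// mulr0; ring.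
rewrite ltnS => mn; rewrite !big_nat_recr//= mulrDr IH// {IH}.
rewrite /sn /freq -pmulrn; set t := pi * x.
have -> : 2 * pi * n%:R * x = 2 * n%:R * t by rewrite /t; ring.
have -> : (2 * n.+1%:R - 1) * t = 2 * n%:R * t + t by rewrite -natr1; ring.
have -> : (2 * n%:R - 1) * t = 2 * n%:R * t - t by ring.
rewrite !cosD cosN sinN; ring.
Qed.

(** The sum is split near frequency [2 rho]. Below, absolute values give order [rho^(1-g)]. Above,
    Abel summation gives [rho^(-g) / |sin|], and [|sin|] is at least of order [1 / rho]. The
    condition [d N = 0] removes the upper boundary term. *)
Lemma sin_sum_bound (C g : R) N d x : (0 < N)%N -> 0 < g -> g < 1 -> 0 <= C ->
  d N = 0 ->
  (forall j, (0 < j <= N)%N -> `|d j| <= C * j%:R `^ (- g)) ->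
  (forall j, (0 < j < N)%N -> `|d j.+1 - d j| <= C * j%:R `^ (- g - 1)) ->
  `|\sum_(1 <= j < N) d j * sn j%:Z x| <= C * (2 / (1 - g) + 2 + g^-1) * rho N x `^ (1 - g).
Proof.
move=> N0 g0 g1 C0 dN dj dd.
have r0 := rho_gt0 N0 x; have rN := rho_le N0 x; have rh := rho_ge N0 x.
have [r rE] : exists r, r = rho N x by exists (rho N x).
rewrite -rE in r0 rN rh *.
have /andP[n1 n2] := truncnP (ltW (mulr_gt0 (ltr0n R 2) r0)).
set n := Num.truncn _ in n1 n2.
have head k : (k <= n)%N -> (k <= N.-1)%N ->
    `|\sum_(1 <= j < k.+1) d j * sn j%:Z x| <= C * (2 / (1 - g)) * r `^ (1 - g).
  move=> kn kN; apply: (le_trans (ler_norm_sum _ _ _)).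
  apply: (@le_trans _ _ (C * \sum_(0 <= j < k) j.+1%:R `^ ((1 - g) - 1))).
    rewrite big_add1/= big_distrr/= !big_nat; apply: ler_sum => j /andP[_ jk].
    rewrite normrM (_ : 1 - g - 1 = - g); last by ring.
    apply: le_trans (dj j.+1 _); last first.
      by rewrite /= (leq_trans jk)// (leq_trans kN)// leq_pred.
    by rewrite ler_piMr//; exact: sn_le1.
  rewrite -!mulrA ler_wpM2l//.
  apply: (le_trans (sum_powR_concave k _)); first by lra.
  rewrite mulrC mulrCA ler_pM2l ?invr_gt0 ?subr_gt0//.
  apply: (@le_trans _ _ ((2 * r) `^ (1 - g))).
    apply: powR_le_gt0 => //; first by rewrite subr_ge0 ltW.
    by apply: le_trans n1; rewrite ler_nat.
  rewrite powRM//; last exact: ltW.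
  rewrite ler_wpM2r ?powR_ge0//.
  by rewrite -[leRHS]powRr1// ler_powR//; [rewrite ler1n|lra].
have tail_ge0 : 0 <= C * (2 + g^-1) * r `^ (1 - g).
  by rewrite !mulr_ge0 ?powR_ge0// addr_ge0// invr_ge0 ltW.
have -> : C * (2 / (1 - g) + 2 + g^-1) * r `^ (1 - g) =
  C * (2 / (1 - g)) * r `^ (1 - g) + C * (2 + g^-1) * r `^ (1 - g) by ring.
have [Nn|nN] := leqP N n.+1.
  have -> : N = N.-1.+1 by rewrite prednK.
  apply: (le_trans (head N.-1 _ (leqnn _))); last by rewrite lerDl.
  by rewrite -ltnS prednK.
rewrite (big_cat_nat (n := n.+1))//= ?(ltnW nN)//.
apply: (le_trans (ler_normD _ _)); apply: lerD.
  by apply: head => //; rewrite -ltnS prednK// ltnW.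
have nNR : n.+1%:R <= N%:R :> R by rewrite ler_nat ltnW.
have [s sE] : exists s, s = `|sin (pi * x)| by eexists.
have s0 : 0 <= s by rewrite sE.
(* When there is a tail, [2 r <= N], so [N^(-2)] accounts for at most a quarter of [r^(-2)], and
   [|sin|] itself is comparable to [1 / r]. *)
have rs : 1 <= 2 * r ^+ 2 * s ^+ 2.
  have := rho_sqrM N0 x; rewrite -rE -[sin _ ^+ 2]real_normK ?num_real// -sE mulrDr.
  have NR : 0 < N%:R :> R by rewrite ltr0n.
  have : r ^+ 2 / N%:R ^+ 2 <= 4^-1.
    rewrite ler_pdivrMr ?exprn_gt0//.
    have h : 2 * r <= N%:R by apply: le_trans nNR; exact: ltW.
    have : (2 * r) ^+ 2 <= N%:R ^+ 2 by rewrite lerXn2r// ?nnegrE ?mulr_ge0// ltW.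
    by rewrite exprMn; lra.
  lra.
have s_gt0 : 0 < s.
  rewrite lt_neqAle s0 andbT; apply/eqP => s00.
  by move: rs; rewrite -s00 expr0n mulr0; lra.
have s2r : 1 <= 2 * s * r.
  rewrite leNgt; apply/negP => h; have w0 : 0 <= s * r by rewrite mulr_ge0// ltW.
  have h1 : s * r * (s * r) <= s * r * 2^-1 by rewrite ler_wpM2l//; lra.
  have h2 : 2 * r ^+ 2 * s ^+ 2 = 2 * (s * r * (s * r)) by ring.
  lra.
have /(congr1 Num.norm) := abel_sin d x (ltnW nN).
rewrite dN mul0r subr0 normrM normrM -sE ger0_norm// => absE.
rewrite -(ler_pM2l (_ : 0 < 2 * s)) ?mulr_gt0// absE.
have n0R : 0 < n.+1%:R :> R by rewrite ltr0n.
apply: (@le_trans _ _ (C * (2 + g^-1) * n.+1%:R `^ (- g))).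
  apply: (le_trans (ler_normD _ _)).
  have -> : C * (2 + g^-1) * n.+1%:R `^ (- g) = C * n.+1%:R `^ (- g) +
     (C * n.+1%:R `^ (- g) + C * (n.+1%:R `^ (- g) / g)) by ring.
  apply: lerD.
    rewrite normrM; apply: le_trans (dj n.+1 _); last by rewrite /= ltnW.
    by rewrite ler_piMr// cos_max.
  (* The first increment is bounded on its own: [sum_powR_convex] started at [n.+1] controls powers
     of [n.+2] and beyond. *)
  apply: (le_trans (ler_norm_sum _ _ _)); rewrite big_ltn//.
  have step j : (0 < j < N)%N -> `|(d j.+1 - d j) * cos ((2 * j.+1%:R - 1) * (pi * x))| <=
      C * j%:R `^ (- g - 1).
    move=> jN; rewrite normrM; apply: le_trans (dd j jN).
    by rewrite ler_piMr// cos_max.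
  apply: lerD.
    apply: (le_trans (step n.+1 _)); first by rewrite /= nN.
    rewrite ler_wpM2l//; apply: ler_powR; first by rewrite ler1n.
    lra.
  apply: (@le_trans _ _ (\sum_(n.+1 <= j < N.-1) C * j.+1%:R `^ (- g - 1))).
    rewrite big_add1 !big_nat; apply: ler_sum => j /andP[nj jN]; apply: step.
    by rewrite /= -ltnS prednK// in jN *.
  by rewrite -big_distrr/= ler_wpM2l// sum_powR_convex.
rewrite mulrA (mulrC (2 * s)) -!mulrA ler_wpM2l//.
rewrite ler_wpM2l//; first by rewrite addr_ge0// invr_ge0 ltW.
apply: (@le_trans _ _ (r `^ (- g))).
  apply: powR_le_lt0; [lra|exact: r0|].
  by apply: ltW; apply: le_lt_trans n2; lra.
rewrite powRD_gt0// powRr1; last exact: ltW.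
rewrite -[leLHS]mul1r.
have -> : 2 * (s * (r * r `^ (- g))) = (2 * s * r) * r `^ (- g) by ring.
by rewrite ler_wpM2r ?powR_ge0.
Qed.

End abel_summation.

(** * Coefficients of the Fejer sum with compensated mean *)

Section weights.
Context {R : realType}.
Variables (g : R) (N : nat).
Hypothesis g01 : 0 < g < 1.
Hypothesis N0 : (0 < N)%N.

Let ck (k : nat) : R := k.+1%:R `^ (g - 2).

(* Half the cosine coefficients of a multiple of [fejer N] minus [fejer_sum] (see
   [weight_fejer]); the multiple is chosen to make the mean vanish, so that the
   difference is the derivative of a periodic function.  The subtraction in
   [(k.+1 - j)%:R] is truncated. *)
Definition weight_coef (j : nat) : R :=
  \sum_(0 <= k < N) ck k * (k.+1%:R - (k.+1 - j)%:R - k.+1%:R * j%:R / N%:R).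

Let NR : 0 < N%:R :> R. Proof. by rewrite ltr0n. Qed.
Let ck_ge0 k : 0 <= ck k. Proof. exact: powR_ge0. Qed.

Let ckM k : ck k * k.+1%:R = k.+1%:R `^ (g - 1).
Proof.
have k0 : 0 < k.+1%:R :> R by rewrite ltr0n.
rewrite /ck (_ : g - 2 = (g - 1) - 1); last by ring.
by rewrite powRD_gt0// powR_inv1 ?ltW// divfK// gt_eqF.
Qed.

Lemma weight_coefN : weight_coef N = 0.
Proof.
rewrite /weight_coef big_nat big1// => k /andP[_ kN].
have /eqP -> : (k.+1 - N == 0)%N by rewrite subn_eq0.
by rewrite mulfK ?gt_eqF// subr0 subrr mulr0.
Qed.

Lemma weight_coef_term_ge0 j k : (j <= N)%N -> (k < N)%N ->
  0 <= k.+1%:R - (k.+1 - j)%:R - k.+1%:R * j%:R / N%:R :> R.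
Proof.
move=> jN kN; have [kj|jk] := leqP k.+1 j.
  have /eqP -> : (k.+1 - j == 0)%N by rewrite subn_eq0.
  rewrite subr0 subr_ge0 ler_pdivrMr// ler_wpM2l//.
  by rewrite ler_nat.
rewrite natrB ?(ltnW jk)// opprB addrCA subrr addr0 subr_ge0 ler_pdivrMr// mulrC.
by rewrite ler_wpM2l// ler_nat.
Qed.

Lemma weight_coef_ge0 j : (j <= N)%N -> 0 <= weight_coef j.
Proof.
move=> jN; rewrite /weight_coef big_nat; apply: sumr_ge0 => k /andP[_ kN].
by rewrite mulr_ge0// weight_coef_term_ge0.
Qed.

(** All terms are nonnegative and the one with [k = 0] equals [1 - 1/N]. This keeps the first mode
    of the test function away from 0, so that sine data have a large pairing with it. *)
Lemma weight_coef1_ge : 1 - N%:R^-1 <= weight_coef 1.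
Proof.
rewrite /weight_coef big_ltn// /ck powR1 subnn subr0 !mul1r lerDl.
rewrite big_nat; apply: sumr_ge0 => k /andP[_ kN].
by rewrite mulr_ge0 ?powR_ge0// weight_coef_term_ge0.
Qed.

Definition weight_const : R := g^-1 + (1 - g)^-1.

Lemma weight_const_ge0 : 0 <= weight_const.
Proof.
have /andP[g0 g1] := g01.
by rewrite /weight_const addr_ge0// invr_ge0 ?subr_ge0 ltW.
Qed.

(** The bracket is at most the minimum of [k.+1] and [j]. Cutting at [k = j] leaves a sum of
    [k.+1^(g-1)] and [j] times a tail of [k.+1^(g-2)], both of order [j^g]. *)
Lemma weight_coef_le j : (0 < j <= N)%N -> weight_coef j <= weight_const * j%:R `^ g.
Proof.
have /andP[g0 g1] := g01.
move=> /andP[j0 jN]; have jR : 0 < j%:R :> R by rewrite ltr0n.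
have termN k : 0 <= k.+1%:R * j%:R / N%:R :> R by rewrite !mulr_ge0// invr_ge0 ltW.
apply: (@le_trans _ _ (\sum_(0 <= k < j) k.+1%:R `^ (g - 1) +
   \sum_(j <= k < N) j%:R * k.+1%:R `^ (- (1 - g) - 1))).
  rewrite /weight_coef (big_cat_nat (leq0n j) jN)/=; apply: lerD.
    apply: ler_sum => k _; rewrite -ckM ler_wpM2l//.
    by have := termN k; have := ler0n R (k.+1 - j); lra.
  rewrite !big_nat; apply: ler_sum => k /andP[jk _].
  rewrite mulrC (_ : - (1 - g) - 1 = g - 2); last by ring.
  rewrite ler_wpM2r// natrB ?(leqW jk)//; have := termN k; lra.
rewrite /weight_const mulrDl; apply: lerD.
  by apply: (le_trans (sum_powR_concave j _)); [lra|rewrite mulrC].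
rewrite -big_distrr/=; apply: (@le_trans _ _ (j%:R * (j%:R `^ (- (1 - g)) / (1 - g)))).
  by rewrite ler_wpM2l// sum_powR_convex// subr_gt0.
have -> : g = 1 + - (1 - g) by ring.
rewrite [in leRHS]powRD_gt0// powRr1; last exact: ltW.
have -> : 1 - (1 + - (1 - g)) = 1 - g by ring.
by rewrite le_eqVlt; apply/orP; left; apply/eqP; ring.
Qed.

(** From [j] to [j.+1] the bracket grows by the indicator of [j <= k] minus [k.+1 / N]. Summed
    against the weights, each part is nonnegative and of order at most [j^(g-1)]. *)
Lemma weight_coef_diff j : (0 < j < N)%N ->
  `|weight_coef j.+1 - weight_coef j| <= weight_const * j%:R `^ (g - 1).
Proof.
have /andP[g0 g1] := g01.
move=> /andP[j0 jN]; have jR : 0 < j%:R :> R by rewrite ltr0n.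
have -> : weight_coef j.+1 - weight_coef j =
   \sum_(j <= k < N) k.+1%:R `^ (- (1 - g) - 1) -
   N%:R^-1 * \sum_(0 <= k < N) k.+1%:R `^ (g - 1).
  rewrite /weight_coef -sumrB big_distrr/=.
  have -> : \sum_(j <= k < N) k.+1%:R `^ (- (1 - g) - 1) =
    \sum_(0 <= k < N) ck k * (j <= k)%N%:R.
    rewrite [RHS](big_cat_nat (leq0n j) (ltnW jN))/=.
    rewrite [X in _ = X + _]big_nat [X in _ = X + _]big1 ?add0r.
      rewrite !big_nat; apply: eq_bigr => k /andP[-> _]; rewrite mulr1 /ck.
      by congr (_ `^ _); ring.
    by move=> k /andP[_ kj]; rewrite leqNgt kj mulr0.
  rewrite -sumrB; apply: eq_bigr => k _; rewrite -ckM.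
  have -> : (k.+1 - j)%:R = (k.+1 - j.+1)%:R + (j <= k)%N%:R :> R.
    rewrite -natrD; congr (_%:R); case: leqP => h /=.
      by rewrite addn1 subSS subSn.
    by rewrite addn0; apply/eqP; rewrite subSS; apply/eqP; move: h; lia.
  by rewrite -(natr1 j); field; rewrite gt_eqF.
have s1 := sum_powR_convex N (_ : 0 < 1 - g) j0.
have s2 := sum_powR_concave N (_ : 0 < g <= 1).
have h1 : \sum_(j <= k < N) k.+1%:R `^ (- (1 - g) - 1) <= (1 - g)^-1 * j%:R `^ (g - 1).
  rewrite mulrC (_ : g - 1 = - (1 - g)); last by ring.
  by apply: s1; rewrite subr_gt0.
have h2 : N%:R^-1 * \sum_(0 <= k < N) k.+1%:R `^ (g - 1) <= g^-1 * j%:R `^ (g - 1).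
  apply: (@le_trans _ _ (N%:R^-1 * (N%:R `^ g / g))).
    by rewrite ler_wpM2l ?invr_ge0//; apply: s2; lra.
  rewrite mulrA mulrC ler_wpM2l//; first by rewrite invr_ge0 ltW.
  have -> : N%:R^-1 * N%:R `^ g = N%:R `^ (g - 1) :> R.
    by rewrite powRD_gt0// powR_inv1 ?ltW// mulrC.
  apply: powR_le_lt0 => //; [lra|by rewrite ler_nat ltnW].
have h3 : 0 <= \sum_(j <= k < N) k.+1%:R `^ (- (1 - g) - 1) :> R.
  by apply: sumr_ge0 => k _; exact: powR_ge0.
have h4 : 0 <= N%:R^-1 * \sum_(0 <= k < N) k.+1%:R `^ (g - 1) :> R.
  by rewrite mulr_ge0 ?invr_ge0//; apply: sumr_ge0 => k _; exact: powR_ge0.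
have k1 : 0 <= (1 - g)^-1 * j%:R `^ (g - 1) by rewrite mulr_ge0 ?powR_ge0// invr_ge0 subr_ge0 ltW.
have k2 : 0 <= g^-1 * j%:R `^ (g - 1) by rewrite mulr_ge0 ?powR_ge0// invr_ge0 ltW.
rewrite /weight_const mulrDl ler_norml; apply/andP; split; lra.
Qed.

Lemma weight_fejer x :
  - (2 * \sum_(1 <= j < N) weight_coef j * cs j%:Z x) =
  fejer_sum N g x - N%:R^-1 * (\sum_(0 <= k < N) k.+1%:R `^ (g - 1)) * fejer N x.
Proof.
pose L k := 2 * \sum_(1 <= j < N) (k.+1 - j)%:R * cs j%:Z x.
pose M := 2 * \sum_(1 <= j < N) (N - j)%:R * cs j%:Z x.
pose D := 2 * \sum_(1 <= j < N) cs j%:Z x.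
pose E := 2 * \sum_(1 <= j < N) j%:R * cs j%:Z x.
have ME : M = N%:R * D - E.
  rewrite /M /D /E mulrCA -mulrBr; congr (_ * _).
  rewrite big_distrr/= -sumrB !big_nat; apply: eq_bigr => j /andP[_ jN].
  by rewrite natrB ?(ltnW jN)//; ring.
transitivity (\sum_(0 <= k < N) ck k * (- (k.+1%:R * D - L k - k.+1%:R / N%:R * E))).
  rewrite -mulrN -sumrN.
  transitivity (2 * \sum_(1 <= j < N) \sum_(0 <= k < N) - (ck k *
     (k.+1%:R - (k.+1 - j)%:R - k.+1%:R * j%:R / N%:R) * cs j%:Z x)).
    congr (_ * _); apply: eq_bigr => j _.
    by rewrite /weight_coef sumrN big_distrl.
  rewrite exchange_big/= big_distrr/=; apply: eq_bigr => k _.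
  rewrite /D /L /E !big_distrr/= -!sumrB -sumrN big_distrr/=.
  by apply: eq_bigr => j _; field; rewrite gt_eqF.
rewrite /fejer_sum big_distrr/= big_distrl/= -sumrB !big_nat.
apply: eq_bigr => k /andP[_ kN].
rewrite -/(ck k) (fejer_widen x kN) -/(L k) /fejer -/M ME -ckM; field.
by rewrite gt_eqF.
Qed.

(* Coefficients of the test function and of its fractional Laplacian, up to
   constants, for [p = 1] and [p = 2 g]. *)
Lemma weight_series_bound (p : R) x : 2 * g <= p -> p <= 1 ->
  `|\sum_(1 <= j < N) weight_coef j * j%:R `^ (- p) * sn j%:Z x| <=
  weight_const * 2 * (2 / (1 - g) + 2 + g^-1) * rho N x `^ (1 - g).
Proof.
have /andP[g0 g1] := g01; move=> gp p1.
have wc := weight_const_ge0.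
(* The coefficients have order [j^(g-p)], hence at most [j^(-g)] exactly because [2 g <= p]. *)
apply: (sin_sum_bound (d := fun j => weight_coef j * j%:R `^ (- p))) => //.
- by rewrite mulr_ge0.
- by rewrite weight_coefN mul0r.
- move=> j /[dup] jN /andP[j0 jN']; have jR : 0 < j%:R :> R by rewrite ltr0n.
  rewrite ger0_norm; last by rewrite mulr_ge0 ?powR_ge0// weight_coef_ge0.
  apply: (@le_trans _ _ (weight_const * j%:R `^ g * j%:R `^ (- p))).
    by rewrite ler_wpM2r ?powR_ge0// weight_coef_le.
  rewrite -mulrA -powRD_gt0// -mulrA ler_wpM2l//.
  apply: (@le_trans _ _ (j%:R `^ (- g))).
    by apply: ler_powR; [rewrite ler1n|lra].
  by rewrite ler_peMl ?powR_ge0// ler1n.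
- move=> j /[dup] jN /andP[j0 jN']; have jR : 0 < j%:R :> R by rewrite ltr0n.
  have jR1 : 0 < j.+1%:R :> R by rewrite ltr0n.
  (* Discrete product rule; its two terms account for the factor 2 in the constant. *)
  have -> : weight_coef j.+1 * j.+1%:R `^ (- p) - weight_coef j * j%:R `^ (- p) =
    (weight_coef j.+1 - weight_coef j) * j.+1%:R `^ (- p) -
    weight_coef j * (j%:R `^ (- p) - j.+1%:R `^ (- p)) by ring.
  have exp_le (a b : R) : a + b <= - g - 1 -> j%:R `^ a * j%:R `^ b <= j%:R `^ (- g - 1).
    by move=> ab; rewrite -powRD_gt0//; apply: ler_powR => //; rewrite ler1n.
  apply: (le_trans (ler_normB _ _)); rewrite !normrM.
  have -> : weight_const * 2 * j%:R `^ (- g - 1) =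
    weight_const * j%:R `^ (- g - 1) + weight_const * j%:R `^ (- g - 1) by ring.
  apply: lerD.
    rewrite (ger0_norm (powR_ge0 _ _)).
    apply: (@le_trans _ _ (weight_const * j%:R `^ (g - 1) * j%:R `^ (- p))).
      apply: ler_pM; rewrite ?powR_ge0//; first exact: weight_coef_diff.
      by apply: powR_le_lt0 => //; [lra|rewrite ler_nat].
    rewrite -mulrA ler_wpM2l//; apply: exp_le; lra.
  rewrite (ger0_norm (weight_coef_ge0 (ltnW jN'))).
  apply: (@le_trans _ _ (weight_const * j%:R `^ g * (p * j%:R `^ (- p - 1)))).
    apply: ler_pM => //; first by rewrite weight_coef_ge0// ltnW.
    - by rewrite weight_coef_le// j0 ltnW.
    - by apply: powR_step_diff => //; lra.
  rewrite -mulrA ler_wpM2l// mulrCA.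
  apply: (@le_trans _ _ (1 * (j%:R `^ g * j%:R `^ (- p - 1)))).
    by rewrite ler_wpM2r// mulr_ge0 ?powR_ge0.
  rewrite mul1r; apply: exp_le; lra.
Qed.

End weights.

(** * Test functions and the quadratic lower bound *)

Section rho_integral.
Context {R : realType}.
Variable N : nat.
Hypothesis N0 : (0 < N)%N.

Lemma is_derive_pi_shift (x y : R) : is_derive x 1 (fun x => pi * (x - y)) pi.
Proof.
have h := is_deriveMl pi (is_derive_add (is_derive_id x 1) (is_derive_cst (- y) x 1)).
by apply: (is_derive_congr h); rewrite addr0 mulr1.
Qed.

Lemma rho_powR (q x : R) :
  rho N x `^ q = (sin (pi * x) ^+ 2 + N%:R ^- 2) `^ (- (q / 2)).
Proof.
have Z0 : 0 < sin (pi * x) ^+ 2 + N%:R ^- 2 :> R.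
  by rewrite ltr_wpDl ?sqr_ge0// invr_gt0 exprn_gt0// ltr0n.
rewrite /rho -powR12_sqrt ?(ltW Z0)// -powRN -powRrM; congr (_ `^ _); by field.
Qed.

(** With [s = sin^2] and [Z = s + N^(-2)], the function [sin cos Z^(-q/2)] is periodic, so its
    derivative has integral 0. That derivative is at least [pi ((1 - q) rho^q - 2)], since
    [s / Z <= 1] and [s Z^(-q/2) <= 1]. The bound is thus uniform in [N] without any splitting near
    the singularity. *)
Lemma I01_rho_le (q y : R) : 0 <= q -> q < 1 ->
  I01 (fun x => rho N (x - y) `^ q) <= 2 / (1 - q).
Proof.
move=> q0 q1.
pose S (x : R) := sin (pi * (x - y)); pose C (x : R) := cos (pi * (x - y)).
pose Z (x : R) := S x * S x + N%:R ^- 2.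
have Z0 x : 0 < Z x.
  by rewrite /Z -expr2 ltr_wpDl ?sqr_ge0// invr_gt0 exprn_gt0// ltr0n.
have dL (x : R) := is_derive_pi_shift x y.
have dS (x : R) : is_derive x 1 S (pi * C x).
  by apply: (is_derive_congr (is_derive1_comp (is_derive_sin _) (dL x))); rewrite mulrC.
have dC (x : R) : is_derive x 1 C (- pi * S x).
  by apply: (is_derive_congr (is_derive1_comp (is_derive_cos _) (dL x))); rewrite mulNr mulNr mulrC.
have dZ (x : R) : is_derive x 1 Z (2 * pi * S x * C x).
  apply: (is_derive_congr (is_derive_add (is_derive_mul (dS x) (dS x)) (is_derive_cst _ _ _))).
  ring.
have dP (x : R) : is_derive x 1 (fun x => Z x `^ (- (q / 2)))
   (- (q / 2) * Z x `^ (- (q / 2) - 1) * (2 * pi * S x * C x)).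
  exact: (is_derive1_comp (is_derive1_powR _ (Z0 x)) (dZ x)).
pose G (x : R) := S x * C x * Z x `^ (- (q / 2)).
pose dG (x : R) := (pi * C x * C x + S x * (- pi * S x)) * Z x `^ (- (q / 2)) +
  S x * C x * (- (q / 2) * Z x `^ (- (q / 2) - 1) * (2 * pi * S x * C x)).
have dGP (x : R) : is_derive x 1 G (dG x).
  exact: (is_derive_mul (is_derive_mul (dS x) (dC x)) (dP x)).
have cS := derive_continuous dS; have cC := derive_continuous dC.
have cZ := derive_continuous dZ.
have cP p : continuous (fun x => Z x `^ p).
  apply: (@derive_continuous _ _ (fun x => p * Z x `^ (p - 1) * (2 * pi * S x * C x))) => x.
  exact: (is_derive1_comp (is_derive1_powR _ (Z0 x)) (dZ x)).
have cdG : continuous dG.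
  move=> x; apply: cvgD; last first.
    apply: cvgM; first by apply: cvgM; [exact: cS|exact: cC].
    apply: cvgM; first by apply: cvgM; [exact: cvg_cst|exact: cP].
    by apply: cvgM; [apply: cvgM; [exact: cvg_cst|exact: cS]|exact: cC].
  apply: cvgM; last exact: cP.
  apply: cvgD; apply: cvgM; try exact: cS; try exact: cC.
    by apply: cvgM; [exact: cvg_cst|exact: cC].
  by apply: cvgM; [exact: cvg_cst|exact: cS].
have GP : G 1 = G 0.
  rewrite /G /Z /S /C (_ : pi * (1 - y) = pi * (0 - y) + pi); last by ring.
  by rewrite sinDpi cosDpi !mulrNN.
have I0 : I01 dG = 0 by rewrite (I01_derive cdG dGP) GP subrr.
have icst : intg (fun=> 2 : R) by exact: intg_cst.
have irho : intg (fun x => rho N (x - y) `^ q).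
  apply: (eq_intg (f := fun x => Z x `^ (- (q / 2)))); last exact: intg_continuous.
  by move=> x _; rewrite rho_powR /Z /S expr2.
have : I01 (fun x => pi * ((1 - q) * rho N (x - y) `^ q - 2)) <= 0.
  rewrite -I0; apply: le_I01; [|exact: intg_continuous|].
    by apply: intgZ; apply: intgB => //; apply: intgZ.
  move=> x _; rewrite rho_powR -/(S x) expr2 -/(Z x) /dG.
  set p := - (q / 2).
  have Zp : 0 <= Z x `^ p by exact: powR_ge0.
  have -> : Z x `^ (p - 1) = Z x `^ p / Z x.
    by rewrite powRD_gt0// powR_inv1// ltW.
  have hSC : C x * C x = 1 - S x * S x.
    by rewrite -[1](cos2Dsin2 (pi * (x - y))) -/(S x) -/(C x); ring.
  have -> : (pi * C x * C x + S x * (- pi * S x)) * Z x `^ p +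
     S x * C x * (- (q / 2) * (Z x `^ p / Z x) * (2 * pi * S x * C x)) =
     pi * (((1 - S x * S x) - S x * S x) * Z x `^ p
       - q * (S x * S x / Z x) * (1 - S x * S x) * Z x `^ p).
    by rewrite -hSC; field; rewrite gt_eqF.
  rewrite ler_pM2l ?pi_gt0//.
  set s := S x * S x; have s0 : 0 <= s by rewrite /s -expr2 sqr_ge0.
  have s1 : s <= 1.
    rewrite /s -[leRHS](cos2Dsin2 (pi * (x - y))) -expr2 -/(S x) lerDr; exact: sqr_ge0.
  have sZ : s / Z x <= 1.
    by rewrite ler_pdivrMr// mul1r /Z -/s lerDl invr_ge0 exprn_ge0.
  have sZ0 : 0 <= s / Z x by rewrite divr_ge0// ltW.
  have h1 : q * (s / Z x) * (1 - s) * Z x `^ p <= q * Z x `^ p.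
    have hh : (s / Z x) * (1 - s) <= 1.
      by rewrite -[leRHS]mulr1; apply: ler_pM => //; lra.
    by rewrite -(mulrA q) ler_wpM2r// ler_piMr.
  have h2 : s * Z x `^ p <= 1.
    have sleZ : s <= Z x by rewrite /Z -/s lerDl invr_ge0 exprn_ge0.
    have [Z1|Z1] := leP (Z x) 1.
      apply: (@le_trans _ _ (Z x `^ 1 * Z x `^ p)).
        by rewrite powRr1 ?ler_wpM2r// ltW.
      rewrite -powRD_gt0// -[leRHS](powRr0 (Z x)); apply: ger_powR; first by rewrite Z0.
      rewrite /p; lra.
    apply: (@le_trans _ _ (1 * 1)); last by rewrite mulr1.
    apply: ler_pM => //; rewrite -[leRHS](powRr0 (Z x)); apply: ler_powR; first exact: ltW.
    rewrite /p; lra.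
  lra.
rewrite I01Z; last by apply: intgB => //; apply: intgZ.
rewrite I01B//; last exact: intgZ.
rewrite I01Z// I01_cst pmulr_rle0 ?pi_gt0// subr_le0 => h.
by rewrite ler_pdivlMr ?subr_gt0// mulrC.
Qed.

Lemma continuous_rho_powR (q y : R) : continuous (fun x => rho N (x - y) `^ q).
Proof.
have dL (x : R) := is_derive_pi_shift x y.
pose S (x : R) := sin (pi * (x - y)); pose C (x : R) := cos (pi * (x - y)).
have dS (x : R) : is_derive x 1 S (pi * C x).
  by apply: (is_derive_congr (is_derive1_comp (is_derive_sin _) (dL x))); rewrite mulrC.
pose Z (x : R) := S x * S x + N%:R ^- 2.
have Z0 x : 0 < Z x.
  by rewrite /Z -expr2 ltr_wpDl ?sqr_ge0// invr_gt0 exprn_gt0// ltr0n.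
have dZ (x : R) : is_derive x 1 Z (pi * C x * S x + S x * (pi * C x) + 0).
  exact: (is_derive_add (is_derive_mul (dS x) (dS x)) (is_derive_cst _ _ _)).
rewrite (_ : (fun x => _) = (fun x => Z x `^ (- (q / 2)))).
  apply: (@derive_continuous _ _ (fun x => - (q / 2) * Z x `^ (- (q / 2) - 1) *
     (pi * C x * S x + S x * (pi * C x) + 0))) => x.
  exact: (is_derive1_comp (is_derive1_powR _ (Z0 x)) (dZ x)).
by apply/funext => x; rewrite rho_powR /Z /S expr2.
Qed.

End rho_integral.

(** * Pointwise inequalities behind the absorption *)

Section absorption.
Context {R : realType}.
Implicit Types (g r s n v w p q l T X Y W E K : R).

(** Here [v] stands for [u - u(y)], [p] and [q] for the test function and its fractional Laplacian,
    [X] for the lower bound of [W]. Each of the two Young inequalities spends [v^2 X / 4], together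
    the whole of [v^2 X / 2]. The parameter [l] stays free and is optimized after integration. *)
Lemma young_pointwise v p q l T X Y W E : 0 <= l -> 0 < X -> 0 <= T -> 0 <= Y -> X <= W ->
  p ^+ 2 <= T * Y * X -> q ^+ 2 <= T * Y * X -> v ^+ 2 * E <= Y ->
  2^-1 * l * (v * p) - (T * (1 + l ^+ 2) + 1) * Y <=
  - (1 / 2) * (v ^+ 2 * - (W - E)) - v * q.
Proof.
move=> l0 X0 T0 Y0 XW hp hq hE.
have y1 : v * q <= v ^+ 2 * X / 4 + T * Y.
  rewrite -(ler_pM2r X0); have := sqr_ge0 (v * X / 2 - q).
  have -> : (v * X / 2 - q) ^+ 2 = v ^+ 2 * X / 4 * X - v * q * X + q ^+ 2 by field.
  rewrite mulrDl; lra.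
have y2 : 2^-1 * l * (v * p) <= v ^+ 2 * X / 4 + l ^+ 2 * (T * Y).
  have lp : l ^+ 2 * p ^+ 2 <= l ^+ 2 * (T * Y * X) by rewrite ler_wpM2l ?sqr_ge0.
  rewrite -(ler_pM2r X0); have := sqr_ge0 (v * X / 2 - l * p / 2).
  have -> : (v * X / 2 - l * p / 2) ^+ 2 =
    v ^+ 2 * X / 4 * X - 2^-1 * l * (v * p) * X + l ^+ 2 * p ^+ 2 / 4 by field.
  have lp0 : 0 <= l ^+ 2 * p ^+ 2 by rewrite -exprMn sqr_ge0.
  rewrite mulrDl -(mulrA (l ^+ 2)); lra.
have y3 : v ^+ 2 * X <= v ^+ 2 * W by rewrite ler_wpM2l ?sqr_ge0.
have -> : (T * (1 + l ^+ 2) + 1) * Y = T * Y + l ^+ 2 * (T * Y) + Y by ring.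
have -> : - (1 / 2) * (v ^+ 2 * - (W - E)) = 2^-1 * (v ^+ 2 * W) - 2^-1 * (v ^+ 2 * E).
  by field.
lra.
Qed.

(** The exponents satisfy [2 (1 - g) = - g + (1 - 2 g) + (1 + g)], and the surplus factor [r^(-g)]
    is at most 2 because [r >= 1/2]; 512 is twice 256. *)
Lemma weighted_sqr_le g r C w : 0 < g -> g < 1 -> 2^-1 <= r ->
  `|w| <= C * r `^ (1 - g) ->
  w ^+ 2 <= 512 * C ^+ 2 * r `^ (1 - 2 * g) * (256^-1 * r `^ (1 + g)).
Proof.
move=> g0 g1 rh hw; have r0 : 0 < r by lra.
rewrite -[w ^+ 2]real_normK ?num_real//.
apply: (@le_trans _ _ ((C * r `^ (1 - g)) ^+ 2)).
  by rewrite lerXn2r// nnegrE (le_trans _ hw).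
rewrite exprMn (_ : 512 * _ * _ * _ =
  C ^+ 2 * (2 * (r `^ (1 - 2 * g) * r `^ (1 + g)))); last by field.
rewrite ler_wpM2l ?sqr_ge0//.
rewrite -[leLHS]powR_mulrn ?powR_ge0// -powRrM -powRD_gt0//.
have -> : (1 - g) * 2%:R = - g + (1 - 2 * g + (1 + g)) by ring.
rewrite (powRD_gt0 (- g) _ r0) ler_wpM2r ?powR_ge0//.
apply: (@le_trans _ _ (2^-1 `^ (- g))); first by apply: powR_le_lt0 => //; lra.
have -> : 2^-1 `^ (- g) = 2 `^ g :> R.
  by rewrite -powR_inv1// -powRrM; congr (_ `^ _); ring.
by rewrite -[leRHS]powRr1//; apply: ler_powR; [rewrite ler1n|exact: ltW].
Qed.

(** With [Y = r^(1 - 2 g)], the Hoelder bound gives [v^2 r^2 <= K^2 Y^2]. One factor [Y] is at most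
    [n^(1 - 2 g)], which the weight [n^(g-1)] outweighs by [n^(-g)]; the smallness assumption on [n]
    then beats [K^2]. *)
Lemma concentration_error_le g n r s K v F m : 0 < g -> g < 1 / 2 -> 0 < n ->
  0 < r -> r <= n -> 0 <= s -> r * s <= 1 -> `|v| <= K * s `^ (2 * g) ->
  K ^+ 2 * n `^ (- g) <= g / 2 -> 0 <= F -> F <= 2 * r ^+ 2 ->
  0 <= m -> m <= n `^ (g - 1) / g ->
  v ^+ 2 * (m * F) <= r `^ (1 - 2 * g).
Proof.
move=> g0 g1 n0 r0 rn s0 hs vK KN F0 hF m0 hm.
set Y := r `^ (1 - 2 * g).
have Y0 : 0 <= Y by exact: powR_ge0.
have v2 : v ^+ 2 <= K ^+ 2 * r `^ (- (4 * g)).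
  rewrite -[v ^+ 2]real_normK ?num_real//.
  apply: (@le_trans _ _ ((K * r `^ (- (2 * g))) ^+ 2)).
    have hsr : s `^ (2 * g) <= r `^ (- (2 * g)).
      rewrite (_ : - (2 * g) = -1 * (2 * g)); last by ring.
      rewrite (powRrM r (-1)) powR_inv1; last exact: ltW.
      apply: powR_le_gt0 => //; first by lra.
      by rewrite -[leRHS]mul1r ler_pdivlMr// mulrC.
    have [K00|K00] := leP 0 K.
      rewrite lerXn2r ?nnegrE ?mulr_ge0 ?powR_ge0//.
      by apply: (le_trans vK); rewrite ler_wpM2l.
    have v0 : `|v| = 0.
      apply/eqP; rewrite eq_le normr_ge0 andbT; apply: (le_trans vK).
      by rewrite nmulr_rle0// powR_ge0.
    by rewrite v0 expr0n sqr_ge0.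
  rewrite exprMn -[X in _ * X <= _]powR_mulrn ?powR_ge0// -powRrM.
  by rewrite (_ : - (2 * g) * 2%:R = - (4 * g))//; ring.
apply: (@le_trans _ _ (K ^+ 2 * r `^ (- (4 * g)) * (n `^ (g - 1) / g * (2 * r ^+ 2)))).
  by apply: ler_pM; [exact: sqr_ge0|exact: mulr_ge0|exact: v2|exact: ler_pM].
have -> : K ^+ 2 * r `^ (- (4 * g)) * (n `^ (g - 1) / g * (2 * r ^+ 2)) =
   (K ^+ 2 * 2 / g) * (n `^ (g - 1) * (r `^ (- (4 * g)) * r ^+ 2)) by ring.
have -> : r `^ (- (4 * g)) * r ^+ 2 = Y * Y.
  rewrite -powR_mulrn ?(ltW r0)// /Y -!powRD_gt0//; congr (_ `^ _).
  by rewrite -[2%:R]/(2 : R); ring.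
have hY : Y <= n `^ (1 - 2 * g) by apply: powR_le_gt0 => //; [lra|exact: ltW].
have KK : 0 <= K ^+ 2 * 2 / g.
  by apply: divr_ge0; [apply: mulr_ge0 => //; exact: sqr_ge0|exact: ltW].
apply: (@le_trans _ _ ((K ^+ 2 * 2 / g) * (n `^ (g - 1) * (Y * n `^ (1 - 2 * g))))).
  by rewrite ler_wpM2l// ler_wpM2l ?powR_ge0// ler_wpM2l.
have -> : (K ^+ 2 * 2 / g) * (n `^ (g - 1) * (Y * n `^ (1 - 2 * g))) =
   (K ^+ 2 * n `^ (- g)) * (2 / g) * Y.
  have -> : - g = (g - 1) + (1 - 2 * g) by ring.
  by rewrite (powRD_gt0 (g - 1) (1 - 2 * g) n0); ring.
rewrite ler_piMl//; apply: (@le_trans _ _ (g / 2 * (2 / g))).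
  by rewrite ler_wpM2r// divr_ge0// ltW.
by rewrite le_eqVlt; apply/orP; left; apply/eqP; field; rewrite gt_eqF.
Qed.

(* The choice [l = g J / (4 (T + 1))] optimizes the bound up to constants. *)
Lemma young_choice g T (J I : R) : 0 < g -> 0 <= T -> 0 <= I -> I <= g^-1 ->
  g / (16 * (T + 1)) * J ^+ 2 - (T + 1) / g <=
  2^-1 * (g * J / (4 * (T + 1))) * J -
    (T * (1 + (g * J / (4 * (T + 1))) ^+ 2) + 1) * I.
Proof.
move=> g0 T0 I0 hI; set l := g * J / (4 * (T + 1)); have T1 : 0 < T + 1 by lra.
have hT : T * (1 + l ^+ 2) + 1 <= (T + 1) * (1 + l ^+ 2).
  by rewrite [leRHS]mulrDl mul1r lerD2l lerDl sqr_ge0.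
have h : (T * (1 + l ^+ 2) + 1) * I <= (T + 1) * (1 + l ^+ 2) / g.
  by apply: ler_pM => //; rewrite addr_ge0// mulr_ge0// addr_ge0// sqr_ge0.
have -> : g / (16 * (T + 1)) * J ^+ 2 - (T + 1) / g =
  2^-1 * l * J - (T + 1) * (1 + l ^+ 2) / g.
  by rewrite /l; field; rewrite !gt_eqF.
by rewrite lerD2l lerN2.
Qed.

End absorption.

(** * The test functions and their pointwise bounds *)

Section test_functions.
Context {R : realType}.
Variables (alpha : R) (N : nat).
Hypothesis alpha0 : 0 < alpha.
Hypothesis alpha1 : alpha < 1 / 2.
Hypothesis N0 : (0 < N)%N.

Let g : R := 1 / 2 - alpha.
Let A (j : nat) : R := weight_coef g N j.
Let B (j : nat) : R := A j * j%:R `^ (- 1) / pi.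

Let g01 : 0 < g < 1.
Proof. by have := alpha0; have := alpha1; rewrite /g => *; apply/andP; split; lra. Qed.

(** The translation by [y] is expanded into the coefficients (see [test_funE]), so that every
    translate is literally a [trig] polynomial, with known derivative and fractional Laplacian. *)
Definition test_fun (y : R) : R -> R :=
  trig N (fun j => - (B j * sn j%:Z y)) (fun j => B j * cs j%:Z y).

Definition test_lap (y : R) : R -> R :=
  trig N (fun j => `|freq j%:Z| `^ (2 * alpha) * - (B j * sn j%:Z y))
         (fun j => `|freq j%:Z| `^ (2 * alpha) * (B j * cs j%:Z y)).

Lemma test_lapP y : is_fraclap alpha (test_fun y) (test_lap y).
Proof. exact: is_fraclap_trig. Qed.

Lemma sn_sub (j : int) (x y : R) :
  sn j (x - y) = sn j x * cs j y - cs j x * sn j y.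
Proof. by rewrite /sn /cs mulrBr sinB. Qed.

Lemma cs_sub (j : int) (x y : R) :
  cs j (x - y) = cs j x * cs j y + sn j x * sn j y.
Proof. by rewrite /sn /cs mulrBr cosB. Qed.

Let sum_pos (F : nat -> R) : F 0%N = 0 ->
  \sum_(0 <= j < N) F j = \sum_(1 <= j < N) F j.
Proof. by move=> F0; rewrite big_ltn// F0 add0r. Qed.

Lemma test_funE y x : test_fun y x =
  pi^-1 * \sum_(1 <= j < N) A j * j%:R `^ (- 1) * sn j%:Z (x - y).
Proof.
rewrite /test_fun /trig sum_pos; last by rewrite !sn0; ring.
rewrite big_distrr/=; apply: eq_bigr => j _; rewrite sn_sub /B; ring.
Qed.

Lemma test_lapE y x : test_lap y x = (2 * pi) `^ (1 - 2 * g) / pi *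
  \sum_(1 <= j < N) A j * j%:R `^ (- (2 * g)) * sn j%:Z (x - y).
Proof.
rewrite /test_lap /trig sum_pos; last by rewrite !sn0; ring.
rewrite big_distrr/= !big_nat; apply: eq_bigr => j /andP[j0 _].
have jR : 0 < j%:R :> R by rewrite ltr0n.
have -> : `|freq j%:Z| `^ (2 * alpha) = (2 * pi) `^ (1 - 2 * g) * j%:R `^ (1 - 2 * g) :> R.
  rewrite ger0_norm; last by rewrite /freq -pmulrn !mulr_ge0// pi_ge0.
  rewrite /freq -pmulrn powRM ?mulr_ge0 ?pi_ge0//.
  by have -> : 2 * alpha = 1 - 2 * g by rewrite /g; field.
rewrite sn_sub /B.
have -> : j%:R `^ (- (2 * g)) = j%:R `^ (1 - 2 * g) * j%:R `^ (- 1) :> R.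
  by rewrite -powRD_gt0//; congr (_ `^ _); ring.
ring.
Qed.

Lemma derive1_test_funE y x : derive1 (test_fun y) x =
  - (fejer_sum N g (x - y) -
     N%:R^-1 * (\sum_(0 <= k < N) k.+1%:R `^ (g - 1)) * fejer N (x - y)).
Proof.
rewrite -(weight_fejer g N0) opprK derive1_trig /trig sum_pos; last first.
  by rewrite (_ : freq 0 = 0) ?oppr0 ?mul0r ?addr0// /freq mulr0.
rewrite big_distrr/= !big_nat; apply: eq_bigr => j /andP[j0 _].
have jR : 0 < j%:R :> R by rewrite ltr0n.
rewrite cs_sub /B /freq -pmulrn powR_inv1; last exact: ltW.
have p0 := @pi_gt0 R.
rewrite -/(A j); move: (pi) p0 => P p0; field.
by apply/andP; split; exact: lt0r_neq0.
Qed.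

Definition test_const : R := weight_const g * 2 * (2 / (1 - g) + 2 + g^-1) *
  (1 + (2 * pi) `^ (1 - 2 * g)).

Lemma test_const_ge0 : 0 <= test_const.
Proof.
have /andP[g0 g1] := g01.
rewrite /test_const !mulr_ge0// ?weight_const_ge0// ?addr_ge0 ?powR_ge0//.
  by rewrite mulr_ge0// invr_ge0 subr_ge0 ltW.
by rewrite invr_ge0 ltW.
Qed.

Lemma test_fun_le y x : `|test_fun y x| <= test_const * rho N (x - y) `^ (1 - g).
Proof.
have /andP[g0 g1] := g01; have a0 := alpha0.
rewrite test_funE normrM ger0_norm; last by rewrite invr_ge0 pi_ge0.
have g2 : 2 * g <= 1 by rewrite /g; lra.
have h := @weight_series_bound R g N g01 N0 1 (x - y) g2 (lexx _).
set W := weight_const g * 2 * _ in h.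
have W0 : 0 <= W * rho N (x - y) `^ (1 - g) by apply: le_trans h.
apply: (@le_trans _ _ (1 * (W * rho N (x - y) `^ (1 - g)))).
  apply: ler_pM => //; first by rewrite invr_ge0 pi_ge0.
  by rewrite invf_le1 ?pi_gt0//; have := @pi_ge2 R; lra.
have -> : test_const * rho N (x - y) `^ (1 - g) = W * rho N (x - y) `^ (1 - g) +
  (2 * pi) `^ (1 - 2 * g) * (W * rho N (x - y) `^ (1 - g)).
  by rewrite /test_const -/W; ring.
by rewrite mul1r lerDl mulr_ge0 ?powR_ge0.
Qed.

Lemma test_lap_le y x : `|test_lap y x| <= test_const * rho N (x - y) `^ (1 - g).
Proof.
have /andP[g0 g1] := g01; have a0 := alpha0.
rewrite test_lapE normrM ger0_norm; last by rewrite divr_ge0 ?powR_ge0 ?pi_ge0.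
have g2 : 2 * g <= 1 by rewrite /g; lra.
have h := @weight_series_bound R g N g01 N0 (2 * g) (x - y) (lexx _) g2.
set W := weight_const g * 2 * _ in h.
have W0 : 0 <= W * rho N (x - y) `^ (1 - g) by apply: le_trans h.
apply: (@le_trans _ _ ((2 * pi) `^ (1 - 2 * g) * (W * rho N (x - y) `^ (1 - g)))).
  apply: ler_pM => //; first by rewrite divr_ge0 ?powR_ge0 ?pi_ge0.
  rewrite ler_pdivrMr ?pi_gt0// ler_peMr ?powR_ge0//.
  by have := @pi_ge2 R; lra.
have -> : test_const * rho N (x - y) `^ (1 - g) = W * rho N (x - y) `^ (1 - g) +
  (2 * pi) `^ (1 - 2 * g) * (W * rho N (x - y) `^ (1 - g)).
  by rewrite /test_const -/W; ring.
by rewrite lerDr.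
Qed.

(* Absorption of the dissipation and of the linear functional by the quadratic
   term, by Young's inequality against the weight [rho ^ (1 + g)]. *)
Lemma pointwise_lower (K v l x y : R) : 0 <= l ->
  `|v| <= K * `|sin (pi * (x - y))| `^ (2 * g) ->
  K ^+ 2 * N%:R `^ (- g) <= g / 2 ->
  2^-1 * l * (v * test_fun y x) -
    (512 * test_const ^+ 2 * (1 + l ^+ 2) + 1) * rho N (x - y) `^ (1 - 2 * g) <=
  - (1 / 2) * (v ^+ 2 * derive1 (test_fun y) x) - v * test_lap y x.
Proof.
have /andP[g0 g1] := g01.
have g2 : g < 1 / 2 by have a0 := alpha0; rewrite /g; lra.
move=> l0 vK KN; rewrite derive1_test_funE.
have rh := rho_ge N0 (x - y); have NR : 0 < N%:R :> R by rewrite ltr0n.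
have gg : 0 < g <= 1 by rewrite g0 ltW.
have r0 := rho_gt0 N0 (x - y).
have X0 : 0 < 256^-1 * rho N (x - y) `^ (1 + g).
  by apply: mulr_gt0; [rewrite invr_gt0; exact: ltr0n|exact: powR_gt0].
apply: (young_pointwise l0 X0 _ (powR_ge0 _ _) (fejer_sum_ge N0 (x - y) gg)).
- by apply: mulr_ge0; [exact: ler0n|exact: sqr_ge0].
- exact: weighted_sqr_le g0 g1 rh (test_fun_le y x).
- exact: weighted_sqr_le g0 g1 rh (test_lap_le y x).
- apply: (concentration_error_le g0 g2 NR r0 (rho_le N0 _) _ (rho_sin N0 _) vK KN).
  + exact: normr_ge0.
  + exact: fejer_ge0.
  + exact: fejer_rho.
  + by rewrite mulr_ge0 ?invr_ge0//; apply: sumr_ge0 => k _; exact: powR_ge0.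
  + rewrite powRD_gt0// powR_inv1 ?(ltW NR)// (mulrC _ N%:R^-1) -mulrA.
    by rewrite ler_wpM2l ?invr_ge0//; exact: sum_powR_concave.
Qed.

End test_functions.

(** * Integrated lower bound and the choice of the translate *)

Section test_pairings.
Context {R : realType}.
Variable alpha : R.
Hypothesis alpha0 : 0 < alpha.
Hypothesis alpha1 : alpha < 1 / 2.

Let g : R := 1 / 2 - alpha.

Let g0 : 0 < g.
Proof. by have := alpha1; rewrite /g => ?; lra. Qed.

Lemma I01_trig_mean n (a b : nat -> R) : a 0%N = 0 -> I01 (trig n a b) = 0.
Proof.
move=> a0; rewrite (@eq_I01 _ _ (fun x => 1 * trig n a b x)); last first.
  by move=> x _; rewrite mul1r.
rewrite I01_trig; last exact: intg_cst.
rewrite big1// => -[|k] _.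
  rewrite a0 mul0r add0r pairingC (_ : pairing _ _ = 0) ?mulr0//.
  rewrite -[RHS](I01_sn 0); apply: eq_I01 => x _; by rewrite mulr1.
rewrite !(pairingC (fun=> 1)).
rewrite (_ : pairing (cs _) _ = 0); last first.
  by rewrite -[RHS](I01_cs k.+1); apply: eq_I01 => x _; rewrite mulr1.
rewrite (_ : pairing (sn _) _ = 0) ?mulr0 ?addr0//.
by rewrite -[RHS](I01_sn k.+1); apply: eq_I01 => x _; rewrite mulr1.
Qed.

Lemma I01_test_fun N y : I01 (@test_fun R alpha N y) = 0.
Proof. by apply: I01_trig_mean; rewrite sn0 mulr0 oppr0. Qed.

Lemma I01_test_lap N y : I01 (@test_lap R alpha N y) = 0.
Proof. by apply: I01_trig_mean; rewrite sn0 mulr0 oppr0 mulr0. Qed.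

Lemma I01_derive1_test_fun N y : I01 (derive1 (@test_fun R alpha N y)) = 0.
Proof. by rewrite derive1_trig; apply: I01_trig_mean; rewrite /freq mulr0 mul0r. Qed.

Lemma continuous_test_fun N y : continuous (@test_fun R alpha N y).
Proof. exact: continuous_trig. Qed.

Lemma continuous_test_lap N y : continuous (@test_lap R alpha N y).
Proof. exact: continuous_trig. Qed.

Lemma continuous_derive1_test_fun N y : continuous (derive1 (@test_fun R alpha N y)).
Proof. by rewrite derive1_trig; exact: continuous_trig. Qed.

Lemma continuousM_fun (u v : R -> R) : continuous u -> continuous v ->
  continuous (fun x => u x * v x).
Proof. by move=> cu cv x; apply: cvgM; [exact: cu|exact: cv]. Qed.

(** Right-hand side of the weak formulation for the translate at [y], that is, the time derivative
    of the pairing; it has no sign. *)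
Definition energy N y (u : R -> R) : R :=
  - (1 / 2) * pairing (fun x => u x ^+ 2) (derive1 (@test_fun R alpha N y)) -
  pairing u (@test_lap R alpha N y).

(** Expanding the square, the subtraction of [c] adds multiples of the integral of [u phi'] and of
    the means of [phi'] and of the fractional Laplacian, all of which vanish. *)
Lemma energy_shift N y (u : R -> R) (c : R) : continuous u ->
  pairing u (derive1 (@test_fun R alpha N y)) = 0 ->
  energy N y u = I01 (fun x => - (1 / 2) * ((u x - c) ^+ 2 * derive1 (@test_fun R alpha N y) x)
     - (u x - c) * @test_lap R alpha N y x).
Proof.
move=> cu u0; set p := derive1 _ in u0 *; set q := test_lap _ _ _.
have cp : continuous p by exact: continuous_derive1_test_fun.
have cq : continuous q by exact: continuous_test_lap.
have iu : intg (fun x => u x * p x) by apply: intg_continuous; exact: continuousM_fun.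
have iq : intg (fun x => u x * q x) by apply: intg_continuous; exact: continuousM_fun.
have iuu : intg (fun x => u x ^+ 2 * p x).
  by apply: intg_continuous; apply: continuousM_fun => //; exact: continuousM_fun.
have ip : intg p by exact: intg_continuous.
have iq1 : intg q by exact: intg_continuous.
rewrite (@eq_I01 _ _ (fun x => (- (1 / 2) * (u x ^+ 2 * p x) + c * (u x * p x)) +
   ((- (c ^+ 2 / 2) * p x) + (c * q x - u x * q x)))); last first.
  by move=> x _; field.
rewrite I01D; [|apply: intgD; exact: intgZ|]; last first.
  by apply: intgD; [exact: intgZ|apply: intgB => //; exact: intgZ].
rewrite I01D; [|exact: intgZ..].
rewrite I01D; [|exact: intgZ|by apply: intgB => //; exact: intgZ].
rewrite I01B//; last exact: intgZ.
rewrite !I01Z// I01_derive1_test_fun I01_test_lap [I01 (fun x => u x * p x)]u0.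
by rewrite /energy -/p -/q !mulr0 addr0 !add0r.
Qed.

(** The index exceeds 1 so that the first mode is present in the test function. *)
Lemma exists_large_index (K c d : R) : 0 < c -> 0 < d ->
  exists2 n : nat, (1 < n)%N & K * n%:R `^ (- c) <= d.
Proof.
move=> c0 d0; have [K0|K0] := leP K 0.
  exists 2%N => //; apply: (@le_trans _ _ 0); last exact: ltW.
  by rewrite mulr_le0_ge0// powR_ge0.
have X0 : 0 <= (K / d) `^ c^-1 by exact: powR_ge0.
exists (Num.truncn ((K / d) `^ c^-1)).+2 => //; set n := _.+2.
have nR : 0 < n%:R :> R by rewrite ltr0n.
have Xn : (K / d) `^ c^-1 <= n%:R.
  by have /andP[_ h] := truncnP X0; apply: (le_trans (ltW h)); rewrite ler_nat.
rewrite powRN ler_pdivrMr ?powR_gt0// mulrC -ler_pdivrMr//.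
have -> : K / d = ((K / d) `^ c^-1) `^ c.
  by rewrite -powRrM mulVf ?gt_eqF// powRr1// divr_ge0// ltW.
by apply: powR_le_gt0 => //; exact: ltW.
Qed.

(** The order of the quantifiers is the point: [k] and [b] come before the Hoelder constant [K], and
    only [N] depends on it. The initial data can then be chosen from [k] and [b] alone. *)
Lemma energy_lower : exists k b : R, [/\ 0 < k, 0 < b & forall K : R,
  exists2 N : nat, (1 < N)%N & forall (u : R -> R) (y : R), continuous u ->
    (forall x, `|u x - u y| <= K * `|sin (pi * (x - y))| `^ (2 * g)) ->
    pairing u (derive1 (@test_fun R alpha N y)) = 0 ->
    0 <= pairing u (@test_fun R alpha N y) ->
    k * pairing u (@test_fun R alpha N y) ^+ 2 - b <= energy N y u].
Proof.
have gp := g0; have a0 := alpha0; have a1 := alpha1.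
have tc0 : 0 <= 512 * @test_const R alpha ^+ 2 by apply: mulr_ge0; [exact: ler0n|exact: sqr_ge0].
set T := 512 * _ in tc0.
have T1 : 0 < T + 1 by exact: ltr_wpDl.
exists (g / (16 * (T + 1))), ((T + 1) / g); split; [|exact: divr_gt0|].
  by rewrite divr_gt0// mulr_gt0.
move=> K; have g2 : 0 < g / 2 by exact: divr_gt0.
have [N N1 KN] := exists_large_index (K ^+ 2) gp g2.
exists N => // u y cu uK u0 J0.
rewrite (energy_shift (u y) cu u0); set J := pairing u _ in J0 *.
have N0 : (0 < N)%N by exact: ltnW.
set l := g * J / (4 * (T + 1)); have l0 : 0 <= l.
  by apply: divr_ge0; apply: mulr_ge0 => //; exact: ltW.
have cv : continuous (fun x => u x - u y).
  by move=> x; apply: cvgB; [exact: cu|exact: cvg_cst].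
have irho : intg (fun x => rho N (x - y) `^ (1 - 2 * g)).
  by apply: intg_continuous; exact: continuous_rho_powR.
have ivf : intg (fun x => (u x - u y) * test_fun alpha N y x).
  by apply: intg_continuous; apply: continuousM_fun => //; exact: continuous_test_fun.
apply: (@le_trans _ _ (I01 (fun x => 2^-1 * l * ((u x - u y) * test_fun alpha N y x) -
    (T * (1 + l ^+ 2) + 1) * rho N (x - y) `^ (1 - 2 * g)))); last first.
  apply: le_I01.
  - by apply: intgB; exact: intgZ.
  - apply: intgB; last first.
      by apply: intg_continuous; apply: continuousM_fun => //; exact: continuous_test_lap.
    apply: intgZ; apply: intg_continuous.
    apply: continuousM_fun; last exact: continuous_derive1_test_fun.
    exact: continuousM_fun.
  - move=> x _; exact: (pointwise_lower alpha0 alpha1 N0 l0 (uK x) KN).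
rewrite I01B; [|exact: intgZ..]; rewrite !I01Z//.
have -> : I01 (fun x => (u x - u y) * test_fun alpha N y x) = J.
  have cf : continuous (test_fun alpha N y) by exact: continuous_test_fun.
  rewrite (@eq_I01 _ _ (fun x => u x * test_fun alpha N y x -
      u y * test_fun alpha N y x)); last first.
    by move=> x _; rewrite mulrBl.
  rewrite I01B; last 2 first.
    by apply: intg_continuous; exact: continuousM_fun.
    by apply: intgZ; exact: intg_continuous.
  by rewrite I01Z ?I01_test_fun ?mulr0 ?subr0//; exact: intg_continuous.
apply: young_choice => //; first by apply: I01_ge0 => x _; exact: powR_ge0.
(* The bound of [I01_rho_le] for the exponent [q = 1 - 2 g]. *)
have -> : g^-1 = 2 / (1 - (1 - 2 * g)).
  by rewrite opprB addrCA subrr addr0 invfM mulrA divff ?mul1r.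
by apply: I01_rho_le => //; rewrite /g; lra.
Qed.

(** As a function of the translation the pairing is itself a trigonometric polynomial: it attains
    its maximum on a period, and its derivative is minus the pairing with [phi']. *)
Lemma maximal_shift N (u : R -> R) : intg u -> exists y : R,
  (forall z, pairing u (@test_fun R alpha N z) <= pairing u (@test_fun R alpha N y)) /\
  pairing u (derive1 (@test_fun R alpha N y)) = 0.
Proof.
move=> iu.
pose p j := pairing u (cs j%:Z); pose q j := pairing u (sn j%:Z).
pose B j := weight_coef g N j * j%:R `^ (- 1) / pi.
pose J := trig N (fun j => B j * q j) (fun j => - (B j * p j)).
have JE z : pairing u (@test_fun R alpha N z) = J z.
  rewrite /pairing -/(I01 _) I01_trig//; apply: eq_bigr => j _.
  by rewrite /= -/(p j) -/(q j) /B /g; ring.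
have dJ (z : R) : is_derive z 1 J (- pairing u (derive1 (@test_fun R alpha N z))).
  apply: (is_derive_congr (is_derive_trig _ _ _ z)).
  rewrite derive1_trig /pairing -/(I01 _) I01_trig// /trig -sumrN.
  by apply: eq_bigr => j _; rewrite -/(p j) -/(q j) /B /g; ring.
have cJ : continuous J by exact: continuous_trig.
have [y y01 ymax] := @EVT_max R J 0 1 ler01 (continuous_subspaceT cJ).
have Jmax z : J z <= J y.
  have -> : J z = J (z + 1 *~ (- Num.floor z)).
    by rewrite periodic_intmul//; exact: periodic_trig.
  apply: ymax; rewrite in_itv/= mulrNz.
  have := Num.Theory.floor_itv z; rewrite intrD => /andP[h1 h2].
  by rewrite subr_ge0 h1/= lerBlDl ltW.
exists y; split; first by move=> z; rewrite !JE.
(* By periodicity the maximum over [[0, 1]] is global; an interval centred at [y] makes it interior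
   even if [y] is 0 or 1. *)
have y0 : y \in `](y - 1), (y + 1)[ by rewrite in_itv/=; apply/andP; split; lra.
have yy : y - 1 <= y + 1 by lra.
have dJ0 := derive1_at_max yy
  (fun t _ => @ex_derive _ _ _ _ _ _ _ (dJ t)) y0 (fun t _ => Jmax t).
have h1 := @derive_val _ _ _ _ _ _ _ dJ0; have h2 := @derive_val _ _ _ _ _ _ _ (dJ y).
by apply/eqP; rewrite -oppr_eq0 -h2 h1.
Qed.

(** Only the first mode pairs with the sine, and its coefficient is at least [1 / (2 pi)] because
    [N >= 2]. *)
Lemma pairing_initial N (A : R) : (1 < N)%N -> 0 <= A ->
  A / (4 * pi) <= pairing (trig 2 (fun=> 0) (fun=> A)) (@test_fun R alpha N 0).
Proof.
move=> N1 A0; have p0 := @pi_gt0 R.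
have iu : intg (@test_fun R alpha N 0).
  by apply: intg_continuous; exact: continuous_test_fun.
have -> : pairing (trig 2 (fun=> 0) (fun=> A)) (@test_fun R alpha N 0) =
   A * pairing (@test_fun R alpha N 0) (sn 1%:Z).
  rewrite pairingC /pairing -!/(I01 _) -I01Z; last first.
    by apply: intgM_continuous => //; exact: continuous_sn.
  apply: eq_I01 => x _.
  have -> : trig 2 (fun=> 0) (fun=> A) x = A * sn 1%:Z x.
    by rewrite /trig 2?big_ltn// big_geq// sn0 !mul0r mulr0 !add0r addr0.
  ring.
rewrite pairing_trig_sn// N1 /cs mulr0 cos0 mulr1 powR1 mulr1.
have N2 : 2^-1 <= 1 - N%:R^-1 :> R.
  have N2R : 2 <= N%:R :> R by rewrite (ler_nat _ 2).
  have : N%:R^-1 <= 2^-1 :> R by rewrite lef_pV2// posrE; lra.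
  lra.
have h := le_trans N2 (weight_coef1_ge (1 / 2 - alpha) (ltnW N1)).
have -> : A / (4 * pi) = A * (2^-1 * (2^-1 / pi)).
  by move: (pi) p0 => P p0; field; exact: lt0r_neq0.
by rewrite ler_wpM2l// ler_wpM2l// ler_wpM2r// invr_ge0 ltW.
Qed.

End test_pairings.

(** * Growth of solutions *)

Section regular_representatives.
Context {R : realType}.
Implicit Types (f h : R -> R) (K e t r T s b : R).

(** [|sin (pi (x - y))|] is comparable to the distance on the circle. For [b > 0] the last condition
    also forces period 1. *)
Definition holder b K (ft : R -> R) : Prop := [/\ continuous ft,
  forall x, `|ft x| <= K &
  forall x y, `|ft x - ft y| <= K * `|sin (pi * (x - y))| `^ b].

Definition representative b K f (ft : R -> R) : Prop := holder b K ft /\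
  {ae (@lebesgue_measure R), forall x, x \in `[0, 1] -> f x = ft x}.

Lemma holderD b K e f h : holder b K f -> holder b e h ->
  holder b (K + e) (fun x => f x + h x).
Proof.
move=> [cf fK fH] [ch he hH]; split.
- by move=> x; apply: cvgD; [exact: cf|exact: ch].
- by move=> x; rewrite (le_trans (ler_normD _ _))// lerD.
- move=> x y; rewrite mulrDl opprD addrACA (le_trans (ler_normD _ _))//.
  exact: lerD.
Qed.

Lemma holderS b K e f : K <= e -> holder b K f -> holder b e f.
Proof.
move=> Ke [cf fK fH]; split=> //.
- by move=> x; exact: le_trans Ke.
- by move=> x y; apply: (le_trans (fH x y)); rewrite ler_wpM2r// powR_ge0.
Qed.

Lemma L2B f h : L2 f -> L2 h -> L2 (f \- h).
Proof.
move=> f2 h2; have mB : measurable_fun (`[0, 1]%classic : set R) (f \- h).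
  by apply: measurable_funB; exact: L2_measurable.
apply: intg_L2 => //; apply: (@le_intg _ _ (fun x => 2 * f x ^+ 2 + 2 * h x ^+ 2)).
- exact: measurable_funX.
- by apply: intgD; apply: intgZ; exact: L2_sqr.
- move=> x _ /=; rewrite ger0_norm ?sqr_ge0// -subr_ge0.
  have -> : 2 * f x ^+ 2 + 2 * h x ^+ 2 - (f x - h x) ^+ 2 = (f x + h x) ^+ 2 by ring.
  exact: sqr_ge0.
Qed.

Lemma mean_zeroB f h : L2 f -> L2 h -> mean_zero f -> mean_zero h ->
  mean_zero (f \- h).
Proof.
move=> f2 h2 f0 h0; rewrite /mean_zero -/(I01 _).
have -> : I01 (f \- h) = I01 f - I01 h by apply: I01B; exact: L2_intg.
by rewrite /I01 f0 h0 subrr.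
Qed.

Lemma Hnorm_representative s b : 0 <= s -> 0 < b <= 1 -> b < s - 1 / 2 ->
  exists2 C : R, 0 < C & forall f e, 0 < e -> L2 f -> mean_zero f ->
    (Hnorm s f < e%:E)%E -> exists ft, representative b (C * e) f ft.
Proof.
move=> s0 b01 bs; have [C C0 HC] := sobolev_embedding s0 b01 bs.
exists C => // f e e0 f2 f0 /ereal_inf_lt[_ [g [g2 fg] <-] ge].
by have [ft [? ? ? ?]] := HC f g e e0 f2 f0 g2 fg ge; exists ft.
Qed.

Lemma Hnorm_small T s (u : R -> R -> R) t e : continuous_Hs T s u ->
  t \in `[0, T] -> 0 < e -> exists2 d : R, 0 < d &
    forall r, r \in `[0, T] -> `|r - t| < d -> (Hnorm s (u r \- u t)%R < e%:E)%E.
Proof.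
move=> cu tT e0; have [_ h] := cu t tT.
have /h : nbhs 0%E [set y : \bar R | (y < e%:E)%E].
  exact: (@nbhs_open_ereal_lt R 0 (fun=> e)).
move=> /nbhs_ballP[d /= d0 Hd]; exists d => // r rT rt.
by apply: Hd => //; rewrite /ball/= distrC.
Qed.

(** Compactness of [[0, T]], through real induction. Near [t] a representative of [u r] is the sum
    of those of [u t] and of [u r - u t], the second being small by continuity in [H^s]. *)
Lemma uniform_representative T s b (u : R -> R -> R) : 0 < T -> 0 <= s ->
  0 < b <= 1 -> b < s - 1 / 2 -> continuous_Hs T s u ->
  exists2 K : R, 0 < K &
    forall t, t \in `[0, T] -> exists ft, representative b K (u t) ft.
Proof.
move=> T0 s0 b01 bs cu; have [C C0 HC] := Hnorm_representative s0 b01 bs.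
pose P t := exists2 K : R, 0 < K &
  forall r, 0 <= r -> r <= t -> exists ft, representative b K (u r) ft.
have in_T r : 0 <= r -> r <= T -> r \in `[0, T] by rewrite in_itv/= => -> ->.
have local t : 0 <= t -> t <= T -> exists2 d : R, 0 < d & exists2 K : R, 0 < K &
    forall r, 0 <= r -> r <= T -> `|r - t| < d ->
      exists ft, representative b K (u r) ft.
  move=> t0 tT; have tI := in_T _ t0 tT; have [[_ t2 tm tH] _] := cu t tI.
  have [d d0 Hd] := Hnorm_small cu tI ltr01; exists d => //.
  have [e e0 te] : exists2 e, 0 < e & (Hnorm s (u t) < e%:E)%E.
    case: (Hnorm s (u t)) tH => [x| |]// _.
      exists (`|x| + 1); first by rewrite ltr_wpDl.
      by rewrite lte_fin (le_lt_trans (ler_norm x))// ltrDl.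
    by exists 1 => //; rewrite ltNyr.
  have [f [fh fae]] := HC _ _ e0 t2 tm te.
  exists (C * e + C * 1); first by rewrite addr_gt0// mulr_gt0.
  move=> r r0 rT rt; have rI := in_T _ r0 rT; have [[_ r2 rm _] _] := cu r rI.
  have [w [wh wae]] := HC _ _ ltr01 (L2B r2 t2) (mean_zeroB r2 t2 rm tm) (Hd r rI rt).
  exists (fun x => f x + w x); split; first exact: holderD.
  by apply: aeS2 fae wae => x h1 h2 x01; rewrite -(h1 x01) -(h2 x01)/= addrC subrK.
suff [K K0 HK] : P T.
  by exists K => // t; rewrite in_itv/= => /andP[? ?]; exact: HK.
(* Gluing of a bound up to [t - d] with a local one around [t]; [K + K'] serves for both. *)
have cover t K K' (d : R) : t <= T -> 0 < K -> 0 < K' ->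
    (forall r, 0 <= r -> r <= t - d -> exists ft, representative b K (u r) ft) ->
    (forall r, 0 <= r -> r <= T -> `|r - t| < d -> exists ft, representative b K' (u r) ft) ->
    forall r', r' < t + d -> r' <= T -> P r'.
  move=> tT K0 K'0 HK HK' r' r'd r'T; exists (K + K'); first exact: addr_gt0.
  move=> r r0 rr; have [rd|rd] := leP r (t - d).
    have [ft [fh fae]] := HK r r0 rd; exists ft; split => //.
    by apply: holderS fh; rewrite lerDl ltW.
  have [|ft [fh fae]] := HK' r r0 (le_trans rr r'T).
    by rewrite ltr_distl rd (le_lt_trans rr).
  by exists ft; split => //; apply: holderS fh; rewrite lerDr ltW.
apply: (@real_induction R 0 T P _ _ _ T (ltW T0) (lexx _)).
- have [d d0 [K K0 HK]] := local 0 (lexx _) (ltW T0); exists K => // r r0 r0'.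
  by apply: HK => //; [exact: le_trans (ltW T0)|rewrite subr0 ger0_norm ?(le_lt_trans r0')].
- move=> t t0 tT [K K0 HK]; have [d d0 [K' K'0 HK']] := local t t0 (ltW tT).
  exists d => // r tr rd rT; apply: (cover t K K' d (ltW tT) K0 K'0 _ HK') => // x x0 xt.
  by apply: HK => //; apply: (le_trans xt); rewrite gerBl ltW.
- move=> t t0 tT Hr; have [d d0 [K' K'0 HK']] := local t (ltW t0) tT.
  have td : t < t + d by rewrite ltrDl.
  have [td0|td0] := leP 0 (t - d).
    have [|K K0 HK] := Hr (t - d) td0; first by rewrite ltrBlDr.
    exact: (cover t K K' d tT K0 K'0 HK HK').
  (* No time in [[0, t - d]] exists here, so any positive constant will do. *)
  apply: (cover t 1 K' d tT ltr01 K'0 _ HK') => // x x0 xt.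
  by have := lt_le_trans td0 x0; rewrite ltNge xt.
Qed.

(** Continuity in time is recorded in L^1 only; together with the uniform bound [K] it controls the
    pairings with [u] and with [u^2]. *)
Lemma regular_solution T s b (u : R -> R -> R) : 0 < T -> 0 <= s ->
  0 < b <= 1 -> b < s - 1 / 2 -> continuous_Hs T s u ->
  exists v : R -> R -> R, exists2 K : R, 0 < K &
    (forall t, t \in `[0, T] -> representative b K (u t) (v t)) /\
    (forall t e, t \in `[0, T] -> 0 < e -> exists2 d : R, 0 < d &
      forall r, r \in `[0, T] -> `|r - t| < d ->
        I01 (fun x => `|v r x - v t x|) <= e).
Proof.
move=> T0 s0 b01 bs cu.
have [K K0 HK] := uniform_representative T0 s0 b01 bs cu.
have [C C0 HC] := Hnorm_representative s0 b01 bs.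
have /choice[v Hv] t : exists w, t \in `[0, T] -> representative b K (u t) w.
  have [tT|tT] := boolP (t \in `[0, T]); last by exists (u t).
  by have [w] := HK t tT; exists w.
exists v, K => //; split => // t e tT e0.
have eC : 0 < e / C by exact: divr_gt0.
have [d d0 Hd] := Hnorm_small cu tT eC; exists d => // r rT rt.
have [[_ t2 tm _] _] := cu t tT; have [[_ r2 rm _] _] := cu r rT.
have [w [[cw wle _] wae]] := HC _ _ eC (L2B r2 t2) (mean_zeroB r2 t2 rm tm) (Hd r rT rt).
have [[cvt _ _] vtae] := Hv t tT; have [[cvr _ _] vrae] := Hv r rT.
have cd : continuous (fun x => `|v r x - v t x|).
  by move=> x; apply: cvg_norm; apply: cvgB; [exact: cvr|exact: cvt].
have cnw : continuous (fun x => `|w x|) by move=> x; apply: cvg_norm; exact: cw.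
rewrite (@ae_eq_I01 _ _ (fun x => `|w x|)); try exact: continuous_measurable01.
  rewrite -[leRHS]I01_cst; apply: le_I01; [exact: intg_continuous|exact: intg_cst|].
  by move=> x _; rewrite (le_trans (wle x))// mulrC divfK// gt_eqF.
have vE : {ae (@lebesgue_measure R), forall x, x \in `[0, 1] ->
    u r x - u t x = v r x - v t x}.
  by apply: aeS2 vrae vtae => x h1 h2 x01; rewrite h1// h2.
by apply: aeS2 wae vE => x h1 h2 x01; rewrite -h1//= h2.
Qed.

End regular_representatives.

(** * Comparison with a quadratic differential equation *)

Section blowup_criterion.
Context {R : realType}.

(* The barrier is [1 / q t] with [q t = 1/m - k t], the solution of the
   equation [y' = k y ^ 2], [y 0 = m]; it becomes infinite at time [T]. *)
Lemma quadratic_growth_blowup (I : Type) (J : R -> I -> R) (k c m T : R) :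
  0 < k -> 0 < c -> 0 < m -> k * m * T = 1 -> (exists y, m <= J 0 y) ->
  (forall t, 0 <= t -> t <= T -> exists y, (forall z, J t z <= J t y) /\
    (m <= J t y -> t < T -> exists2 d : R, 0 < d &
      forall r, t < r -> r < t + d -> r <= T ->
        (k * J t y ^+ 2 + c) * (r - t) <= J r y - J t y)) ->
  (forall t e, 0 <= t -> t <= T -> 0 < e -> exists2 d : R, 0 < d &
    forall r y, 0 <= r -> r <= T -> `|r - t| < d -> J r y <= J t y + e) ->
  False.
Proof.
move=> k0 c0 m0 kmT [y0 my0] Jmax Jcont.
pose q t := m^-1 - k * t.
have T0 : 0 <= T.
  by rewrite -(pmulr_rge0 _ (mulr_gt0 k0 m0)) kmT.
have kT : k * T = m^-1.
  by apply: (mulfI (lt0r_neq0 m0)); rewrite divff ?lt0r_neq0// mulrA (mulrC m).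
have q_sub t r : q r = q t - k * (r - t) by rewrite /q; ring.
have q_ge0 t : t <= T -> 0 <= q t.
  by move=> tT; rewrite /q subr_ge0 -kT ler_wpM2l// ltW.
have q_gt0 t : t < T -> 0 < q t.
  by move=> tT; rewrite /q subr_gt0 -kT ltr_pM2l.
have q_le t : 0 <= t -> q t <= m^-1.
  by move=> t0; rewrite /q gerBl mulr_ge0// ltW.
(* The comparison with [1 / q t] is written as a product, which still makes sense at [T], where
   [q T = 0] turns it into a contradiction. *)
have [y] : exists y, 1 <= J T y * q T; last first.
  by rewrite /q kT subrr mulr0 ler10.
apply: (@real_induction R 0 T (fun t => exists y, 1 <= J t y * q t)) => //.
- by exists y0; rewrite /q mulr0 subr0 ler_pdivlMr// mul1r.
- move=> t t0 tT [z hz].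
  have [y [ymax growth]] := Jmax t t0 (ltW tT).
  have hy : 1 <= J t y * q t.
    by apply: (le_trans hz); rewrite ler_wpM2r ?q_ge0// ltW.
  have Jm : m <= J t y.
    have h : 1 <= J t y * m^-1.
      apply: (le_trans hy); have Jp : 0 < J t y.
        by rewrite -(pmulr_lgt0 _ (q_gt0 t tT)) (lt_le_trans ltr01).
      by rewrite ler_pM2l// q_le.
    by move: h; rewrite ler_pdivlMr// mul1r.
  have J0 : 0 < J t y by exact: lt_le_trans Jm.
  have [d d0 Hd] := growth Jm tT; set j := J t y in hy Jm J0 Hd *.
  pose E := k * j ^+ 2 + c.
  have E0 : 0 < E by rewrite /E addr_gt0// mulr_gt0// exprn_gt0.
  have kjE : 0 < k * j * E by rewrite !mulr_gt0.
  (* Over a time [h] the product gains [c h] and loses [h^2 k j E], so it does not decrease as long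
     as [h k j E <= c]. The surplus [c] is there for this. *)
  exists (Num.min d (c / (k * j * E))); first by rewrite lt_min d0 divr_gt0.
  move=> r tr rd rT; exists y.
  have [rd1 rd2] : r < t + d /\ (r - t) * (k * j * E) <= c.
    move: rd; rewrite -ltrBlDl lt_min ltrBlDl => /andP[-> h]; split=> //.
    by rewrite -ler_pdivlMr// ltW.
  have h0 : 0 <= r - t by rewrite subr_ge0 ltW.
  have hr : j + E * (r - t) <= J r y by rewrite -lerBrDl; exact: Hd.
  apply: (@le_trans _ _ ((j + E * (r - t)) * q r)); last by rewrite ler_wpM2r// q_ge0.
  rewrite -(ler_pM2l J0) mulr1 (q_sub t).
  have -> : j * ((j + E * (r - t)) * (q t - k * (r - t))) =
     (j + E * (r - t)) * (j * q t - j * k * (r - t)) by ring.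
  apply: (@le_trans _ _ ((j + E * (r - t)) * (1 - j * k * (r - t)))); last first.
    by rewrite ler_wpM2l ?lerB// addr_ge0 ?mulr_ge0// ltW.
  have -> : (j + E * (r - t)) * (1 - j * k * (r - t)) =
    j + (r - t) * (c - (r - t) * (k * j * E)) by rewrite /E; ring.
  by rewrite lerDl mulr_ge0// subr_ge0.
- move=> t t0 tT H; have [y [ymax _]] := Jmax t (ltW t0) tT.
  exists y; set j := J t y in ymax *; have qt := q_ge0 t tT.
  rewrite leNgt; apply/negP => jq.
  pose M := `|j| + q t + 1.
  have M0 : 0 < M by rewrite /M ltr_wpDl// addr_ge0.
  (* If the maximum [j] at [t] fails the bound, then at an earlier nearby time every [J x z] is at
     most [j + e] and [q x] at most [q t + e]; [e] is so small that [(j + e) (q t + e)] stays below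
     1. *)
  pose e := Num.min 1 ((1 - j * q t) / (2 * M)).
  have e0 : 0 < e by rewrite /e lt_min ltr01 divr_gt0 ?subr_gt0// mulr_gt0.
  have e1 : e <= 1 by rewrite /e ge_min lexx.
  have e2 : e * M <= (1 - j * q t) / 2.
    have : e <= (1 - j * q t) / (2 * M) by rewrite /e ge_min lexx orbT.
    by rewrite invfM mulrA ler_pdivlMr.
  have [d d0 Hd] := Jcont t e (ltW t0) tT e0.
  pose x := Num.max (t / 2) (Num.max (t - d / 2) (t - e / k)).
  have ek : 0 < e / k by rewrite divr_gt0.
  have xt : x < t by rewrite /x !gt_max; apply/and3P; split; lra.
  have x0 : 0 <= x by rewrite /x le_max; apply/orP; left; lra.
  have xd : t - d / 2 <= x by rewrite /x !le_max lexx orbT.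
  have xe : t - e / k <= x by rewrite /x !le_max lexx !orbT.
  have [z hz] := H x x0 xt.
  have qx : 0 < q x by apply: q_gt0; exact: lt_le_trans tT.
  have jx : J x z <= j + e.
    have xdt : `|x - t| < d by rewrite ltr_distl; apply/andP; split; lra.
    apply: (le_trans (Hd x z x0 (le_trans (ltW xt) tT) xdt)).
    by rewrite lerD2r.
  have qe : q x <= q t + e.
    rewrite (q_sub t x) lerD2l -mulrN opprB.
    by rewrite -ler_pdivlMl// mulrC; lra.
  have h1 : 1 <= (j + e) * q x by apply: (le_trans hz); rewrite ler_pM2r.
  have je : 0 < j + e by rewrite -(pmulr_lgt0 _ qx) (lt_le_trans ltr01).
  have h2 : 1 <= (j + e) * (q t + e) by apply: (le_trans h1); rewrite ler_pM2l.
  have h3 : e * (j + q t + e) <= e * M.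
    by rewrite ler_pM2l// /M lerD// lerD2r ler_norm.
  have h4 : (j + e) * (q t + e) = j * q t + e * (j + q t + e) by ring.
  rewrite h4 in h2; lra.
Qed.

End blowup_criterion.

(** * Evolution of the pairings along a solution *)

Section solution_growth.
Context {R : realType}.
Implicit Types (f h p : R -> R) (u v : R -> R -> R) (K M e t r T b alpha : R).

Lemma pairing_dist f h p M : continuous f -> continuous h -> continuous p ->
  {in `[0, 1], forall x, `|p x| <= M} ->
  `|pairing f p - pairing h p| <= M * I01 (fun x => `|f x - h x|).
Proof.
move=> cf ch cp pM.
have cfh : continuous (fun x => f x - h x) by move=> x; apply: cvgB; [exact: cf|exact: ch].
have cn : continuous (fun x => `|f x - h x|) by move=> x; apply: cvg_norm; exact: cfh.
have cfhp := continuousM_fun cfh cp.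
have -> : pairing f p - pairing h p = I01 (fun x => (f x - h x) * p x).
  rewrite /pairing -!/(I01 _) -I01B; last 2 first.
    by apply: intg_continuous; exact: continuousM_fun.
    by apply: intg_continuous; exact: continuousM_fun.
  by apply: eq_I01 => x _; rewrite mulrBl.
rewrite (le_trans (le_normr_Rintegral _ (intg_continuous cfhp)))//.
rewrite -I01Z; last exact: intg_continuous.
apply: le_I01.
- by apply: intg_continuous => x; apply: cvg_norm; exact: cfhp.
- by apply: intgZ; exact: intg_continuous.
- by move=> x x01; rewrite normrM mulrC ler_wpM2r// pM.
Qed.

Lemma pairing_sqr_dist f h p K M : 0 <= M -> continuous f -> continuous h ->
  continuous p -> (forall x, `|f x| <= K) -> (forall x, `|h x| <= K) ->
  {in `[0, 1], forall x, `|p x| <= M} ->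
  `|pairing (fun x => f x ^+ 2) p - pairing (fun x => h x ^+ 2) p| <=
  M * (2 * K) * I01 (fun x => `|f x - h x|).
Proof.
move=> M0 cf ch cp fK hK pM.
have cn : continuous (fun x => `|f x - h x|).
  by move=> x; apply: cvg_norm; apply: cvgB; [exact: cf|exact: ch].
have cf2 := continuousM_fun cf cf; have ch2 := continuousM_fun ch ch.
apply: (le_trans (pairing_dist cf2 ch2 cp pM)).
rewrite -mulrA ler_wpM2l// -I01Z; last exact: intg_continuous.
apply: le_I01; last 1 first.
- move=> x _; have -> : f x * f x - h x * h x = (f x + h x) * (f x - h x) by ring.
  rewrite normrM ler_wpM2r// (le_trans (ler_normD _ _))// mulr_natl mulr2n.
  exact: lerD.
- apply: intg_continuous => x; apply: cvg_norm.
  by apply: cvgB; [exact: cf2|exact: ch2].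
- by apply: intgZ; exact: intg_continuous.
Qed.

Lemma energy_dist alpha N (y K : R) : exists2 M, 0 < M & forall f h,
  continuous f -> continuous h ->
  (forall x, `|f x| <= K) -> (forall x, `|h x| <= K) ->
  energy alpha N y h - M * I01 (fun x => `|f x - h x|) <= energy alpha N y f.
Proof.
have cp := @continuous_derive1_test_fun R alpha N y.
have cq := @continuous_test_lap R alpha N y.
have [M1 M10 HM1] := continuous_bounded01 cp.
have [M2 M20 HM2] := continuous_bounded01 cq.
exists (M1 * `|K| + M2); first by rewrite ltr_wpDl// mulr_ge0// ltW.
move=> f h cf ch fK hK.
have h1 := pairing_sqr_dist (ltW M10) cf ch cp fK hK HM1.
have h2 := pairing_dist cf ch cq HM2.
set D := I01 _ in h1 h2 *.
have D0 : 0 <= D by apply: I01_ge0 => x _; exact: normr_ge0.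
have h3 : M1 * (2 * K) * D <= 2 * (M1 * `|K| * D).
  have : M1 * K * D <= M1 * `|K| * D by rewrite ler_wpM2r// ler_wpM2l ?ler_norm// ltW.
  lra.
move: h1 h2; rewrite /energy !ler_norml => /andP[_ h1] /andP[_ h2].
rewrite mulrDl; lra.
Qed.

Lemma pairing_representative b K f ft p : L2 f -> representative b K f ft ->
  continuous p -> pairing f p = pairing ft p.
Proof.
move=> f2 [[cf _ _] fft] cp; apply: ae_eq_I01.
- by apply: measurable_funM; [exact: L2_measurable|exact: continuous_measurable01].
- by apply: continuous_measurable01; exact: continuousM_fun.
- by apply: aeS fft => x h x01; rewrite h.
Qed.

Lemma pairing_sqr_representative b K f ft p : L2 f -> representative b K f ft ->
  continuous p -> pairing (fun x => f x ^+ 2) p = pairing (fun x => ft x ^+ 2) p.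
Proof.
move=> f2 [[cf _ _] fft] cp; apply: ae_eq_I01.
- apply: measurable_funM; last exact: continuous_measurable01.
  by apply: measurable_funX; exact: L2_measurable.
- apply: continuous_measurable01; apply: continuousM_fun => //.
  exact: continuousM_fun.
- by apply: aeS fft => x h x01; rewrite h.
Qed.

(** The translate [y] is frozen. At times near [t] the almost everywhere derivative of the pairing
    is the energy of a function close to [v t] in L^1, hence at least the energy at [t] minus [e];
    absolute continuity integrates this bound. *)
Lemma energy_growth alpha T (u0 : R -> R) u v b K N (y : R) t e :
  0 < alpha -> alpha < 1 / 2 -> (0 < N)%N ->
  weak_solution alpha T u0 u -> (forall r, r \in `[0, T] -> L2 (u r)) ->
  (forall r, r \in `[0, T] -> representative b K (u r) (v r)) ->
  (forall e, 0 < e -> exists2 d : R, 0 < d &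
     forall r, r \in `[0, T] -> `|r - t| < d ->
       I01 (fun x => `|v r x - v t x|) <= e) ->
  0 <= t -> t < T -> 0 < e -> exists2 d : R, 0 < d &
    forall r, t < r -> r < t + d -> r <= T ->
      (energy alpha N y (v t) - e) * (r - t) <=
      pairing (v r) (test_fun alpha N y) - pairing (v t) (test_fun alpha N y).
Proof.
move=> a0 a1 N0 wu u2 uv vcont t0 tT e0.
set phi := test_fun alpha N y; set psi := test_lap alpha N y.
have cphi : continuous phi by exact: continuous_test_fun.
have cpsi : continuous psi by exact: continuous_test_lap.
have cp : continuous (derive1 phi) by exact: continuous_derive1_test_fun.
have [acu du _] := wu phi psi (@smooth_trig _ _ _ _) (@periodic_trig _ _ _ _)
  (L2_continuous cpsi) (test_lapP _ _ _).
have [M M0 HM] := energy_dist alpha N y K.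
have [d d0 Hd] := vcont (e / M) (divr_gt0 e0 M0).
have in_T r : 0 <= r -> r <= T -> r \in `[0, T] by rewrite in_itv/= => -> ->.
have tI := in_T t t0 (ltW tT).
have [[cvt vtK _] _] := uv t tI.
exists d => // r tr rd rT; have r0 : 0 <= r by apply: (le_trans t0); exact: ltW.
have rI := in_T r r0 rT.
rewrite -(pairing_representative (u2 r rI) (uv r rI) cphi).
rewrite -(pairing_representative (u2 t tI) (uv t tI) cphi).
apply: (absolutely_continuous_ge (ltW tr) (absolutely_continuous_itvS t0 rT acu)).
apply: aeS du => x hx; rewrite in_itv/= => /andP[tx xr].
have x0T : x \in `]0, T[.
  by rewrite in_itv/= (le_lt_trans t0 tx) (lt_le_trans xr rT).
have xI : x \in `[0, T] by apply: in_T; apply: ltW; move: x0T; rewrite in_itv/= => /andP[].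
have xt : `|x - t| < d by rewrite ger0_norm ?subr_ge0 ?ltrBlDl//; [exact: lt_trans rd|exact: ltW].
have [[cvx vxK _] _] := uv x xI.
exists (energy alpha N y (v x)).
  apply: le_trans (HM _ _ cvx cvt vxK vtK); rewrite lerD2l lerN2.
  by rewrite -ler_pdivlMl// mulrC; exact: Hd.
have -> : energy alpha N y (v x) =
    - (1 / 2) * pairing (fun z => u x z ^+ 2) (derive1 phi) - pairing (u x) psi.
  rewrite (pairing_sqr_representative (u2 x xI) (uv x xI) cp).
  by rewrite (pairing_representative (u2 x xI) (uv x xI) cpsi).
exact: hx.
Qed.

Lemma test_fun_bound alpha N : 0 < alpha -> alpha < 1 / 2 -> (0 < N)%N ->
  exists2 M, 0 < M & forall y x : R, `|test_fun alpha N y x| <= M.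
Proof.
move=> a0 a1 N0; have tc := test_const_ge0 a0 a1.
exists (test_const alpha * N%:R `^ (1 / 2 + alpha) + 1).
  by rewrite ltr_wpDl// mulr_ge0// powR_ge0.
move=> y x; apply: (le_trans (test_fun_le a0 a1 N0 y x)).
rewrite (_ : 1 - _ = 1 / 2 + alpha); last by field.
apply: (@le_trans _ _ (test_const alpha * N%:R `^ (1 / 2 + alpha))); last by rewrite lerDl.
rewrite ler_wpM2l//; apply: powR_le_gt0; [lra|exact: (ltW (rho_gt0 N0 _))|exact: (rho_le N0)].
Qed.

End solution_growth.

Theorem theorem1p4 (R : realType) (alpha : R)
    (alpha_gt0 : 0 < alpha) (alpha_lt : alpha < 1 / 2) :
  exists u0 : R -> R,
    [/\ smooth u0, periodic u0 1, mean_zero u0 &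
        forall s : R, 3 / 2 - 2 * alpha < s -> blows_up alpha s u0].
Proof.
have [k [b [k0 b0 HE]]] := energy_lower alpha_gt0 alpha_lt.
(* Half of [k J^2] must pay for [b], for the error 1 of [energy_growth] and for the surplus 1 of the
   barrier as soon as [J >= m]; hence [b + 2]. *)
pose m := 2 * (b + 2) / k + 1.
have m1 : 1 <= m by rewrite lerDr divr_ge0 ?mulr_ge0 ?addr_ge0// ltW.
have m0 : 0 < m by exact: lt_le_trans m1.
have km : b + 2 <= k / 2 * m ^+ 2.
  have -> : b + 2 = k / 2 * (m - 1) by rewrite /m; field; exact: lt0r_neq0.
  rewrite ler_wpM2l//; first by rewrite divr_ge0// ltW.
  have : m <= m * m by rewrite ler_peMl// ltW.
  rewrite expr2; lra.
have k2 : 0 < k / 2 by exact: divr_gt0.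
(* The amplitude for which [pairing_initial] gives the value [m] at time 0. *)
pose A := 4 * pi * m.
have A0 : 0 <= A by rewrite !mulr_ge0 ?pi_ge0// ltW.
exists (trig 2 (fun=> 0) (fun=> A)); split.
- exact: smooth_trig.
- exact: periodic_trig.
- exact: I01_trig_mean.
(* The time at which the barrier starting from [m] with rate [k / 2] becomes infinite; it depends
   neither on [s] nor on the solution. *)
move=> s hs; pose T := (k / 2 * m)^-1.
have km0 : 0 < k / 2 * m by exact: mulr_gt0.
have T0 : 0 < T by rewrite invr_gt0.
exists T => // -[u [cu wu]].
(* The Hoelder exponent [2 g = 1 - 2 alpha]: the hypothesis on [s] is precisely [g2 < s - 1/2]. *)
pose g2 := 2 * (1 / 2 - alpha).
have [|||v [K K0 [uv vcont]]] := @regular_solution R T s g2 u T0 _ _ _ cu.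
- lra.
- by rewrite /g2; apply/andP; split; lra.
- rewrite /g2; lra.
(* Only now, with the Hoelder constant of the given solution known, is the order of the test
   function fixed. *)
have [N N1 HN] := HE K; have N0 : (0 < N)%N by exact: ltnW.
have in_T r : 0 <= r -> r <= T -> r \in `[0, T] by rewrite in_itv/= => -> ->.
have u2 r : r \in `[0, T] -> L2 (u r) by move=> /cu[[]].
apply: (@quadratic_growth_blowup R R
  (fun t y => pairing (v t) (test_fun alpha N y)) (k / 2) 1 m T) => //.
- by rewrite /T divff// lt0r_neq0.
- exists 0; have I0 := in_T 0 (lexx _) (ltW T0).
  have cphi := @continuous_test_fun R alpha N 0.
  have cpsi := @continuous_test_lap R alpha N 0.
  have [_ _ h0] := wu (test_fun alpha N 0) (test_lap alpha N 0) (@smooth_trig _ _ _ _)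
    (@periodic_trig _ _ _ _) (L2_continuous cpsi) (test_lapP _ _ _).
  rewrite -(pairing_representative (u2 0 I0) (uv 0 I0) cphi) h0.
  apply: le_trans (pairing_initial alpha N1 A0).
  by rewrite /A mulrAC divff ?mul1r// lt0r_neq0// mulr_gt0// pi_gt0.
- move=> t t0 tT; have tI := in_T t t0 tT; have [[cv _ vH] _] := uv t tI.
  have [y [ymax y0]] := maximal_shift alpha N (intg_continuous cv).
  exists y; split => // mJ tT'.
  (* The allowed loss is 1, so the rate is at least [k J^2 - b - 1], which is at least
     [k / 2 J^2 + 1] since [J >= m]. *)
  have [d d0 Hd] := energy_growth y alpha_gt0 alpha_lt N0 wu u2 uv
    (fun e => vcont t e tI) t0 tT' ltr01.
  exists d => // r tr rd rT; apply: le_trans (Hd r tr rd rT).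
  rewrite ler_wpM2r ?subr_ge0 ?(ltW tr)//.
  have J0 := le_trans (ltW m0) mJ.
  have hE := HN (v t) y cv (fun x => vH x y) y0 J0.
  set J := pairing _ _ in mJ J0 hE *.
  have mJ2 : k / 2 * m ^+ 2 <= k / 2 * J ^+ 2.
    by rewrite ler_wpM2l ?(ltW k2)// lerXn2r// nnegrE// ltW.
  lra.
- move=> t e t0 tT e0; have tI := in_T t t0 tT; have [[cvt _ _] _] := uv t tI.
  have [M M0 HM] := test_fun_bound alpha_gt0 alpha_lt N0.
  have [d d0 Hd] := vcont t (e / M) tI (divr_gt0 e0 M0).
  exists d => // r y r0 rT rt; have rI := in_T r r0 rT; have [[cvr _ _] _] := uv r rI.
  have cphi := @continuous_test_fun R alpha N y.
  have := pairing_dist cvr cvt cphi (fun x _ => HM y x).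
  rewrite ler_norml => /andP[_]; rewrite lerBlDl => h; apply: (le_trans h).
  by rewrite lerD2l -ler_pdivlMl// mulrC; exact: Hd.
Qed.
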